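(* Let $G$ be a simple, connected, undirected, anonymous, port-labeled graph with $n$ nodes, $m$ edges and maximum degree $\Delta$. Let $k=n$ mobile agents be placed arbitrarily on the nodes of $G$, occupying $p$ distinct nodes in the initial configuration, where the agents have no prior knowledge of any of the global parameters $n$, $m$, $k$, $p$, $\Delta$. Then there is a deterministic algorithm that solves the Distance-2-Dispersion (D-2-D) problem with termination in $O(\max\{n\log^2 n, m\})$ synchronous rounds, with each agent using $O(\log n)$ bits of memory.
   Context: Model: the nodes of $G$ have no identifiers and no memory (zero storage). At each node $v$ of degree $\delta(v)$ the incident edges carry distinct local port numbers from $\{0,\dots,\delta(v)-1\}$; the two port numbers at the ends of an edge are independent. Each agent has a unique identifier from $\{1,\dots,n^c\}$ for some constant $c$. Agents are always located at nodes, never on edges. Only agents at the same node can communicate (face-to-face communication). An agent at a node sees the port numbers at that node and knows the port through which it entered the node. Execution proceeds in synchronous rounds: in each round an agent communicates with co-located agents, computes, and then either stays or moves along one incident edge. Time complexity is the number of rounds until all agents terminate; memory complexity is the number of bits each agent needs. D-2-D problem (with $n$ agents): the agents must reach a final configuration, and terminate, in which every agent is settled at some node such that (i) no two adjacent nodes are both occupied by settled agents, and (ii) an agent settles at a node already containing a settled agent only if there is no empty node available at which it could settle while satisfying (i). (Equivalently, the set of occupied nodes forms a maximal independent set of $G$.) *)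

(* Defs.v *)
From mathcomp Require Import all_boot.
Set Implicit Arguments. Unset Strict Implicit. Unset Printing Implicit Defensive.

Definition simple_graph (V : finType) (adj : rel V) :=
  symmetric adj /\ irreflexive adj.

Definition connected_graph (V : finType) (adj : rel V) :=
  forall u v : V, connect adj u v.

Definition deg (V : finType) (adj : rel V) (v : V) : nat :=
  #|[pred w | adj v w]|.

Definition num_edges (V : finType) (adj : rel V) : nat :=
  #|[pred e : V * V | adj e.1 e.2]| %/ 2.

(* port v i = the neighbour of v reached through local port i (i < deg v);
   the ports 0..deg v - 1 are pairwise distinct edges, hence a bijection
   onto the neighbourhood of v. *)
Definition port_labeling (V : finType) (adj : rel V) (port : V -> nat -> V) :=
  forall v : V,
    {in [pred i | i < deg adj v] &, injective (port v)} /\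
    (forall i, i < deg adj v -> adj v (port v i)).

Definition rport (V : finType) (adj : rel V) (port : V -> nat -> V)
  (w v : V) : nat :=
  find (fun j => port w j == v) (iota 0 (deg adj w)).

Inductive action := Stay | Move of nat | Halt.

(* A deterministic algorithm, uniform (it receives no global parameter).
   The agent's memory is its state; [encode] is an injective encoding of
   states as bit strings, used to measure memory in bits.
   [transition s d e others] : own state s, degree d of the current node,
   port e through which the agent entered the current node (None if it never
   moved), and the states of the other agents currently at the same node
   (face-to-face communication); it returns the new state and the action. *)
Record algorithm := Algorithm {
  state : Type;
  encode : state -> seq bool;
  encode_inj : injective encode;
  init : nat -> state;
  transition : state -> nat -> option nat -> seq state -> state * action
}.

Record agent_conf (V : finType) (A : algorithm) := AC {
  loc : V;
  st : state A;
  entry : option nat;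
  halted : bool
}.

Definition init_conf (V : finType) (A : algorithm) (N : nat)
  (pos0 : 'I_N -> V) (id : 'I_N -> nat) : 'I_N -> agent_conf V A :=
  fun a => AC (pos0 a) (init A (id a)) None false.

Definition others (V : finType) (A : algorithm) (N : nat)
  (c : 'I_N -> agent_conf V A) (a : 'I_N) : seq (state A) :=
  [seq st (c b) | b <- enum 'I_N & (b != a) && (loc (c b) == loc (c a))].

Definition step_agent (V : finType) (adj : rel V) (port : V -> nat -> V)
  (A : algorithm) (N : nat) (c : 'I_N -> agent_conf V A) (a : 'I_N)
  : agent_conf V A :=
  let ca := c a in
  if halted ca then ca else
  let (s', act) := transition (st ca) (deg adj (loc ca)) (entry ca) (others c a) in
  match act with
  | Stay => AC (loc ca) s' (entry ca) false
  | Halt => AC (loc ca) s' (entry ca) true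
  | Move i =>
      if i < deg adj (loc ca) then
        let w := port (loc ca) i in
        AC w s' (Some (rport adj port w (loc ca))) false
      else AC (loc ca) s' (entry ca) false
  end.

Fixpoint run (V : finType) (adj : rel V) (port : V -> nat -> V)
  (A : algorithm) (N : nat) (pos0 : 'I_N -> V) (id : 'I_N -> nat) (t : nat)
  : 'I_N -> agent_conf V A :=
  match t with
  | 0 => init_conf A pos0 id
  | t'.+1 => fun a => step_agent adj port (run adj port A pos0 id t') a
  end.

Definition occupied (V : finType) (A : algorithm) (N : nat)
  (c : 'I_N -> agent_conf V A) : {set V} :=
  [set v | [exists a, loc (c a) == v]].

Definition maximal_independent (V : finType) (adj : rel V) (S : {set V}) :=
  (forall u v, u \in S -> v \in S -> ~~ adj u v) /\
  (forall v, v \notin S -> exists2 u, u \in S & adj v u).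

Definition solves_D2D_at (V : finType) (adj : rel V) (port : V -> nat -> V)
  (A : algorithm) (N : nat) (pos0 : 'I_N -> V) (id : 'I_N -> nat) (T : nat) :=
  (forall a, halted (run adj port A pos0 id T a)) /\
  maximal_independent adj (occupied (run adj port A pos0 id T)).

(* log n, rounded so that it is >= 1 *)
Definition lg (n : nat) : nat := (trunc_log 2 n).+1.

(* Main.v *)
(* All agents run in lock step through epochs e = 0, 1, 2, ..., epoch e being correct
   whenever n <= 2 ^ e and m <= 2 ^ e * (e + 1) ^ 2, and harmless otherwise.

   Its first part makes the positions distinct. Agents on a common node form a group
   that grows a depth-first tree of settled agents; the free neighbour of the head is
   found in O(e) rounds by probing with recruited members, a doubling number at a time.
   A group that touches another one freezes, and its spare agents then walk along the
   stack to its head and over to the touched group. All spares end on limit cycles of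
   this functional graph and gather there at the points of maximal key, so each phase at
   least halves the number of nodes holding several agents, and e + 1 phases suffice.

   Its second part elects a leader by simultaneous depth-first traversals in which a
   larger key captures the homes of smaller ones. A traversal can only be delayed by an
   absent home, which costs O(log n) cycles, and only at its n captures. A completed
   traversal certifies that every node is occupied, hence that the positions are
   distinct; the winner traverses once more, and agents then read off a greedy maximal
   independent set: a node belongs to it when it is left by the traversal with no
   neighbour known to belong. Without a winner, no agent stops and the next epoch starts.

   The lengths of the epochs grow geometrically, and all counters and registers are
   polynomial in n, which bounds the memory. *)

Require Import Defs.
From mathcomp Require Import all_boot zify.
Set Implicit Arguments. Unset Strict Implicit. Unset Printing Implicit Defensive.

(** * Synchronous runs of a sub-protocol *)

(** With exactly [n] agents for [n] nodes, the two parts meet opposite obstacles. While some node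
    holds several agents, another one is empty; so a group with spares never spans the graph, and it
    either uses them up or touches another group. Once the agents are dispersed, nobody is left over
    to carry a token: a home that explores leaves its own node empty, and two neighbours exploring
    each other at the same time would miss each other forever. The identifiers, read as bit words,
    break this symmetry, which is the source of the logarithm in the price of a capture.

    Since [n] is unknown, success has to be certified. The certificate is a count: if every node has
    a home, all [n] agents are homes. This argument does not refer to the epoch, so only progress,
    never correctness, depends on [e] being large enough.

    The budget [2 ^ e * (e + 1) ^ 2] is the cost of the first part, [e + 1] phases of [2 * 2 ^ e]
    searches of [3 * e + 4] rounds; up to a constant it also pays for the traversals, which take
    time linear in [m] plus [n * e] for the captures. *)

Section MaxOver.
Variable T : Type.
(** Agents read numbers from each other through maxima, which do not depend on the order of the
    list. Mostly all carriers agree, and the maximum merely reads their common value. As 0 stands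
    for absence, ports that may be missing are stored plus one. *)
Definition maxo (f : T -> nat) (s : seq T) : nat := \max_(o <- s) f o.
End MaxOver.

(* A configuration seen by one sub-protocol: location, entry port, and only the
   component of the agent's state that belongs to the sub-protocol. *)
Record cell (V : finType) (S : Type) := Cell { cl : V; ce : option nat; cs : S }.

Section Reduced.
Variables (V : finType) (adj : rel V) (port : V -> nat -> V).
Hypothesis adjS : symmetric adj.
Hypothesis adjI : irreflexive adj.
Hypothesis portP : port_labeling adj port.
Notation deg := (deg adj).
Notation rport := (rport adj port).

Lemma port_adj v i : i < deg v -> adj v (port v i).
Proof. by case: (portP v) => _; apply. Qed.

Lemma port_inj v i j : i < deg v -> j < deg v -> port v i = port v j -> i = j.
Proof. by move=> Hi Hj; case: (portP v) => H _; apply: H. Qed.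

(** An injection between finite sets of the same size [deg v] is onto. *)
Lemma port_surj v w : adj v w -> exists2 i, i < deg v & port v i = w.
Proof.
move=> vw.
pose f (i : 'I_(deg v)) := port v i.
have fi : injective f.
  by move=> i j /(port_inj (ltn_ord i) (ltn_ord j)) /val_inj.
have sub : codom f \subset [pred w | adj v w].
  by apply/subsetP=> x /codomP [i ->]; rewrite inE; apply: port_adj.
have card : #|codom f| = deg v by rewrite card_codom // card_ord.
have /subset_cardP : #|codom f| = #|[pred w | adj v w]| by rewrite card.
move=> /(_ sub) /(_ w); rewrite [in RHS]inE vw => /codomP [i ->].
by exists i.
Qed.

Lemma rportP w v : adj w v -> rport w v < deg w /\ port w (rport w v) = v.
Proof.
move=> /port_surj [i Hi <-]; rewrite /Defs.rport.
set p := (fun j => _).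
have hp : has p (iota 0 (deg w)).
  by apply/hasP; exists i; rewrite ?mem_iota /p //=.
have := hp; rewrite has_find size_iota => lt; split=> //.
by have := nth_find 0 hp; rewrite nth_iota // add0n => /eqP.
Qed.

Lemma rport_back w p : p < deg w ->
  rport (port w p) w < deg (port w p) /\ port (port w p) (rport (port w p) w) = w.
Proof. by move=> Hp; apply: rportP; rewrite adjS; apply: port_adj. Qed.

Lemma rport_port w p : p < deg w -> rport w (port w p) = p.
Proof.
move=> Hp; have [H1 H2] := rportP (port_adj Hp).
exact: port_inj H2.
Qed.

Lemma port_neq w p : p < deg w -> port w p != w.
Proof.
by move=> /port_adj H; apply/eqP=> E; rewrite E adjI in H.
Qed.

Lemma deg_lt v : deg v < #|V|.
Proof.
rewrite /Defs.deg; apply: proper_card; apply/properP; split.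
  by apply/subsetP.
by exists v; rewrite // inE adjI.
Qed.

Variables (N : nat) (id : 'I_N -> nat).

Section Step.
Variables (S : Type).
Definition view (x : 'I_N -> cell V S) a : seq (nat * S) :=
  [seq (id b, cs (x b)) | b <- enum 'I_N & (b != a) && (cl (x b) == cl (x a))].

Definition moveto (S' : Type) (l : V) (en : option nat) (s' : S') (m : option nat) :=
  if m is Some i then
    if i < deg l then Cell (port l i) (Some (rport (port l i) l)) s' else Cell l en s'
  else Cell l en s'.

Definition rstep_def (tr : nat -> S -> nat -> option nat -> seq (nat * S) -> S * option nat)
    (x : 'I_N -> cell V S) (a : 'I_N) : cell V S :=
  let r := tr (id a) (cs (x a)) (deg (cl (x a))) (ce (x a)) (view x a) in
  moveto (cl (x a)) (ce (x a)) r.1 r.2.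

(* Sealed, since simplification would otherwise unfold a step at every occurrence. *)
Lemma rstep_seal : {f | f = rstep_def}.
Proof. by exists rstep_def. Qed.
Definition rstep := sval rstep_seal.

Lemma rstepE tr x a : rstep tr x a =
  let r := tr (id a) (cs (x a)) (deg (cl (x a))) (ce (x a)) (view x a) in
  moveto (cl (x a)) (ce (x a)) r.1 r.2.
Proof. by rewrite /rstep (svalP rstep_seal). Qed.

Lemma has_view P x a :
  has P (view x a) =
  [exists b, [&& b != a, cl (x b) == cl (x a) & P (id b, cs (x b))]].
Proof.
rewrite has_map; apply/idP/idP.
  move=> /hasP[b]; rewrite mem_filter => /andP[/andP[H1 H2] _] H3.
  by apply/existsP; exists b; rewrite H1 H2.
move=> /existsP[b /and3P[H1 H2 H3]]; apply/hasP; exists b => //.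
by rewrite mem_filter H1 H2 mem_enum.
Qed.

Lemma maxo_view f x a :
  maxo f (view x a) =
  \max_(b | (b != a) && (cl (x b) == cl (x a))) f (id b, cs (x b)).
Proof. by rewrite /maxo big_map big_filter big_enum_cond; apply: eq_bigl. Qed.

Lemma maxo_view_ge f x a b : b != a -> cl (x b) = cl (x a) ->
  f (id b, cs (x b)) <= maxo f (view x a).
Proof.
move=> ba E; rewrite maxo_view.
by apply: (@leq_bigmax_cond _ _ (fun b => f (id b, cs (x b)))); rewrite ba E eqxx.
Qed.

Lemma maxo_viewP f x a :
  maxo f (view x a) = 0 \/
  exists b, [/\ b != a, cl (x b) = cl (x a) & maxo f (view x a) = f (id b, cs (x b))].
Proof.
rewrite maxo_view.
case: (pickP (fun b => (b != a) && (cl (x b) == cl (x a)))) => [b Hb|H0].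
  right; rewrite (bigmax_eq_arg b Hb).
  by case: arg_maxnP => // i /andP[H1 /eqP H2] _; exists i.
by left; rewrite big_pred0.
Qed.

Lemma maxo_view_eq f x a b k : b != a -> cl (x b) = cl (x a) ->
  f (id b, cs (x b)) = k ->
  (forall b', b' != a -> cl (x b') = cl (x a) -> f (id b', cs (x b')) <= k) ->
  maxo f (view x a) = k.
Proof.
move=> ba E fk H; apply/eqP; rewrite eqn_leq; apply/andP; split.
  by case: (maxo_viewP f x a) => [->//|[b' [H1 H2 ->]]]; apply: H.
by rewrite -fk; apply: maxo_view_ge.
Qed.

Lemma maxo_view0 f x a :
  (forall b, b != a -> cl (x b) = cl (x a) -> f (id b, cs (x b)) = 0) ->
  maxo f (view x a) = 0.
Proof.
by move=> H; case: (maxo_viewP f x a) => // [[b [H1 H2 ->]]]; apply: H.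
Qed.

Lemma maxo_view_le f x a k :
  (forall b, b != a -> cl (x b) = cl (x a) -> f (id b, cs (x b)) <= k) ->
  maxo f (view x a) <= k.
Proof.
by move=> H; case: (maxo_viewP f x a) => [->//|[b [H1 H2 ->]]]; apply: H.
Qed.

Lemma view_ext x y a : x =1 y -> view x a = view y a.
Proof.
move=> E; rewrite /view; under eq_filter do rewrite !E.
by apply: eq_map => b; rewrite E.
Qed.

Lemma rstep_ext tr x y : x =1 y -> rstep tr x =1 rstep tr y.
Proof. by move=> E a; rewrite !rstepE (view_ext _ E) E. Qed.

Fixpoint rrun (tr : nat -> nat -> S -> nat -> option nat -> seq (nat * S) -> S * option nat)
  (t0 k : nat) (x : 'I_N -> cell V S) :=
  if k is k'.+1 then rstep (tr (t0 + k')) (rrun tr t0 k' x) else x.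

Lemma rrunD tr t0 k k' x : rrun tr t0 (k + k') x = rrun tr (t0 + k) k' (rrun tr t0 k x).
Proof. by elim: k' => [|k' IH]; rewrite ?addn0 // addnS /= IH addnA. Qed.

End Step.
End Reduced.

(** * Dispersion: growing the groups *)

(* Homes ([hom]) are the settled agents, the others are spares walking on the tree
   of their group. [lab] is the group label, the identifier of its root home, and
   0 for a lone settled agent that any group may absorb. [par] and [chd] are one
   more than the port of a home to its parent and to the current child, 0 for none. *)
Record core := Core { hom : bool; lab : nat; par : nat; chd : nat; frz : bool }.
(* Scratch memory of one search for a free neighbour: a recruited home probes with
   its spares under the rank [idx]; [best] and [dec] are one more than a port, and
   [fwd] marks a spare that is entering a new node. *)
Record tmp := Tmp { idx : nat; best : nat; out : nat; en1 : nat; dec : nat; fwd : bool }.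
Record wlk := Wlk { md : bool; wl : nat; wmx : nat }.
Record st1 := S1 { co : core; tm : tmp; wk : wlk }.

Definition trans1 := nat -> st1 -> nat -> option nat -> seq (nat * st1) -> st1 * option nat.

Definition actv (s : st1) := ~~ hom (co s) && ~~ frz (co s).
Definition helper (s : st1) := actv s || (idx (tm s) != 0).
Definition slab (s : st1) := lab (co s).

Definition tr_init : trans1 := fun u s d en oth =>
  let mu := maxo fst oth in
  let l := if oth is [::] then 0 else maxn mu u in
  (S1 (Core (mu < u) l 0 0 false) (Tmp 0 0 0 0 0 false) (Wlk false l 0), None).

(* Batch [k] probes the ports [2 ^ k - 1, ..., 2 ^ k.+1 - 2] in parallel: the head
   already holds one prober per port probed so far, and each prober finding a home of
   its own group recruits that home. *)
Definition tr_go (k : nat) : trans1 := fun u s d en oth =>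
  let t := tm s in
  let p := (2 ^ k).-1 + idx t in
  if helper s && (p < d) then
    (S1 (co s) (Tmp (idx t) (best t) p.+1 (en1 t) (dec t) (fwd t)) (wk s), Some p)
  else (s, None).

Definition tr_look : trans1 := fun u s d en oth =>
  let t := tm s in
  if out t != 0 then
    let f := has (fun o => [&& hom (co o.2), slab o.2 == slab s & idx (tm o.2) == 0]) oth in
    (S1 (co s) (Tmp (idx t) (if f then best t else out t) (out t) (odflt 0 en) (dec t) (fwd t)) (wk s), None)
  else (s, None).

(** A recruited home learns its rank and its way to the head from its visitors; they all came
    through the same port, so the maxima are unambiguous. *)
Definition tr_back : trans1 := fun u s d en oth =>
  let t := tm s in
  if out t != 0 then
    (S1 (co s) (Tmp (idx t) (best t) 0 (en1 t) (dec t) (fwd t)) (wk s), Some (en1 t))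
  else if hom (co s) && (idx t == 0) then
    let r := maxo (fun o => if slab o.2 == slab s then out (tm o.2) else 0) oth in
    if r != 0 then
      (S1 (co s) (Tmp r (best t) 0 (en1 t) (dec t) (fwd t)) (wk s),
       Some (maxo (fun o => if (slab o.2 == slab s) && (out (tm o.2) != 0)
                            then en1 (tm o.2) else 0) oth))
    else (s, None)
  else (s, None).

Definition tr_dec : trans1 := fun u s d en oth =>
  let t := tm s in
  let m := maxn (best t) (maxo (fun o => if slab o.2 == slab s then best (tm o.2) else 0) oth) in
  (S1 (co s) (Tmp 0 0 0 (en1 t) m (fwd t)) (wk s),
   if idx t is i.+1 then Some i else None).

Definition tr_act : trans1 := fun u s d en oth =>
  let t := tm s in let c := co s in
  if actv s then
    if dec t is p.+1 then
      (S1 c (Tmp (idx t) (best t) (out t) (en1 t) (dec t) true) (wk s), Some p)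
    else (s, if maxo (fun o => if hom (co o.2) then par (co o.2) else 0) oth is p.+1
             then Some p else None)
  else if hom c && has (fun o => actv o.2 && (slab o.2 == slab s)) oth then
    (S1 (Core (hom c) (lab c) (par c) (dec t) (frz c)) t (wk s), None)
  else (s, None).

Definition tr_look2 : trans1 := fun u s d en oth =>
  let t := tm s in
  (S1 (co s) (Tmp (idx t) (best t) (out t) (odflt 0 en) (dec t) (fwd t)) (wk s), None).

Definition fwlab (o : nat * st1) := if fwd (tm o.2) then slab o.2 else 0.

(** Simultaneous arrivals are settled in one round by comparing labels: a home with a nonzero label
    beats every arrival, otherwise the largest arriving label wins, and losers step back and freeze.
    The winners absorb a lone home if there is one, and else settle the spare of largest
    identifier. *)
Definition tr_res : trans1 := fun u s d en oth =>
  let t := tm s in let c := co s in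
  let t' := Tmp (idx t) (best t) (out t) (en1 t) (dec t) false in
  let hp := has (fun o => hom (co o.2)) oth in
  let hl := maxo (fun o => if hom (co o.2) then slab o.2 else 0) oth in
  let ml := maxo fwlab oth in
  if fwd t then
    if (hp && (hl != 0)) || (lab c < ml) then
      (S1 (Core (hom c) (lab c) (par c) (chd c) true) t' (wk s), Some (en1 t))
    else if ~~ hp && (maxo (fun o => if fwd (tm o.2) && (slab o.2 == lab c) then o.1 else 0) oth < u) then
      (S1 (Core true (lab c) (en1 t).+1 0 false) t' (wk s), None)
    else (S1 c t' (wk s), None)
  else if [&& hom c, lab c == 0 & ml != 0] then
    (S1 (Core true ml (maxo (fun o => if fwd (tm o.2) && (slab o.2 == ml) then en1 (tm o.2) else 0) oth).+1
          0 false) t (wk s), None)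
  else (s, None).

(** The stretch [w = 0] reaches the limit cycle, [w = 1] records the largest key met, and [w = 2]
    walks on until that key recurs. A label other than the remembered [wl] reveals that the walker
    has just crossed into another tree, which turns it to up mode. *)
Definition tr_walk (w : nat) : trans1 := fun u s d en oth =>
  let c := co s in let W := wk s in
  if hom c then (s, None) else
  let y := maxo (fun o => if hom (co o.2) then slab o.2 else 0) oth in
  let p := maxo (fun o => if hom (co o.2) then par (co o.2) else 0) oth in
  let ch := maxo (fun o => if hom (co o.2) then chd (co o.2) else 0) oth in
  let hu := maxo (fun o => if hom (co o.2) then o.1 else 0) oth in
  let m := (y != wl W) || md W in
  let key := 2 * hu + m in
  let mx := if w == 1 then maxn (wmx W) key else wmx W in
  if (w == 2) && (key == wmx W) then (s, None) else
  if m && (p != 0) then (S1 c (tm s) (Wlk true y mx), Some p.-1)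
  else (S1 c (tm s) (Wlk false y mx), if ch is q.+1 then Some q else None).

Definition tr_batch (k r : nat) : trans1 :=
  match r with 0 => tr_go k | 1 => tr_look | _ => tr_back end.

Definition tr_fin (r : nat) : trans1 :=
  match r with 0 => tr_dec | 1 => tr_act | 2 => tr_look2 | _ => tr_res end.

Definition tr_macro (e q : nat) : trans1 :=
  if q < 3 * e then tr_batch (q %/ 3) (q %% 3) else tr_fin (q - 3 * e).

(** The [e] batches of three rounds probe the ports below [2 ^ e - 1], which are all ports if
    [n <= 2 ^ e], as degrees are below [n]. Four more rounds carry out the decision. *)
Definition macroL (e : nat) := 3 * e + 4.
(** Serves twice: a depth-first growth over [n] nodes takes fewer than [2 * n] searches, and a
    walker has [2 * n] states, a node and a direction. *)
Definition walkL (e : nat) := 2 * 2 ^ e.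

Definition tr1 (e tau : nat) : trans1 :=
  if tau is t.+1 then
    if t < walkL e * macroL e then tr_macro e (t %% macroL e)
    else tr_walk ((t - walkL e * macroL e) %/ walkL e)
  else tr_init.

Definition phaseL (e : nat) := (walkL e * macroL e + 3 * walkL e).+1.

(** * Parallel probing: one batch of the search for a free neighbour *)

Section Batch.
Variables (V : finType) (adj : rel V) (port : V -> nat -> V).
Hypothesis adjS : symmetric adj.
Hypothesis adjI : irreflexive adj.
Hypothesis portP : port_labeling adj port.
Notation deg := (deg adj).
Notation rport := (rport adj port).
Notation N := #|V|.
Variable id : 'I_N -> nat.
Hypothesis id_inj : injective id.
Hypothesis id_pos : forall a, 0 < id a.
Notation conf := ('I_N -> cell V st1).
Notation rstep := (rstep adj port id).
Notation H x a := (hom (co (cs (x a)))).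
Notation X x a := (lab (co (cs (x a)))).
Notation L x a := (cl (x a)).
Notation act x a := (actv (cs (x a))).
Notation ix x a := (idx (tm (cs (x a)))).
Notation bst x a := (best (tm (cs (x a)))).
Notation ou x a := (out (tm (cs (x a)))).

(** Holds between two searches. By [bd_same] the spares of a group stay together and agree, so the
    group acts as a single depth-first token however many spares it has. *)
Record boundary (x : conf) : Prop := Boundary {
  bd_clean : forall a, [/\ ix x a = 0, bst x a = 0, ou x a = 0 & fwd (tm (cs (x a))) = false];
  bd_inj : forall a b, H x a -> H x b -> L x a = L x b -> a = b;
  bd_sp : forall b, ~~ H x b -> X x b != 0 /\ exists a, [/\ H x a, L x a = L x b & X x a = X x b];
  bd_same : forall b b', ~~ H x b -> ~~ H x b' -> X x b = X x b' ->
     L x b = L x b' /\ frz (co (cs (x b))) = frz (co (cs (x b')))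
}.

Definition fresh (x : conf) l v p :=
  p < deg v /\ forall a, H x a -> X x a = l -> L x a <> port v p.

(** Here [x] precedes the search and [y] follows [k] batches. The alternative in [bi_comp] drives
    the doubling: either a free port is already known at the head, or every probed port has yielded
    a recruit. *)
Record batch_inv (x : conf) (k : nat) (y : conf) : Prop := BatchInv {
  bi_co : forall a, [/\ co (cs (y a)) = co (cs (x a)), wk (cs (y a)) = wk (cs (x a)),
     fwd (tm (cs (y a))) = false & ou y a = 0];
  bi_sp : forall a, ~~ H x a -> ix y a = 0 /\ L y a = L x a;
  bi_hm : forall a, H x a -> [/\ ix y a = 0, L y a = L x a & bst y a = 0] \/
     (exists b j, [/\ act x b, X x b = X x a, ix y a = j.+1 &
        [/\ j < deg (L x b), j.+1 < 2 ^ k, port (L x b) j = L x a & L y a = L x b]]);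
  bi_best : forall a, bst y a != 0 ->
     (H x a || act x a) /\ fresh x (X x a) (L y a) (bst y a).-1;
  bi_comp : forall b, act x b ->
     (exists a, [/\ X x a = X x b, L y a = L x b & bst y a != 0]) \/
     (forall i, i.+1 < 2 ^ k -> i < deg (L x b) ->
        exists a, [/\ H x a, X x a = X x b, L x a = port (L x b) i & ix y a = i.+1])
}.

Lemma batch0 x : boundary x -> batch_inv x 0 x.
Proof.
move=> B; have cl0 := bd_clean B; split.
- by move=> a; case: (cl0 a).
- by move=> a _; case: (cl0 a).
- by move=> a _; left; case: (cl0 a).
- by move=> a; case: (cl0 a) => _ ->.
- by move=> b _; right=> i; rewrite expn0; lia.
Qed.

Section OneBatch.
Variables (x y : conf) (k : nat).
Hypothesis B : boundary x.
Hypothesis I : batch_inv x k y.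

Let p a := (2 ^ k).-1 + ix y a.
Let mv a := helper (cs (y a)) && (p a < deg (L y a)).
Let w a := port (L y a) (p a).
Let y1 := rstep (tr_go k) y.
Let y2 := rstep tr_look y1.
Let y3 := rstep tr_back y2.
Let t1 a := let t := tm (cs (y a)) in Tmp (idx t) (best t) (p a).+1 (en1 t) (dec t) (fwd t).

Lemma y1E a : y1 a = if mv a then Cell (w a) (Some (rport (w a) (L y a)))
   (S1 (co (cs (y a))) (t1 a) (wk (cs (y a)))) else y a.
Proof.
rewrite /y1 rstepE /tr_go -/(p a) -/(mv a).
case: ifP => //= Hm; last by case: (y a).
by case/andP: Hm => _ ->.
Qed.

Lemma coE a : co (cs (y a)) = co (cs (x a)).
Proof. by case: (bi_co I a). Qed.

Lemma ouE a : ou y a = 0.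
Proof. by case: (bi_co I a). Qed.

(* Every moving agent starts from the location of the active spares of its group. *)
Lemma mvP a : mv a -> exists b, [/\ act x b, X x b = X x a, L y a = L x b & X x a != 0].
Proof.
have actX b : act x b -> X x b != 0.
  by case/andP=> Hh _; case: (bd_sp B Hh).
case/andP=> /orP[Ha|Hi] _.
  have Ha' : act x a by move: Ha; rewrite /actv coE.
  exists a; split=> //; last exact: actX.
  by case/andP: Ha' => Hh _; case: (bi_sp I Hh).
have Hh : H x a.
  by case E: (H x a) => //; move/negbT: E => /(bi_sp I) [E _]; rewrite E in Hi.
case: (bi_hm I Hh) => [[E]|[b [j [Hb E _ [_ _ _ E2]]]]]; first by rewrite E in Hi.
by exists b; split=> //; rewrite -E; apply: actX.
Qed.

Lemma mv_home a : H x a -> ix y a = 0 -> mv a = false.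
Proof.
by move=> Hh E; rewrite /mv /helper /actv coE Hh E.
Qed.

Lemma mv_w a : mv a -> [/\ p a < deg (L y a), adj (w a) (L y a) &
  rport (w a) (L y a) < deg (w a) /\ port (w a) (rport (w a) (L y a)) = L y a].
Proof.
case/andP=> _ Hp; split=> //; last exact: (rport_back adjS portP).
by rewrite adjS; apply: (port_adj portP).
Qed.

(** Probing cannot mistake an absent member for a free node: earlier recruits live across ports
    below [2 ^ k - 1], the port [p a] is not among these, and ports are injective. So a member
    across [p a] has not been called away. *)
Lemma home_here a b : mv a -> H x b -> X x b = X x a -> L x b = w a ->
  [/\ ix y b = 0, y1 b = y b & L y b = w a].
Proof.
move=> ma Hb Xb Lb; have [c [Hc Xc Lc _]] := mvP ma.
have [pd _ _] := mv_w ma.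
case: (bi_hm I Hb) => [[E1 E2 E3]|[c' [j [Hc' Xc' _ [jd jk E _]]]]].
  by split=> //; rewrite ?y1E ?mv_home // E2.
have EL : L x c' = L x c.
  case/andP: Hc' => Hc' _; case/andP: Hc => Hc _.
  by case: (bd_same B Hc' Hc _) => //; rewrite Xc' Xb.
have Ej : j = p a.
  apply: (port_inj portP (v := L y a)) => //; rewrite Lc -EL //.
  by rewrite E Lb /w Lc -EL.
by move: jk; rewrite Ej /p; lia.
Qed.

Let fnd a := [exists b, [&& H x b, X x b == X x a & L x b == w a]].

Lemma fndE a : mv a ->
  has (fun o => [&& hom (co o.2), slab o.2 == slab (cs (y1 a)) & idx (tm o.2) == 0]) (view id y1 a) = fnd a.
Proof.
move=> ma; rewrite has_view.
have E1 : slab (cs (y1 a)) = X x a by rewrite /slab y1E ma /= coE.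
have E2 : L y1 a = w a by rewrite y1E ma.
apply/existsP/existsP => -[b].
  case/and3P=> nb; rewrite E1 E2 /= => /eqP Lb.
  rewrite /slab y1E; case: ifP => mb /= /and3P[Hb /eqP Xb /eqP ib].
    by rewrite mv_home // -?coE // in mb.
  exists b; rewrite -(coE b) Hb Xb eqxx /=.
  rewrite y1E mb in Lb; rewrite -Lb; rewrite coE in Hb.
  by case: (bi_hm I Hb) => [[_ -> _]//|[c [j [_ _ E]]]]; rewrite E in ib.
case/and3P=> Hb /eqP Xb /eqP Lb; exists b.
have [i0 Eb Lyb] := home_here ma Hb Xb Lb.
rewrite E1 E2 /slab Eb Lyb coE Hb Xb i0 !eqxx !andbT /=.
by apply/eqP=> E; subst b; rewrite mv_home in ma.
Qed.

Let t2 a := let t := tm (cs (y a)) in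
  Tmp (idx t) (if fnd a then best t else (p a).+1) (p a).+1 (rport (w a) (L y a)) (dec t) (fwd t).

Lemma y2E a : y2 a = if mv a then Cell (w a) (Some (rport (w a) (L y a)))
   (S1 (co (cs (y a))) (t2 a) (wk (cs (y a)))) else y a.
Proof.
rewrite /y2 rstepE /tr_look.
case ma: (mv a).
  rewrite fndE // y1E ma /= /t2; by [].
rewrite y1E ma ouE /=; by case: (y a).
Qed.

Let rq h a := [&& mv a, X x a == X x h & w a == L x h].

Lemma rqP h a : H x h -> ix y h = 0 -> rq h a ->
  [/\ a != h, L y2 a = L y2 h & L y2 h = L x h].
Proof.
move=> Hh i0 /and3P[ma _ /eqP wa]; rewrite !y2E ma (mv_home Hh i0) /=.
case: (bi_hm I Hh) => [[_ Lh _]|[b [j [_ _ E]]]]; last by rewrite E in i0.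
rewrite Lh wa; split=> //.
by apply/eqP=> E; subst a; rewrite mv_home in ma.
Qed.

Lemma rq_view h a : H x h -> ix y h = 0 -> a != h -> L y2 a = L y2 h ->
  slab (cs (y2 a)) == slab (cs (y2 h)) -> ou y2 a != 0 -> rq h a.
Proof.
move=> Hh i0 ah; rewrite /slab !y2E (mv_home Hh i0) /rq.
case: ifP => ma /=; last by rewrite ouE.
move=> wa; rewrite !coE => -> _ /=.
case: (bi_hm I Hh) => [[_ Lh _]|[b [j [_ _ E]]]]; last by rewrite E in i0.
by rewrite wa Lh eqxx.
Qed.

(** All probers of a group leave from the one node of its spares, so those reaching the same home
    used the same port. *)
Lemma rq_same h a a' : rq h a -> rq h a' -> p a = p a' /\ L y a = L y a'.
Proof.
move=> /and3P[ma /eqP Xa /eqP wa] /and3P[ma' /eqP Xa' /eqP wa'].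
have [b [Hb Xb Lb _]] := mvP ma.
have [b' [Hb' Xb' Lb' _]] := mvP ma'.
have EL : L x b = L x b'.
  case/andP: Hb' => Hb' _; case/andP: Hb => Hb _.
  by case: (bd_same B Hb Hb' _) => //; rewrite Xb Xb' Xa Xa'.
rewrite Lb Lb'; split=> //.
have [pa _ _] := mv_w ma; have [pa' _ _] := mv_w ma'.
apply: (port_inj portP (v := L y a)) => //; first by rewrite Lb EL -Lb'.
by rewrite -/(w a) wa -wa' /w Lb' -EL -Lb.
Qed.

Lemma y3_home h a : H x h -> ix y h = 0 -> rq h a ->
  y3 h = Cell (L y a) (Some (rport (L y a) (L x h)))
    (S1 (co (cs (y h))) (let t := tm (cs (y h)) in Tmp (p a).+1 (best t) 0 (en1 t) (dec t) (fwd t)) (wk (cs (y h)))).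
Proof.
move=> Hh i0 ra; rewrite /y3 rstepE /tr_back.
have [ah La Lh] := rqP Hh i0 ra.
have ma : mv a by case/and3P: ra.
have wa : w a = L x h by case/and3P: ra => _ _ /eqP.
have Xa : slab (cs (y2 a)) = slab (cs (y2 h)).
  by rewrite /slab !y2E (mv_home Hh i0) ma /= !coE; case/and3P: ra => _ /eqP.
have sub b : b != h -> L y2 b = L y2 h -> slab (cs (y2 b)) == slab (cs (y2 h)) -> ou y2 b != 0 ->
  ou y2 b = (p a).+1 /\ en1 (tm (cs (y2 b))) = rport (L x h) (L y a).
  move=> bh Lb Xb ob; have rb := rq_view Hh i0 bh Lb Xb ob.
  have [Ep EL] := rq_same ra rb.
  case/and3P: rb => mb _ /eqP wb.
  by rewrite y2E mb /= -Ep EL wb.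
have oa : ou y2 a = (p a).+1 by rewrite y2E ma.
have ea : en1 (tm (cs (y2 a))) = rport (L x h) (L y a) by rewrite y2E ma /= wa.
rewrite (@maxo_view_eq _ _ id _ _ y2 h a (p a).+1) //=; last first.
- move=> b bh Lb; case: ifP => // Xb.
  case: (eqVneq (ou y2 b) 0) => [->//|ob].
  by have [->] := sub b bh Lb Xb ob.
- by rewrite Xa eqxx.
rewrite (@maxo_view_eq _ _ id _ _ y2 h a (rport (L x h) (L y a))) //=; last first.
- move=> b bh Lb; case: ifP => // /andP[Xb ob].
  by have [_ ->//] := sub b bh Lb Xb ob.
- by rewrite Xa eqxx oa.
rewrite !(y2E h) (mv_home Hh i0) ouE coE Hh i0 /=.
have -> : L y h = L x h by rewrite -Lh y2E mv_home.
have [_ _] := mv_w ma; rewrite wa => -[lt ->].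
by rewrite lt.
Qed.

Lemma y3E a : (mv a -> y3 a = Cell (L y a) (Some (p a))
    (S1 (co (cs (y a))) (let t := t2 a in Tmp (idx t) (best t) 0 (en1 t) (dec t) (fwd t)) (wk (cs (y a))))).
Proof.
move=> ma; rewrite /y3 rstepE /tr_back y2E ma /=.
have [pd _ [lt ->]] := mv_w ma.
by rewrite lt (rport_port portP).
Qed.

Lemma y3_stay a : ~~ mv a -> (H x a -> ix y a = 0 -> forall b, ~~ rq a b) -> y3 a = y a.
Proof.
move=> ma nr; rewrite /y3 rstepE /tr_back.
have Ea : y2 a = y a by rewrite y2E (negbTE ma).
rewrite Ea ouE /= coE; case Hh: (H x a) => /=; last by case: (y a).
case i0: (ix y a == 0); last by case: (y a).
rewrite maxo_view0 /=; first by case: (y a).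
move=> b ba Lb; case: ifP => // Xb.
case: (eqVneq (ou y2 b) 0) => // ob.
have := rq_view Hh (eqP i0) ba Lb; rewrite Ea => /(_ Xb ob) rb.
by have := nr Hh (eqP i0) b; rewrite rb.
Qed.

Lemma batchS : batch_inv x k.+1 y3.
Proof.
have kk : 2 ^ k < 2 ^ k.+1 by rewrite ltn_exp2l.
have k0 : 0 < 2 ^ k by rewrite expn_gt0.
have fate a : [\/ [/\ mv a & y3 a = Cell (L y a) (Some (p a))
    (S1 (co (cs (y a))) (let t := t2 a in Tmp (idx t) (best t) 0 (en1 t) (dec t) (fwd t)) (wk (cs (y a))))],
   exists b, [/\ H x a, ix y a = 0, rq a b & y3 a = Cell (L y b) (Some (rport (L y b) (L x a)))
    (S1 (co (cs (y a))) (let t := tm (cs (y a)) in Tmp (p b).+1 (best t) 0 (en1 t) (dec t) (fwd t)) (wk (cs (y a))))]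
   | ~~ mv a /\ y3 a = y a].
  case ma: (mv a); first by constructor 1; split=> //; apply: y3E.
  case Hh: (H x a); last first.
    by constructor 3; split=> //; apply: y3_stay; rewrite ?ma // Hh.
  case: (eqVneq (ix y a) 0) => i0; last first.
    constructor 3; split=> //; apply: y3_stay; rewrite ?ma // => _ E.
    by rewrite E in i0.
  case: (pickP (rq a)) => [b rb|n0].
    by constructor 2; exists b; split=> //; apply: y3_home.
  by constructor 3; split=> //; apply: y3_stay; rewrite ?ma // => _ _ b; rewrite n0.
split.
- move=> a; have [E1 E2 E3 E4] := bi_co I a.
  by case: (fate a) => [[_ ->]|[b [_ _ _ ->]]|[_ ->]].
- move=> a Hh; have [E1 E2] := bi_sp I Hh.
  by case: (fate a) => [[_ ->]|[b [Hh' _ _ ->]]|[_ ->]] //=; rewrite Hh' in Hh.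
- move=> a Hh; case: (fate a) => [[ma ->]|[b [_ i0 rb ->]]|[_ ->]] /=.
  + case: (bi_hm I Hh) => [[E _]|]; first by rewrite mv_home in ma.
    case=> b [j [Hb Xb E [jd jk pj Lb]]]; right; exists b, j.
    by split=> //; split=> //; apply: ltn_trans kk.
  + right; have /and3P[mb /eqP Xb /eqP wb] := rb.
    have [c [Hc Xc Lc _]] := mvP mb; have [pd _ _] := mv_w mb.
    exists c, (p b); split; rewrite ?Xc //; split=> //; rewrite -?Lc //.
    rewrite /p; case Hb: (H x b); last first.
      by move/negbT: Hb => /(bi_sp I) [-> _]; lia.
    case: (bi_hm I Hb) => [[-> _]|[? [j [_ _ -> [_ jk _ _]]]]]; first lia.
    by rewrite expnS; lia.
  + case: (bi_hm I Hh) => [//|]; first by left.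
    case=> b [j [Hb Xb E [jd jk pj Lb]]]; right; exists b, j.
    by split=> //; split=> //; apply: ltn_trans kk.
- move=> a; case: (fate a) => [[ma ->]|[b [Hh i0 _ ->]]|[_ ->]] /=; last exact: (bi_best I).
    case: ifP => fa; first exact: (bi_best I).
    move=> _; split.
      case/andP: (ma) => /orP[Ha _|Hi _]; first by move: Ha; rewrite /actv coE => ->; rewrite orbT.
      by case E: (H x a) => //; move/negbT: E => /(bi_sp I) [E _]; rewrite E in Hi.
    split=> /=; first by case: (mv_w ma).
    move=> b Hb Xb Lb; move/negbT/existsPn: fa => /(_ b).
    by rewrite Hb Xb Lb /w !eqxx.
  by case: (bi_hm I Hh) => [[_ _ ->]//|[? [j [_ _ E]]]]; rewrite E in i0.
- move=> b Hb; have Hb0 : ~~ H x b by case/andP: Hb.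
  have best_keep a : X x a = X x b -> L y a = L x b -> bst y a != 0 ->
     [/\ L y3 a = L x b & bst y3 a != 0].
    move=> Xa La ba; case: (fate a) => [[ma ->]|[c [Hh i0 _ ->]]|[_ ->]] //=.
      by split=> //; case: ifP.
    by case: (bi_hm I Hh) ba => [[_ _ ->]//|[? [j [_ _ E]]]]; rewrite E in i0.
  case: (bi_comp I Hb) => [[a [Xa La ba]]|all0].
    by left; exists a; have [] := best_keep a Xa La ba.
  (* Port [i] falls to rank [i.+1 - 2 ^ k]: rank 0 is a spare, and rank [j.+1] is the home recruited
     across port [j], which exists by [all0]. *)
  have asg i : 2 ^ k <= i.+1 -> i.+1 < 2 ^ k.+1 -> i < deg (L x b) ->
     exists a, [/\ mv a, p a = i, X x a = X x b & L y a = L x b].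
    move=> ik ik' id0; case: (posnP (i.+1 - 2 ^ k)) => Ei.
      exists b; have [E1 E2] := bi_sp I Hb0; rewrite /mv /helper /p E1 E2 /actv coE.
      by move: Hb; rewrite /actv => ->; split=> //; lia.
    have [] := all0 (i.+1 - 2 ^ k).-1; [move: ik'; rewrite expnS; lia|lia|].
    move=> a [Ha Xa La Ea].
    have [[E _]|[c [j [Hc Xc _ [_ _ _ Lc]]]]] := bi_hm I Ha; first by rewrite Ea in E.
    have Lab : L y a = L x b.
      rewrite Lc; case/andP: Hc => Hc _.
      by case: (bd_same B Hc Hb0 _); rewrite ?Xc.
    have Ep : p a = i by rewrite /p Ea; lia.
    by exists a; split=> //; rewrite /mv /helper Ea orbT Lab Ep.
  case: (pickP (fun a => [&& mv a, X x a == X x b, L y a == L x b & ~~ fnd a])).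
    move=> a /and4P[ma /eqP Xa /eqP La fa]; left; exists a.
    by rewrite y3E //= (negbTE fa).
  move=> allf; right=> i ik id0.
  case: (ltnP i.+1 (2 ^ k)) => ik'.
    have [a [Ha Xa La Ea]] := all0 i ik' id0; exists a; split=> //.
    case: (fate a) => [[_ ->]|[c [_ E _ _]]|[_ ->]] //.
    by rewrite E in Ea.
  have [a [ma pa Xa La]] := asg i ik' ik id0.
  have /existsP[h /and3P[Hh /eqP Xh /eqP Lh]] : fnd a.
    by have := allf a; rewrite ma Xa La !eqxx /= => /negbFE.
  have [i0 _ _] := home_here ma Hh Xh Lh.
  have ra : rq h a by rewrite /rq ma Xh Lh !eqxx.
  exists h; split=> //; first by rewrite Xh.
    by rewrite Lh /w pa La.
  by rewrite (y3_home Hh i0 ra) /= pa.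
Qed.
End OneBatch.

End Batch.

(** * One whole search and its effect on the groups *)

Section Macro.
Variables (V : finType) (adj : rel V) (port : V -> nat -> V).
Hypothesis adjS : symmetric adj.
Hypothesis adjI : irreflexive adj.
Hypothesis portP : port_labeling adj port.
Notation deg := (deg adj).
Notation rport := (rport adj port).
Notation N := #|V|.
Variable id : 'I_N -> nat.
Hypothesis id_inj : injective id.
Hypothesis id_pos : forall a, 0 < id a.
Notation conf := ('I_N -> cell V st1).
Notation rstep := (rstep adj port id).
Notation H x a := (hom (co (cs (x a)))).
Notation X x a := (lab (co (cs (x a)))).
Notation L x a := (cl (x a)).
Notation act x a := (actv (cs (x a))).
Notation ix x a := (idx (tm (cs (x a)))).
Notation bst x a := (best (tm (cs (x a)))).
Notation ou x a := (out (tm (cs (x a)))).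
Notation boundary := (@boundary V).
Notation fresh := (fresh adj port).
Notation batch_inv := (batch_inv adj port).

(** The interface between rounds and groups: one step of the group invariant is derived from these
    clauses alone. [D] is one more than the port chosen by a group, and 0 when the group has to
    backtrack. *)
Record macro_spec (x : conf) (D : 'I_N -> nat) (x' : conf) : Prop := MacroSpec {
  ms_dec : forall b, act x b -> D b != 0 -> fresh x (X x b) (L x b) (D b).-1;
  ms_dec0 : forall b, act x b -> D b = 0 -> forall v, adj (L x b) v ->
     exists a, [/\ H x a, X x a = X x b & L x a = v];
  ms_same : forall b a, act x b -> L x a = L x b -> X x a = X x b -> D a = D b;
  ms_clean : forall a, [/\ ix x' a = 0, bst x' a = 0, ou x' a = 0 & fwd (tm (cs (x' a))) = false];
  ms_wk : forall a, wk (cs (x' a)) = wk (cs (x a));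
  ms_home : forall a, H x a -> X x a != 0 -> L x' a = L x a /\
     co (cs (x' a)) = Core true (X x a) (par (co (cs (x a))))
       (if [exists b, [&& act x b, X x b == X x a & L x b == L x a]] then D a else chd (co (cs (x a))))
       (frz (co (cs (x a))));
  ms_dumb : forall a, H x a -> X x a = 0 -> L x' a = L x a /\
     ((forall b, act x b -> D b != 0 -> port (L x b) (D b).-1 <> L x a) /\ H x' a /\ X x' a = 0 \/
      exists b, [/\ act x b, D b != 0, port (L x b) (D b).-1 = L x a,
         co (cs (x' a)) = Core true (X x b) (rport (L x a) (L x b)).+1 0 false &
         forall b', act x b' -> D b' != 0 -> port (L x b') (D b').-1 = L x a -> X x b' <= X x b]);
  ms_frz : forall a, ~~ H x a -> ~~ act x a -> L x' a = L x a /\ co (cs (x' a)) = co (cs (x a));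
  ms_bk : forall b h, act x b -> D b = 0 -> H x h -> L x h = L x b ->
     co (cs (x' b)) = co (cs (x b)) /\
     L x' b = if par (co (cs (x h))) is p.+1 then if p < deg (L x b) then port (L x b) p else L x b
              else L x b;
  ms_lose : forall b, act x b -> D b != 0 ->
     (exists h, [/\ H x h, L x h = port (L x b) (D b).-1 & X x h != 0]) \/
     (exists b', [/\ act x b', D b' != 0, port (L x b') (D b').-1 = port (L x b) (D b).-1 &
         X x b < X x b']) ->
     L x' b = L x b /\ co (cs (x' b)) = Core false (X x b) (par (co (cs (x b)))) (chd (co (cs (x b)))) true;
  ms_win : forall b, act x b -> D b != 0 ->
     (forall h, H x h -> L x h = port (L x b) (D b).-1 -> X x h = 0) ->
     (forall b', act x b' -> D b' != 0 -> port (L x b') (D b').-1 = port (L x b) (D b).-1 ->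
         X x b' <= X x b) ->
     L x' b = port (L x b) (D b).-1 /\
     ((exists h, H x h /\ L x h = port (L x b) (D b).-1) /\ co (cs (x' b)) = co (cs (x b)) \/
      (forall h, H x h -> L x h <> port (L x b) (D b).-1) /\
      (if [exists b', [&& act x b', D b' != 0, port (L x b') (D b').-1 == port (L x b) (D b).-1,
            X x b' == X x b & id b < id b']] then co (cs (x' b)) = co (cs (x b))
       else co (cs (x' b)) = Core true (X x b) (rport (port (L x b) (D b).-1) (L x b)).+1 0 false))
}.

Section OneMacro.
Variables (e : nat) (x y : conf).
Hypothesis Ne : N <= 2 ^ e.
Hypothesis B : boundary x.
Hypothesis I : batch_inv x e y.

Let coE a : co (cs (y a)) = co (cs (x a)).
Proof. by case: (bi_co I a). Qed.

Let D a := \max_(b | (L y b == L y a) && (X x b == X x a)) bst y b.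
Let z1 := rstep tr_dec y.
Let z2 := rstep tr_act z1.
Let z3 := rstep tr_look2 z2.
Let z4 := rstep tr_res z3.

(** Probers return within their batch, and recruits now go back through the port stored in their
    rank; so everybody stands where the search began. *)
Lemma z1E a : L z1 a = L x a /\
  cs (z1 a) = S1 (co (cs (x a))) (Tmp 0 0 0 (en1 (tm (cs (y a)))) (D a) false) (wk (cs (x a))).
Proof.
have -> : D a = maxn (bst y a) (maxo (fun o => if slab o.2 == slab (cs (y a)) then best (tm o.2) else 0) (view id y a)).
  rewrite maxo_view -big_mkcondr /D (bigD1 a) ?eqxx //=; congr maxn.
  apply: eq_bigl => b; rewrite /slab !coE.
  by case: (b != a); rewrite ?andbT ?andbF.
rewrite /z1 rstepE /tr_dec /=.
have [E1 E2 E3 E4] := bi_co I a; rewrite E1 E2 E3.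
case Hh: (H x a); last first.
  by move/negbT: Hh => /(bi_sp I) [-> ->].
case: (bi_hm I Hh) => [[-> -> _]//|[b [j [Hb Xb -> [jd jk <- ->]]]]].
by rewrite /= jd.
Qed.

Let actL b a : act x b -> ~~ H x a -> X x a = X x b -> L x a = L x b.
Proof.
by case/andP=> Hb _ Ha Xa; case: (bd_same B Ha Hb Xa).
Qed.

(** A recruit stands at the node of its spares, a proper neighbour of its own node; a home sharing
    its node with them was therefore not recruited. *)
Let homeL h : H x h -> (forall b, act x b -> X x b = X x h -> L x b = L x h) -> L y h = L x h.
Proof.
move=> Hh Hb; case: (bi_hm I Hh) => [[_ -> _]//|[b [j [Ab Xb _ [jd _ pj Lh]]]]].
by have := port_neq adjI portP jd; rewrite pj (Hb b Ab Xb) eqxx.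
Qed.

Let decP b : act x b -> D b != 0 -> fresh x (X x b) (L x b) (D b).-1.
Proof.
move=> Ab; have /andP[Hb _] := Ab; have [_ Lb] := bi_sp I Hb.
have : 0 < #|[pred c | (L y c == L y b) && (X x c == X x b)]|.
  by apply/card_gt0P; exists b; rewrite inE !eqxx.
case/(eq_bigmax_cond (fun c => bst y c)) => c; rewrite inE => /andP[/eqP Lc /eqP Xc].
by rewrite -/(D b) => -> bc; have [_] := bi_best I bc; rewrite Xc Lc Lb.
Qed.

Let dec0P b : act x b -> D b = 0 -> forall v, adj (L x b) v ->
     exists a, [/\ H x a, X x a = X x b & L x a = v].
Proof.
move=> Ab D0 v /(port_surj portP) [i id0 <-].
have /andP[Hb _] := Ab; have [_ Lb] := bi_sp I Hb.
case: (bi_comp I Ab) => [[a [Xa La ba]]|all0].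
  have : bst y a <= D b.
    by apply: (@leq_bigmax_cond _ _ (fun c => bst y c)); rewrite La Lb Xa !eqxx.
  by rewrite D0 leqn0 (negbTE ba).
(* From [deg < N <= 2 ^ e] every port [i] satisfies [i.+1 < 2 ^ e], so none escaped the [e]
   batches. *)
have := deg_lt adjI (L x b) => dl.
by have [|a [Ha Xa La _]] := all0 i _ id0; [lia|exists a].
Qed.

Let sameP b a : act x b -> L x a = L x b -> X x a = X x b -> D a = D b.
Proof.
move=> Ab La Xa; have /andP[Hb _] := Ab; have [_ Lb] := bi_sp I Hb.
have -> : D a = \max_(c | (L y c == L y b) && (X x c == X x b)) bst y c; last by [].
apply: eq_bigl => c; rewrite Xa; congr ((_ == _) && _).
case Ha: (H x a); last by move/negbT: Ha => /(bi_sp I) [_ ->]; rewrite Lb.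
rewrite Lb -La; apply: homeL => // b' Ab' Xb'.
by rewrite La; apply: actL => //; [case/andP: Ab'|rewrite Xb' Xa].
Qed.

Let g b := act x b && (D b != 0).
Let tgt b := port (L x b) (D b).-1.
Let hd a := [exists b, [&& act x b, X x b == X x a & L x b == L x a]].

Lemma z3E a : let t := tm (cs (z3 a)) in
  [/\ idx t = 0, best t = 0, out t = 0, wk (cs (z3 a)) = wk (cs (x a)) & fwd t = g a] /\
  [/\ g a -> [/\ L z3 a = tgt a, en1 t = rport (tgt a) (L x a) & co (cs (z3 a)) = co (cs (x a))],
      ~~ act x a -> L z3 a = L x a,
      H x a -> co (cs (z3 a)) = Core true (X x a) (par (co (cs (x a))))
          (if hd a then D a else chd (co (cs (x a)))) (frz (co (cs (x a)))),
      ~~ H x a -> co (cs (z3 a)) = co (cs (x a)) &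
      forall h, act x a -> D a = 0 -> H x h -> L x h = L x a ->
        L z3 a = if par (co (cs (x h))) is p.+1 then if p < deg (L x a) then port (L x a) p else L x a
              else L x a].
Proof.
have zc b : co (cs (z1 b)) = co (cs (x b)) by case: (z1E b) => _ ->.
have zL b : L z1 b = L x b by case: (z1E b).
have -> : z3 a = Cell (L z2 a) (ce (z2 a)) (S1 (co (cs (z2 a)))
   (let t := tm (cs (z2 a)) in Tmp (idx t) (best t) (out t) (odflt 0 (ce (z2 a))) (dec t) (fwd t)) (wk (cs (z2 a)))).
  by rewrite /z3 rstepE.
have [E1 E2] := z1E a.
have E2' : cs (z1 a) = S1 (co (cs (x a))) (tm (cs (z1 a))) (wk (cs (x a))) by rewrite E2.
have Ea : actv (cs (z1 a)) = act x a by rewrite /actv zc.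
rewrite /z2 rstepE /tr_act Ea E1.
case Aa: (act x a).
  have [Ha _] := andP Aa.
  rewrite E2 /= /g Aa /=.
  case ED: (D a) => [|q] /=.
    split; first by case: (maxo _ _) => //= p; case: ifP.
    split=> //; rewrite ?(negbTE Ha) //.
      by case: (maxo _ _) => //= p; case: ifP.
    move=> h _ _ Hh Lh; rewrite (@maxo_view_eq _ _ id _ _ z1 a h (par (co (cs (x h))))) //=.
    - by case: (par _) => //= p; case: ifP.
    - by apply/eqP=> E; subst h; rewrite Hh in Ha.
    - by rewrite !zL.
    - by rewrite zc Hh.
    move=> b _; rewrite !zL zc => Lb; case: ifP => // Hb.
    by have -> // : b = h by apply: (bd_inj B) => //; rewrite Lh.
  have D0 : D a != 0 by rewrite ED.
  have [qd _] := decP Aa D0; rewrite ED /= in qd.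
  by rewrite /tgt ED /= qd; split=> //; split=> //; rewrite (negbTE Ha).
have Eh : has (fun o => actv o.2 && (slab o.2 == slab (cs (z1 a)))) (view id z1 a) = hd a.
  rewrite has_view; apply/existsP/existsP => -[b].
    rewrite !zL => /and3P[_ Lb /=]; rewrite /actv /slab !zc => /andP[Ab Xb].
    by exists b; rewrite Lb Xb /actv Ab.
  case/and3P=> Ab Xb Lb; exists b; apply/and3P; split; rewrite ?zL //=.
    by apply/eqP=> E; subst b; rewrite Ab in Aa.
  by rewrite /actv /slab !zc Xb andbT.
rewrite Eh E2 /= /g Aa /=.
case Hh: (H x a) => /=; last by [].
case: ifP => _ /=; split=> //; split=> //.
by rewrite -Hh; case: (co _).
Qed.

Lemma fw_view a : maxo fwlab (view id z3 a) =
   \max_(b | [&& b != a, g b & L z3 b == L z3 a]) X x b.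
Proof.
rewrite maxo_view /fwlab /=.
rewrite (eq_bigr (fun b => if g b then X x b else 0)); last first.
  move=> b _; have [[_ _ _ _ ->] [G _ _ _ _]] := z3E b.
  by case Gb: (g b) => //; have [_ _ Ec] := G Gb; rewrite /slab Ec.
by rewrite -big_mkcondr; apply: eq_bigl => b; rewrite -andbA [g b && _]andbC.
Qed.

Let g_act b : g b -> act x b. Proof. by case/andP. Qed.
Let g_D b : g b -> D b != 0. Proof. by case/andP. Qed.
Let g_L b : g b -> L z3 b = tgt b.
Proof. by move=> Gb; have [_ [G _ _ _ _]] := z3E b; case: (G Gb). Qed.
Let h_L b : H x b -> L z3 b = L x b.
Proof. by move=> Hb; have [_ [_ G _ _ _]] := z3E b; apply: G; rewrite /actv Hb. Qed.
Let HE b : H z3 b = H x b.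
Proof.
have [_ [_ _ G1 G2 _]] := z3E b.
by case Hb: (H x b); [rewrite G1|rewrite G2 ?Hb].
Qed.
Let XE b : X z3 b = X x b.
Proof.
have [_ [_ _ G1 G2 _]] := z3E b.
by case Hb: (H x b); [rewrite G1|rewrite G2 ?Hb].
Qed.
Let fwE b : fwd (tm (cs (z3 b))) = g b.
Proof. by case: (z3E b) => [[_ _ _ _ ->]]. Qed.
Let g_H b : g b -> H x b = false.
Proof. by move/g_act => /andP[/negbTE]. Qed.

Lemma z4_home a : H x a -> X x a != 0 -> z4 a = z3 a.
Proof.
move=> Ha Xa; rewrite /z4 rstepE /tr_res fwE.
case Ga: (g a); first by rewrite g_H in Ha.
by rewrite HE Ha XE (negbTE Xa) /=; case: (z3 a).
Qed.

Lemma z4_other a : ~~ H x a -> ~~ g a -> z4 a = z3 a.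
Proof.
move=> Ha Ga; by rewrite /z4 rstepE /tr_res fwE (negbTE Ga) HE (negbTE Ha) /=; case: (z3 a).
Qed.

(** Arrivals with the same label left one node together, hence entered by the same edge. *)
Lemma en_max a l b : g b -> b != a -> L z3 b = L z3 a -> X x b = l ->
  maxo (fun o => if fwd (tm o.2) && (slab o.2 == l) then en1 (tm o.2) else 0) (view id z3 a)
  = rport (tgt b) (L x b).
Proof.
move=> Gb ba Lb Xb; apply: (@maxo_view_eq _ _ id _ _ z3 a b) => //=.
  rewrite fwE Gb /slab XE Xb eqxx /=.
  by have [_ [G _ _ _ _]] := z3E b; case: (G Gb).
move=> c ca Lc; rewrite fwE /slab XE; case: ifP => // /andP[Gc /eqP Xc].
have [_ [G _ _ _ _]] := z3E c; have [Lc' -> _] := G Gc.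
have -> : L x c = L x b by apply: actL; rewrite ?g_act ?g_H // Xc.
by rewrite -Lc' Lc -Lb g_L.
Qed.

Lemma z4_dumb a : H x a -> X x a = 0 ->
  (forall b, g b -> tgt b <> L x a) /\ z4 a = z3 a \/
  exists b, [/\ g b, tgt b = L x a,
     z4 a = Cell (L x a) (ce (z3 a)) (S1 (Core true (X x b) (rport (L x a) (L x b)).+1 0 false) (tm (cs (z3 a))) (wk (cs (z3 a)))) &
         forall b', g b' -> tgt b' = L x a -> X x b' <= X x b].
Proof.
move=> Ha Xa; rewrite /z4 rstepE /tr_res fwE.
case Ga: (g a); first by rewrite g_H in Ha.
rewrite HE Ha XE Xa /= fw_view.
have nea b : g b -> b != a by move=> Gb; apply/eqP=> E; subst b; rewrite Gb in Ga.
case: (pickP [pred b | [&& b != a, g b & L z3 b == L z3 a]]) => [b0 Hb0|none].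
  rewrite (bigmax_eq_arg b0) //; case: arg_maxnP => // b /and3P[ba Gb /eqP Lb] mx.
  have X0 : X x b != 0 by case: (bd_sp B (negbT (g_H Gb))).
  rewrite X0; right; exists b; have Lb' : tgt b = L x a by rewrite -g_L // Lb h_L.
  split=> //; last first.
    move=> b' Gb' Lb''; apply: mx; rewrite nea // Gb' /= g_L // Lb''.
    by rewrite h_L.
  by rewrite (@en_max a (X x b) b) //= Lb' h_L.
left; rewrite big_pred0 //=; split; last by case: (z3 a).
move=> b Gb Lb; have := none b; rewrite /= nea // Gb g_L // Lb.
by rewrite h_L // eqxx.
Qed.

Lemma z4_goer b : g b -> let w := tgt b in let t := tm (cs (z3 b)) in
  let t' := Tmp (idx t) (best t) (out t) (en1 t) (dec t) false in
  ((exists h, [/\ H x h, L x h = w & X x h != 0]) \/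
     (exists b', [/\ g b', tgt b' = w & X x b < X x b'])) /\
     (exists e', z4 b = Cell (L x b) e' (S1 (Core false (X x b) (par (co (cs (x b)))) (chd (co (cs (x b)))) true) t' (wk (cs (z3 b)))))
  \/ [/\ (forall h, H x h -> L x h = w -> X x h = 0), (forall b', g b' -> tgt b' = w -> X x b' <= X x b) &
     ((exists h, H x h /\ L x h = w) /\ z4 b = Cell w (ce (z3 b)) (S1 (co (cs (x b))) t' (wk (cs (z3 b)))) \/
      (forall h, H x h -> L x h <> w) /\
      (if [exists b', [&& g b', tgt b' == w, X x b' == X x b & id b < id b']]
       then z4 b = Cell w (ce (z3 b)) (S1 (co (cs (x b))) t' (wk (cs (z3 b))))
       else z4 b = Cell w (ce (z3 b)) (S1 (Core true (X x b) (rport w (L x b)).+1 0 false) t' (wk (cs (z3 b))))))].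
Proof.
move=> Gb w t t'; rewrite /z4 rstepE /tr_res fwE Gb.
have [_ [G _ _ _ _]] := z3E b; have [Lw Ew Ec] := G Gb; rewrite -/t -/w in Ew Lw.
have Hp : has (fun o => hom (co o.2)) (view id z3 b) = [exists h, H x h && (L x h == w)].
  rewrite has_view; apply/existsP/existsP => -[h].
    by case/and3P=> _ /eqP Lh /=; rewrite HE => Hh; exists h; rewrite Hh -Lw -Lh h_L /=.
  case/andP=> Hh /eqP Lh; exists h; rewrite /= HE Hh h_L // Lh Lw eqxx !andbT.
  by apply/eqP=> E; subst h; rewrite g_H in Hh.
have Hl h : H x h -> L x h = w ->
   maxo (fun o => if hom (co o.2) then slab o.2 else 0) (view id z3 b) = X x h.
  move=> Hh Lh; apply: (@maxo_view_eq _ _ id _ _ z3 b h).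
  - by apply/eqP=> E; subst h; rewrite g_H in Hh.
  - by rewrite h_L // Lh Lw.
  - by rewrite /= HE Hh /slab XE.
  move=> c cb Lc /=; rewrite HE; case: ifP => // Hc; rewrite /slab XE.
  have -> // : c = h.
  by apply: (bd_inj B) => //; rewrite Lh -(h_L Hc) Lc Lw.
have [pd _] := decP (g_act Gb) (g_D Gb).
have lose : [|| has (fun o => hom (co o.2)) (view id z3 b) && (maxo (fun o => if hom (co o.2) then slab o.2 else 0) (view id z3 b) != 0)
   | lab (co (cs (z3 b))) < maxo fwlab (view id z3 b)] <->
   ((exists h, [/\ H x h, L x h = w & X x h != 0]) \/
     (exists b', [/\ g b', tgt b' = w & X x b < X x b'])).
  rewrite Hp XE fw_view; split.
    case/orP=> [/andP[/existsP[h /andP[Hh /eqP Lh]]]|].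
      by rewrite (Hl h) // => Xh; left; exists h.
    case: (pickP [pred c | [&& c != b, g c & L z3 c == L z3 b]]) => [b0 Hb0|none].
      rewrite (bigmax_eq_arg b0) //; case: arg_maxnP => // c /and3P[_ Gc /eqP Lc] _ lt.
      by right; exists c; rewrite -g_L // Lc Lw.
    by rewrite big_pred0.
  case=> [[h [Hh Lh Xh]]|[c [Gc Lc lt]]]; apply/orP.
    left; rewrite (Hl h) // Xh andbT; apply/existsP; exists h.
    by rewrite Hh Lh eqxx.
  right; apply: (leq_trans lt).
  apply: (@leq_bigmax_cond _ _ (fun b => X x b)).
  rewrite Gc g_L // Lc Lw eqxx !andbT.
  by apply/eqP=> E; subst c; rewrite ltnn in lt.
case: ifP => [/lose los|/negP nl].
  left; split=> //; exists (Some (D b).-1) => /=.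
  rewrite Lw -/t Ew Ec (g_H Gb) /=.
  have [lt ->] := rport_back adjS portP pd; rewrite -/(tgt b) -/w in lt *.
  by rewrite lt /t' Ew /w /tgt (rport_port portP).
right; split.
- move=> h Hh Lh; apply/eqP; apply: contraT => Xh; case: nl; apply/lose.
  by left; exists h.
- move=> c Gc Lc; rewrite leqNgt; apply/negP=> lt; case: nl; apply/lose.
  by right; exists c.
rewrite Hp; case: existsP => [[h /andP[Hh /eqP Lh]]|noh] /=.
  by left; split; [exists h|rewrite /= -/t Lw Ec].
right; split; first by move=> h Hh Lh; apply: noh; exists h; rewrite Hh Lh eqxx.
have -> : (maxo (fun o : nat * st1 => if fwd (tm o.2) && (slab o.2 == lab (co (cs (z3 b)))) then o.1 else 0) (view id z3 b) < id b)
   = ~~ [exists b', [&& g b', tgt b' == w, X x b' == X x b & id b < id b']].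
  rewrite ltnNge; congr (~~ _); apply/idP/existsP.
    case: (maxo_viewP id (fun o : nat * st1 => if fwd (tm o.2) && (slab o.2 == lab (co (cs (z3 b)))) then o.1 else 0) z3 b).
      by move=> ->; rewrite leqNgt id_pos.
    case=> c [cb Lc ->] /=; rewrite fwE; case: ifP => [/andP[Gc Xc] le|_]; last by rewrite leqNgt id_pos.
    exists c; rewrite Gc -g_L // Lc Lw eqxx /=; move: Xc; rewrite /slab !XE => -> /=.
    by rewrite ltn_neqAle le andbT; apply/eqP=> /id_inj E; rewrite E eqxx in cb.
  case=> c /and4P[Gc /eqP Lc Xc lt]; apply: (leq_trans (ltnW lt)).
  have cb : c != b by apply/eqP=> E; subst c; rewrite ltnn in lt.
  have := @maxo_view_ge _ _ id _ (fun o => if fwd (tm o.2) && (slab o.2 == lab (co (cs (z3 b)))) then o.1 else 0) z3 b c cb.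
  by rewrite /= fwE Gc /slab !XE Xc; apply; rewrite g_L // Lw.
by case: existsP => _ /=; rewrite /t' -/t Lw Ec ?Ew.
Qed.

Lemma macroP : macro_spec x D z4.
Proof.
have tc a := z3E a.
split; [exact: decP|exact: dec0P|exact: sameP| | | | | | | |].
- move=> a; have [[E1 E2 E3 _ E4] _] := tc a.
  case Ga: (g a).
    case: (z4_goer Ga) => [[_ [e' ->]]//|[_ _ [[_ ->]//|[_]]]].
    by case: ifP => _ ->.
  case Ha: (H x a); last by rewrite z4_other ?Ha ?Ga //; split=> //; rewrite E4.
  case: (eqVneq (X x a) 0) => Xa; last by rewrite z4_home //; split=> //; rewrite E4.
  case: (z4_dumb Ha Xa) => [[_ ->]|[b [_ _ -> _]]]; split=> //=; by rewrite E4.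
- move=> a; have [[_ _ _ E _] _] := tc a.
  case Ga: (g a).
    case: (z4_goer Ga) => [[_ [e' ->]]//|[_ _ [[_ ->]//|[_]]]].
    by case: ifP => _ ->.
  case Ha: (H x a); last by rewrite z4_other ?Ha ?Ga.
  case: (eqVneq (X x a) 0) => Xa; last by rewrite z4_home.
  by case: (z4_dumb Ha Xa) => [[_ ->]|[b [_ _ -> _]]].
- move=> a Ha Xa; rewrite z4_home // h_L //; split=> //.
  by have [_ [_ _ -> //]] := tc a.
- move=> a Ha Xa; case: (z4_dumb Ha Xa) => [[nob ->]|[b [Gb Lb -> mx]]].
    rewrite h_L //; split=> //; left; rewrite HE XE; split=> // b Ab Db.
    by apply: nob; rewrite /g Ab.
  split=> //; right; exists b; rewrite g_act // g_D //; split=> // b' Ab' Db'.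
  by apply: mx; rewrite /g Ab'.
- move=> a Ha Aa; rewrite z4_other //; last by rewrite /g (negbTE Aa).
  by have [_ [_ E1 _ E2 _]] := tc a; rewrite E1 // E2.
- move=> b h Ab Db Hh Lh; have [Hb _] := andP Ab.
  rewrite z4_other //; last by rewrite /g Db eqxx andbF.
  by have [_ [_ _ _ E2 E3]] := tc b; rewrite E2 // (E3 h).
- move=> b Ab Db los; have Gb : g b by rewrite /g Ab.
  case: (z4_goer Gb) => [[_ [e' ->]]//|[nh nb _]].
  case: los => [[h [Hh Lh /negP[]]]|[b' [Ab' Db' Lb']]]; first by rewrite (nh h Hh Lh).
  by rewrite ltnNge nb // /g Ab'.
- move=> b Ab Db nh nb; have Gb : g b by rewrite /g Ab.
  case: (z4_goer Gb) => [[los _]|[_ _]].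
    case: los => [[h [Hh Lh]]|[b' [/andP[Ab' Db'] Lb']]]; first by rewrite (nh h Hh Lh).
    by rewrite ltnNge nb.
  case=> [[nh' ->]|[nh' E]]; first by split=> //; left.
  have EE : [exists b', [&& act x b', D b' != 0, port (L x b') (D b').-1 == port (L x b) (D b).-1,
            X x b' == X x b & id b < id b']] = [exists b', [&& g b', tgt b' == tgt b, X x b' == X x b & id b < id b']].
    by apply: eq_existsb => c; rewrite /g -andbA.
  rewrite EE; move: E; case: ifP => _ ->; split=> //; right; split=> //.
Qed.
End OneMacro.
End Macro.

(** The balance of [g_spare] under a push: one more search, one more stack entry, one more home. A
    pop trades a stack entry for a search. *)
Lemma count_push a b c : a + b + 2 = 2 * c -> a.+1 + b.+1 + 2 = 2 * (1 + c).
Proof. lia. Qed.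

(** * The invariant of a growing depth-first group *)

Section Groups.
Variables (V : finType) (adj : rel V) (port : V -> nat -> V).
Hypothesis adjS : symmetric adj.
Hypothesis adjI : irreflexive adj.
Hypothesis portP : port_labeling adj port.
Hypothesis conn : connected_graph adj.
Notation deg := (deg adj).
Notation rport := (rport adj port).
Notation N := #|V|.
Variable id : 'I_N -> nat.
Hypothesis id_inj : injective id.
Hypothesis id_pos : forall a, 0 < id a.
Variable Q : {set 'I_N}.
Notation conf := ('I_N -> cell V st1).
Notation H x a := (hom (co (cs (x a)))).
Notation X x a := (lab (co (cs (x a)))).
Notation L x a := (cl (x a)).
Notation act x a := (actv (cs (x a))).
Notation pr x a := (par (co (cs (x a)))).
Notation ch x a := (chd (co (cs (x a)))).
Notation fr x a := (frz (co (cs (x a)))).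
Notation boundary := (@boundary V).
Notation fresh := (fresh adj port).
Notation macro_spec := (macro_spec adj port id).

(** Tree edges on the stack are recorded at both ends, since walkers later climb to the root and
    descend to the head. *)
Definition link (x : conf) c u :=
  exists p q, [/\ pr x c = p.+1, p < deg (L x c) & port (L x c) p = L x u] /\
    [/\ ch x u = q.+1, q < deg (L x u) & port (L x u) q = L x c].

Fixpoint links (x : conf) c s := if s is u :: s' then link x c u /\ links x u s' else True.

(** Also covers homes that left the stack: they keep their parent pointers, so a walker entering a
    tree anywhere can reach its root. *)
Inductive climb (x : conf) (r : 'I_N) : 'I_N -> Prop :=
| Climb0 : climb x r r
| ClimbS c u p : pr x c = p.+1 -> p < deg (L x c) -> port (L x c) p = L x u ->
    H x u -> X x u = X x c -> climb x r u -> climb x r c.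

(* [h :: s] is the depth-first stack of the group labelled [l]: head first, root last. *)
Record grp (x : conf) (j l : nat) h s : Prop := Grp {
  g_T : forall a, a \in h :: s -> H x a /\ X x a = l;
  g_uniq : uniq (h :: s);
  g_links : links x h s;
  g_root : id (last h s) = l /\ pr x (last h s) = 0;
  g_climb : forall a, H x a -> X x a = l -> climb x (last h s) a;
  g_closed : forall a, H x a -> X x a = l -> a \notin h :: s -> forall v, adj (L x a) v ->
     exists b, [/\ H x b, X x b = l & L x b = v];
  g_spare : forall b, ~~ H x b -> X x b = l -> L x b = L x h /\
     if fr x b then exists q w, [/\ ch x h = q.+1, q < deg (L x h) & L x w = port (L x h) q] /\
                                 [/\ H x w, X x w != l & X x w != 0]
     else j + size s + 2 = 2 * #|[set a | H x a && (X x a == l)]|;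
  g_exh : (forall b, ~~ H x b -> X x b != l) -> ch x h = 0
}.

(** [j] counts searches. [Q] collects the roots and stays fixed: every nonzero label remains the
    identifier of one of them, which bounds the number of groups for the final count. *)
Record ginv (x : conf) (j : nat) : Prop := Inv {
  inv_bd : boundary x;
  inv_grp : forall l a, l != 0 -> H x a -> X x a = l -> exists h s, grp x j l h s;
  inv_lab : forall a, X x a != 0 -> exists2 r, r \in Q & id r = X x a;
  inv_Q : forall r, r \in Q -> H x r /\ X x r = id r;
  inv_wk : forall a, ~~ H x a -> wk (cs (x a)) = Wlk false (X x a) 0
}.

(* By pigeonhole: a group spanning the graph would need as many homes as nodes. *)
Lemma spare_not_closed x l b a0 : boundary x -> ~~ H x b -> H x a0 -> X x a0 = l ->
  (forall a, H x a -> X x a = l -> forall v, adj (L x a) v ->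
     exists c, [/\ H x c, X x c = l & L x c = v]) -> False.
Proof.
move=> B Hb Ha Xa cls.
have all v : exists c, [/\ H x c, X x c = l & L x c = v].
  have /connectP[p] := conn (L x a0) v.
  elim: p a0 Ha Xa => [|w p IH] a0 Ha Xa /= => [_ ->|/andP[aw pth] E].
    by exists a0.
  have [c [Hc Xc Lc]] := cls a0 Ha Xa w aw.
  by apply: (IH c Hc Xc); rewrite Lc.
pose A := [set a | H x a].
have sub : [set L x a | a in A] = [set: V].
  apply/setP=> v; rewrite inE; apply/imsetP.
  by have [c [Hc _ Lc]] := all v; exists c; rewrite ?inE.
have : #|A| = N.
  have := cardsT V; rewrite -sub card_in_imset // => a c; rewrite !inE => Ha' Hc' E.
  exact: (bd_inj B).
have : #|A| < #|'I_N|.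
  apply: proper_card; apply/properP; split; first by apply/subsetP.
  by exists b; rewrite ?inE // (negbTE Hb).
by move=> + E; rewrite card_ord E ltnn.
Qed.

Section Step.
Variables (x x' : conf) (D : 'I_N -> nat) (j : nat).
Hypothesis I : ginv x j.
Hypothesis M : macro_spec x D x'.

Let B : boundary x := inv_bd I.
Let g b := act x b && (D b != 0).
Let tgt b := port (L x b) (D b).-1.
Let win b := [forall h, H x h && (L x h == tgt b) ==> (X x h == 0)] &&
   [forall c, g c && (tgt c == tgt b) ==> (X x c <= X x b)].

Let g_act b : g b -> act x b. Proof. by case/andP. Qed.
Let g_D b : g b -> D b != 0. Proof. by case/andP. Qed.
Let g_H b : g b -> ~~ H x b. Proof. by move/g_act => /andP[]. Qed.
Let act_H b : act x b -> ~~ H x b. Proof. by case/andP. Qed.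
Let act_fr b : act x b -> fr x b = false. Proof. by case/andP => _ /negbTE. Qed.

Let winP b : win b ->
  (forall h, H x h -> L x h = tgt b -> X x h = 0) /\ (forall c, g c -> tgt c = tgt b -> X x c <= X x b).
Proof.
case/andP=> /forallP W1 /forallP W2; split.
  by move=> h Hh Lh; have := W1 h; rewrite Hh Lh eqxx => /eqP.
by move=> c Gc Lc; have := W2 c; rewrite Gc Lc eqxx.
Qed.

Let loseP b : g b -> ~~ win b ->
  [/\ L x' b = L x b, co (cs (x' b)) = Core false (X x b) (pr x b) (ch x b) true &
  (exists h, [/\ H x h, L x h = tgt b & X x h != 0]) \/
  (exists c, [/\ act x c, D c != 0, tgt c = tgt b & X x b < X x c])].
Proof.
move=> Gb nw.
have los : (exists h, [/\ H x h, L x h = tgt b & X x h != 0]) \/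
  (exists c, [/\ act x c, D c != 0, tgt c = tgt b & X x b < X x c]).
  move: nw; rewrite negb_and => /orP[] /forallPn /= [h]; rewrite negb_imply => /andP[/andP[Hh /eqP Lh]].
    by left; exists h.
  by rewrite -ltnNge => lt; right; exists h; rewrite g_act // g_D.
have := ms_lose M (g_act Gb) (g_D Gb); rewrite -/(tgt b) => /(_ los) [E1 E2].
by split.
Qed.

Let winS b : g b -> win b -> L x' b = tgt b /\
     ((exists h, H x h /\ L x h = tgt b) /\ co (cs (x' b)) = co (cs (x b)) \/
      (forall h, H x h -> L x h <> tgt b) /\
      (if [exists c, [&& g c, tgt c == tgt b, X x c == X x b & id b < id c]] then co (cs (x' b)) = co (cs (x b))
       else co (cs (x' b)) = Core true (X x b) (rport (tgt b) (L x b)).+1 0 false)).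
Proof.
move=> Gb /winP[W1 W2].
have [|E1 E2] := ms_win M (g_act Gb) (g_D Gb) W1; first by move=> c Ac Dc; apply: W2; rewrite /g Ac.
split=> //; case: E2 => [|[E2 E3]]; first by left.
right; split=> //; move: E3.
have -> // : [exists c, [&& act x c, D c != 0, port (L x c) (D c).-1 == port (L x b) (D b).-1,
            X x c == X x b & id b < id c]] = [exists c, [&& g c, tgt c == tgt b, X x c == X x b & id b < id c]].
by apply: eq_existsb => c; rewrite /g -andbA.
Qed.

Let old_home a : H x a -> [/\ H x' a, L x' a = L x a & X x a != 0 ->
  [/\ X x' a = X x a, pr x' a = pr x a & fr x' a = fr x a]].
Proof.
move=> Ha; case: (eqVneq (X x a) 0) => Xa; last first.
  by have [-> E] := ms_home M Ha Xa; rewrite E.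
have [-> [[_ [-> _]]|[b [_ _ _ E _]]]] := ms_dumb M Ha Xa; split=> //; by rewrite ?E // Xa.
Qed.

Let home_ch a : H x a -> X x a != 0 -> (forall b, act x b -> X x b = X x a -> L x b <> L x a) -> ch x' a = ch x a.
Proof.
move=> Ha Xa nb; have [_ ->] := ms_home M Ha Xa => /=.
by case: existsP => // [[b /and3P[Ab /eqP Xb /eqP Lb]]]; case: (nb b).
Qed.

Let head_ch a b : H x a -> X x a != 0 -> act x b -> X x b = X x a -> L x b = L x a -> ch x' a = D b.
Proof.
move=> Ha Xa Ab Xb Lb; have [_ ->] := ms_home M Ha Xa => /=.
case: existsP => [_|[]]; first by apply: (ms_same M).
by exists b; rewrite Ab Xb Lb !eqxx.
Qed.

Let spare_act b : ~~ H x b -> act x b = ~~ fr x b.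
Proof. by rewrite /actv => ->. Qed.

Let old_spare b : ~~ H x' b -> ~~ H x b /\ X x' b = X x b.
Proof.
move=> Hb'; have Hb : ~~ H x b.
  by apply/negP=> Hb; have [E _] := old_home Hb; rewrite E in Hb'.
split=> //; case Ab: (act x b); last first.
  by have [_ ->] := ms_frz M Hb (negbT Ab).
case: (eqVneq (D b) 0) => Db.
  have [_ [h [Hh Lh _]]] := bd_sp B Hb.
  by have [-> _] := ms_bk M Ab Db Hh Lh.
have Gb : g b by rewrite /g Ab.
case W: (win b); last by have [_ -> _] := loseP Gb (negbT W).
have [_ [[_ ->] //|[_]]] := winS Gb W.
by case: ifP => _ E; rewrite E in Hb' *.
Qed.

Let new_home z : H x' z -> ~~ H x z -> [/\ g z, win z, L x' z = tgt z,
   co (cs (x' z)) = Core true (X x z) (rport (tgt z) (L x z)).+1 0 false &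
   (forall h, H x h -> L x h <> tgt z) /\ (forall c, g c -> tgt c = tgt z -> X x c = X x z -> id c <= id z)].
Proof.
move=> Hz' Hz; case Az: (act x z); last first.
  by have [_ E] := ms_frz M Hz (negbT Az); rewrite E (negbTE Hz) in Hz'.
case: (eqVneq (D z) 0) => Dz.
  have [_ [h [Hh Lh _]]] := bd_sp B Hz.
  by have [E _] := ms_bk M Az Dz Hh Lh; rewrite E (negbTE Hz) in Hz'.
have Gz : g z by rewrite /g Az.
case W: (win z); last by have [_ E _] := loseP Gz (negbT W); rewrite E in Hz'.
have [Lz [[_ E]|[nh]]] := winS Gz W; first by rewrite E (negbTE Hz) in Hz'.
case: ifP => [_ E|/negbT/existsPn nc E]; first by rewrite E (negbTE Hz) in Hz'.
split=> //; split=> // c Gc Lc Xc; rewrite leqNgt.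
by have := nc c; rewrite Gc Lc Xc !eqxx.
Qed.

(** If a lone home is there, the label absorbing it and the winning label each dominate the other,
    so they coincide. If the target is empty, the new home is the arrival of that group with the
    largest identifier. *)
Let win_home b : g b -> win b -> exists z, [/\ H x' z, L x' z = tgt b, X x' z = X x b,
   pr x' z = (rport (tgt b) (L x b)).+1 & ch x' z = 0] /\ ~ (H x z /\ X x z = X x b).
Proof.
move=> Gb W; have [W1 W2] := winP W.
have X0 : X x b != 0 by case: (bd_sp B (g_H Gb)).
have sameL c : g c -> X x c = X x b -> L x c = L x b.
  by move=> Gc Xc; case: (bd_same B (g_H Gc) (g_H Gb) Xc).
have [_ [[[h [Hh Lh]] _]|[nh _]]] := winS Gb W.
  have [_ [[nb _]|[c [Ac Dc Lc E mx]]]] := ms_dumb M Hh (W1 h Hh Lh).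
    by case: (nb b (g_act Gb) (g_D Gb)).
  have Gc : g c by rewrite /g Ac.
  have Xc : X x c = X x b.
    by apply/eqP; rewrite eqn_leq W2 ?mx ?g_act ?g_D // -Lh.
  exists h; rewrite E Lh Xc (sameL c) //; split; last by rewrite (W1 h) // => -[_ E0]; rewrite -E0 in X0.
  by split=> //; have [_ -> _] := old_home Hh.
have P0 : [&& g b, tgt b == tgt b & X x b == X x b] by rewrite Gb !eqxx.
case: (@arg_maxnP _ b (fun c => [&& g c, tgt c == tgt b & X x c == X x b]) id P0) => z /and3P[Gz /eqP Lz /eqP Xz] mx.
have Wz : win z by move: W; rewrite /win Lz Xz.
exists z; have [Lz' [[[h [Hh Lh]] _]|[_]]] := winS Gz Wz; first by case: (nh h Hh); rewrite Lh.
case: existsP => [[c /and4P[Gc Lc Xc lt]]|_ E].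
  have /= le : geq (id z) (id c) by apply: mx; rewrite Gc -Lz Lc -Xz Xc.
  by rewrite ltnNge le in lt.
rewrite E Lz' Lz Xz (sameL z) //; split=> // -[Hz _].
by have := g_H Gz; rewrite Hz.
Qed.

Let newP a l : l != 0 -> H x' a -> X x' a = l -> ~ (H x a /\ X x a = l) ->
  exists b, [/\ g b, win b, X x b = l & L x' a = tgt b].
Proof.
move=> l0 Ha' Xa' na; case Ha: (H x a); last first.
  have [Gz W Lz E _] := new_home Ha' (negbT Ha).
  by exists a; split=> //; move: Xa'; rewrite E.
case: (eqVneq (X x a) 0) => Xa; last first.
  by have [_ _ /(_ Xa) [E _ _]] := old_home Ha; case: na; rewrite -E.
have [La [[_ [_ E]]|[b [Ab Db Lb E mx]]]] := ms_dumb M Ha Xa; first by rewrite E in Xa'; rewrite -Xa' in l0.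
have Gb : g b by rewrite /g Ab.
exists b; split=> //; [|by move: Xa'; rewrite E|by rewrite La].
apply/andP; split; apply/forallP => c; apply/implyP => /andP[Hc /eqP Lc].
  by have -> : c = a; [apply: (bd_inj B) => //; rewrite Lc -Lb|rewrite Xa].
by apply: mx; rewrite ?g_act ?g_D // -Lb.
Qed.

Let headL b h s : ~~ H x b -> grp x j (X x b) h s -> [/\ H x h, X x h = X x b & L x h = L x b].
Proof.
move=> Hb G; have [Hh Xh] := g_T G (mem_head h s).
by have [-> _] := g_spare G Hb erefl.
Qed.

(** A group with spares never has to backtrack from its root: with nothing else on the stack it
    would be closed under adjacency, against [spare_not_closed]. *)
Let bkP b h s : act x b -> D b = 0 -> grp x j (X x b) h s ->
  co (cs (x' b)) = co (cs (x b)) /\ exists u s', s = u :: s' /\ L x' b = L x u.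
Proof.
move=> Ab Db G; have Hb := act_H Ab; have [Hh Xh Lh] := headL Hb G.
have [Ec El] := ms_bk M Ab Db Hh Lh; split=> //.
case: s G => [|u s'] G.
  case: (@spare_not_closed x (X x b) b h) => // a Ha Xa v av.
  case: (eqVneq a h) => [E|ah]; last by apply: (g_closed G) av => //; rewrite inE.
  have [|c [Hc Xc Lc]] := ms_dec0 M Ab Db (v := v); first by rewrite -Lh -E.
  by exists c.
exists u, s'; split=> //; have [[p [q [[Ep pd pu] _]]] _] := g_links G.
by rewrite El Ep -Lh pd.
Qed.

Lemma bd_step : boundary x'.
Proof.
split; first exact: (ms_clean M).
- have on a b : H x a -> H x' b -> ~~ H x b -> L x' a = L x' b -> a = b.
    move=> Ha Hb Hb0; have [_ -> _] := old_home Ha.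
    by have [_ _ -> _ [nh _]] := new_home Hb Hb0 => /(nh a Ha).
  move=> a b Ha Hb E; case Ha0: (H x a); case Hb0: (H x b).
  + by apply: (bd_inj B) => //; have [_ <- _] := old_home Ha0; have [_ <- _] := old_home Hb0.
  + by apply: on; rewrite ?Hb0.
  + by apply/esym/on; rewrite ?Ha0.
  have [Ga Wa La Ea [_ ma]] := new_home Ha (negbT Ha0).
  have [Gb Wb Lb Eb [_ mb]] := new_home Hb (negbT Hb0).
  have [_ W2a] := winP Wa; have [_ W2b] := winP Wb.
  have Lab : tgt a = tgt b by rewrite -La -Lb.
  have Xab : X x a = X x b by apply/eqP; rewrite eqn_leq W2a ?W2b.
  by apply: id_inj; apply/eqP; rewrite eqn_leq ma ?mb.
- move=> b Hb'; have [Hb ->] := old_spare Hb'.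
  have [X0 [h0 [Hh0 Lh0 Xh0]]] := bd_sp B Hb; split=> //.
  have keep a : H x a -> X x a = X x b -> L x' b = L x a ->
      exists a, [/\ H x' a, L x' a = L x' b & X x' a = X x b].
    move=> Ha Xa ->; have [Ha' La] := old_home Ha; rewrite Xa => /(_ X0) [Xa' _ _].
    by exists a.
  case Ab: (act x b); last by apply: (keep h0) => //; have [-> _] := ms_frz M Hb (negbT Ab).
  case: (eqVneq (D b) 0) => Db.
    have [h [s G]] := inv_grp I X0 Hh0 Xh0.
    have [_ [u [s' [Es Lu]]]] := bkP Ab Db G; subst s.
    have [|Hu Xu] := g_T G (a := u); first by rewrite !inE eqxx orbT.
    exact: (keep u).
  have Gb : g b by rewrite /g Ab.
  case W: (win b); last by apply: (keep h0) => //; have [-> _ _] := loseP Gb (negbT W).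
  have [Lb _] := winS Gb W; have [z [[Hz Lz Xz _ _] _]] := win_home Gb W.
  by exists z; rewrite Lz Lb.
- move=> b c Hb' Hc'; have [Hb ->] := old_spare Hb'; have [Hc ->] := old_spare Hc' => E.
  have [EL Ef] := bd_same B Hb Hc E.
  have Eact : act x b = act x c by rewrite !spare_act // Ef.
  have [X0 [h0 [Hh0 Lh0 Xh0]]] := bd_sp B Hb.
  case Ab: (act x b); last first.
    have [-> ->] := ms_frz M Hb (negbT Ab).
    by have [|-> ->] := ms_frz M Hc; rewrite -?Eact ?Ab.
  have Ac : act x c by rewrite -Eact.
  have ED : D b = D c by apply: (ms_same M).
  case: (eqVneq (D b) 0) => Db.
    have [h [s G]] := inv_grp I X0 Hh0 Xh0.
    have [-> [u [s' [Es ->]]]] := bkP Ab Db G.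
    rewrite E in G; rewrite ED in Db; have [-> [v [t [Es' ->]]]] := bkP Ac Db G.
    by rewrite Es in Es'; case: Es' => ->.
  have Gb : g b by rewrite /g Ab.
  have Gc : g c by rewrite /g Ac -ED.
  have Et : tgt b = tgt c by rewrite /tgt EL ED.
  have EW : win b = win c by rewrite /win Et E.
  case W: (win b).
    have [-> Eb] := winS Gb W; rewrite EW in W; have [-> Ec] := winS Gc W.
    split=> //; have sp d : g d -> (exists h, H x h /\ L x h = tgt d) /\ co (cs (x' d)) = co (cs (x d)) \/
      (forall h, H x h -> L x h <> tgt d) /\
      (if [exists c, [&& g c, tgt c == tgt d, X x c == X x d & id d < id c]] then co (cs (x' d)) = co (cs (x d))
       else co (cs (x' d)) = Core true (X x d) (rport (tgt d) (L x d)).+1 0 false) -> fr x' d = false.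
      by move=> Gd [[_ ->]|[_]]; [|case: ifP => _ ->] => //; apply: act_fr; apply: g_act.
    by rewrite (sp b) ?(sp c).
  have [-> -> _] := loseP Gb (negbT W); rewrite EW in W.
  by have [-> -> _] := loseP Gc (negbT W).
Qed.

Let newT_old a l : l != 0 -> H x a -> X x a = l -> H x' a /\ X x' a = l.
Proof. by move=> l0 Ha Xa; have [-> _] := old_home Ha; rewrite Xa => /(_ l0) [->]. Qed.

Let sameT l : l != 0 -> (forall b, g b -> X x b = l -> ~~ win b) ->
  forall a, H x' a && (X x' a == l) = H x a && (X x a == l).
Proof.
move=> l0 nw a; apply/idP/idP => /andP[Ha /eqP Xa].
  apply/negPn/negP=> na; have [|b [Gb W Xb _]] := newP l0 Ha Xa.
    by case=> Ha0 Xa0; rewrite Ha0 Xa0 eqxx in na.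
  by have := nw b Gb Xb; rewrite W.
by have [-> ->] := newT_old l0 Ha Xa; rewrite eqxx.
Qed.

Let climb_keep l r a : l != 0 -> X x a = l -> climb x r a -> H x a -> climb x' r a.
Proof.
move=> l0 Xa C; elim: C Xa => {a} [_ _|c u p Ec pd pu Hu Xu _ IH Xc Hc]; first exact: Climb0.
have [_ Lc] := old_home Hc; rewrite Xc => /(_ l0) [Xc' Pc _].
have Xu' : X x u = l by rewrite Xu.
have [Hu' Lu] := old_home Hu; rewrite Xu' => /(_ l0) [Xu2 _ _].
apply: (@ClimbS x' r c u p); rewrite ?Pc ?Lc ?Lu ?Xu2 ?Xc' //.
exact: IH.
Qed.

Let links_keep l c s : l != 0 -> (forall a, a \in c :: s -> H x a /\ X x a = l) ->
  (forall a, a \in s -> ch x' a = ch x a) -> links x c s -> links x' c s.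
Proof.
move=> l0; elim: s c => //= u s IH c inT chk [[p [q [[E1 E2 E3] [F1 F2 F3]]]] lk].
split; last first.
  apply: IH => // a Ha; [apply: inT|apply: chk]; by rewrite inE Ha orbT.
have [Hc Xc] := inT c (mem_head _ _).
have [|Hu Xu] := inT u; first by rewrite !inE eqxx orbT.
have [_ Lc] := old_home Hc; rewrite Xc => /(_ l0) [_ Pc _].
have [_ Lu _] := old_home Hu.
by exists p, q; rewrite Pc Lc Lu chk ?mem_head.
Qed.

Let root_keep l r : l != 0 -> H x r -> X x r = l -> id r = l /\ pr x r = 0 -> id r = l /\ pr x' r = 0.
Proof.
by move=> l0 Hr Xr [E1 E2]; have [_ _] := old_home Hr; rewrite Xr => /(_ l0) [_ -> _].
Qed.

Let closed_keep l v : l != 0 -> (exists b, [/\ H x b, X x b = l & L x b = v]) ->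
  exists b, [/\ H x' b, X x' b = l & L x' b = v].
Proof.
move=> l0 [b [Hb Xb Lb]]; exists b; have [H1 H2] := newT_old l0 Hb Xb.
by have [_ -> _] := old_home Hb.
Qed.

Let frz_keep h w l q : l != 0 -> H x h -> L x w = port (L x h) q -> H x w -> X x w != l -> X x w != 0 ->
  L x' w = port (L x' h) q /\ [/\ H x' w, X x' w != l & X x' w != 0].
Proof.
move=> l0 Hh Lw Hw Xw Xw0; have [_ Lh _] := old_home Hh.
by have [Hw' Lw' /(_ Xw0) [-> _ _]] := old_home Hw; rewrite Lw' Lh.
Qed.

(** The stack stays, is popped, or is pushed, according to the common fate of the spares. The
    delicate case is freezing: after the step the target must hold a home of another labelled group,
    and when the target was free, such a home comes from a competitor of larger label. *)
Lemma grp_step l h s : l != 0 -> grp x j l h s -> exists h' s', grp x' j.+1 l h' s'.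
Proof.
move=> l0 G; have [Hh Xh] := g_T G (mem_head h s).
have Xh0 : X x h != 0 by rewrite Xh.
have [Hh' Lh' /(_ Xh0) [Xh' Ph' _]] := old_home Hh.
have [Hr Xr] : H x (last h s) /\ X x (last h s) = l by apply: (g_T G); apply: mem_last.
have T' a : a \in h :: s -> H x' a /\ X x' a = l.
  by move=> /(g_T G) [Ha Xa]; apply: newT_old.
have /= /andP[hs us] := g_uniq G.
have chk a : a \in s -> ch x' a = ch x a.
  move=> as_; have [|Ha Xa] := g_T G (a := a); first by rewrite inE as_ orbT.
  apply: home_ch => //; first by rewrite Xa.
  move=> b Ab Xb Lb; have [Lb2 _] := g_spare G (act_H Ab) (etrans Xb Xa).
  have E : a = h by apply: (bd_inj B) => //; rewrite -Lb.
  by rewrite -E as_ in hs.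
have lk : links x' h s by apply: (links_keep l0 (g_T G) chk (g_links G)).
have Lold a : H x a -> L x' a = L x a by case/old_home.
have closed_old a v : H x a -> X x a = l -> a \notin h :: s -> adj (L x' a) v ->
     exists b, [/\ H x' b, X x' b = l & L x' b = v].
  by move=> Ha Xa na; rewrite Lold // => av; apply: closed_keep => //; apply: (g_closed G) av.
case: (pickP [pred b | act x b && (X x b == l)]) => [b /andP[Ab /eqP Xb]|none]; last first.
  have nob b : act x b -> X x b = l -> False by move=> Ab Xb; have := none b; rewrite /= Ab Xb eqxx.
  have sT : forall a, H x' a && (X x' a == l) = H x a && (X x a == l).
    by apply: sameT => // b Gb Xb; case: (nob b (g_act Gb) Xb).
  have inT a : H x' a -> X x' a = l -> H x a /\ X x a = l.
    by move=> Ha Xa; have := sT a; rewrite Ha Xa eqxx => /esym/andP[-> /eqP].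
  have chh : ch x' h = ch x h.
    by apply: home_ch => // b Ab; rewrite Xh => Xb; case: (nob b).
  exists h, s; split=> //; first exact: (g_uniq G).
  - exact: (root_keep l0 Hr Xr (g_root G)).
  - by move=> a Ha Xa; have [Ha0 Xa0] := inT a Ha Xa; apply: (climb_keep l0 Xa0 (g_climb G Ha0 Xa0)).
  - by move=> a Ha Xa; have [Ha0 Xa0] := inT a Ha Xa; move=> na v; apply: closed_old.
  - move=> b Hb'; have [Hb ->] := old_spare Hb' => Xb.
    have Ab : ~~ act x b by apply/negP=> Ab; case: (nob b).
    have [-> Ec] := ms_frz M Hb Ab; rewrite Ec chh Lh'.
    have [-> ] := g_spare G Hb Xb; rewrite spare_act // negbK in Ab; rewrite Ab => -[q [w [[E1 E2 E3] [E4 E5 E6]]]].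
    split=> //; exists q, w; rewrite E1; have [] := frz_keep l0 Hh E3 E4 E5 E6.
    by rewrite Lh'.
  - move=> nos; rewrite chh; apply: (g_exh G) => b Hb; apply/eqP=> Xb.
    have Ab : ~~ act x b by apply/negP=> Ab; case: (nob b).
    have [_ Ec] := ms_frz M Hb Ab.
    by have := nos b; rewrite Ec Hb Xb eqxx => /(_ isT).
have Hb := act_H Ab; have [Lb] := g_spare G Hb Xb; rewrite (act_fr Ab) => cnt.
have chh : ch x' h = D b by apply: head_ch => //; rewrite Xh.
have allb c : ~~ H x c -> X x c = l -> [/\ act x c, D c = D b & L x c = L x b].
  move=> Hc Xc; have [E1 E2] := bd_same B Hc Hb (etrans Xc (esym Xb)).
  by rewrite spare_act // E2 -spare_act // (ms_same M Ab E1) ?Xc.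
case: (eqVneq (D b) 0) => Db.
  (* backtracking *)
  have G1 : grp x j (X x b) h s by rewrite Xb.
  have [_ [u [s' [Es Lu]]]] := bkP Ab Db G1; subst s.
  have sT : forall a, H x' a && (X x' a == l) = H x a && (X x a == l).
    apply: sameT => // c Gc Xc; have [_ E _] := allb c (g_H Gc) Xc.
    by have := g_D Gc; rewrite E Db.
  have inT a : H x' a -> X x' a = l -> H x a /\ X x a = l.
    by move=> Ha Xa; have := sT a; rewrite Ha Xa eqxx => /esym/andP[-> /eqP].
  have [|Hu Xu] := g_T G (a := u); first by rewrite !inE eqxx orbT.
  have /= [_ lk'] := lk.
  exists u, s'; split=> //.
  - by move=> a as_; apply: T'; rewrite inE as_ orbT.
  - exact: (root_keep l0 Hr Xr (g_root G)).
  - by move=> a Ha Xa; have [Ha0 Xa0] := inT a Ha Xa; apply: (climb_keep l0 Xa0 (g_climb G Ha0 Xa0)).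
  - move=> a Ha Xa; have [Ha0 Xa0] := inT a Ha Xa; move=> na v.
    case: (eqVneq a h) => [->|ah]; last by apply: closed_old => //; rewrite inE negb_or ah.
    rewrite Lh' -Lb => av; apply: closed_keep => //.
    by have [c [Hc Xc Lc]] := ms_dec0 M Ab Db av; exists c; rewrite Xc.
  - move=> c Hc'; have [Hc ->] := old_spare Hc' => Xc.
    have [Ac Dc Lc] := allb c Hc Xc.
    have G2 : grp x j (X x c) h (u :: s') by rewrite Xc.
    have [-> [v [t [[<- _] ->]]]] := bkP Ac (etrans Dc Db) G2.
    rewrite (act_fr Ac) Lold //; split=> //.
    have -> : [set a | H x' a && (X x' a == l)] = [set a | H x a && (X x a == l)].
      by apply/setP=> a; rewrite !inE sT.
    by rewrite -cnt /= addSnnS.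
  - move=> nos; have [E _] := ms_bk M Ab Db Hh (esym Lb).
    by have := nos b; rewrite E (negbTE Hb) Xb eqxx => /(_ isT).
have Gb : g b by rewrite /g Ab.
have allW c : g c -> X x c = l -> win c = win b /\ tgt c = tgt b.
  move=> Gc Xc; have [Ac Dc Lc] := allb c (g_H Gc) Xc.
  have Et : tgt c = tgt b by rewrite /tgt Dc Lc.
  by rewrite /win Et Xc Xb.
have [pd fresh_b] := ms_dec M Ab Db.
case W: (win b); last first.
  (* touching another group: frozen *)
  have sT : forall a, H x' a && (X x' a == l) = H x a && (X x a == l).
    by apply: sameT => // c Gc Xc; have [-> _] := allW c Gc Xc; rewrite W.
  have inT a : H x' a -> X x' a = l -> H x a /\ X x a = l.
    by move=> Ha Xa; have := sT a; rewrite Ha Xa eqxx => /esym/andP[-> /eqP].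
  exists h, s; split=> //; first exact: (g_uniq G).
  - exact: (root_keep l0 Hr Xr (g_root G)).
  - by move=> a Ha Xa; have [Ha0 Xa0] := inT a Ha Xa; apply: (climb_keep l0 Xa0 (g_climb G Ha0 Xa0)).
  - by move=> a Ha Xa; have [Ha0 Xa0] := inT a Ha Xa; move=> na v; apply: closed_old.
  - move=> c Hc'; have [Hc ->] := old_spare Hc' => Xc.
    have [Ac Dc Lc] := allb c Hc Xc.
    have Gc : g c by rewrite /g Ac Dc.
    have [Wc _] := allW c Gc Xc; rewrite W in Wc.
    have [-> -> _] := loseP Gc (negbT Wc); rewrite /= Lc Lh'; split=> //.
    have tw : exists w, [/\ H x' w, L x' w = tgt b, X x' w != l & X x' w != 0].
      have [_ _ [[w [Hw Lw Xw]]|[d [Ad Dd Ld lt]]]] := loseP Gb (negbT W).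
        have Xw2 : X x w != l by rewrite -Xb; apply/eqP=> E; case: (fresh_b w Hw E).
        by exists w; have [-> -> /(_ Xw) [-> _ _]] := old_home Hw.
      (* the strongest competitor at the target *)
      have P0 : g d && (tgt d == tgt b) by rewrite /g Ad Dd Ld eqxx.
      case: (@arg_maxnP _ d (fun c => g c && (tgt c == tgt b)) (fun c => X x c) P0) => z /andP[Gz /eqP Lz] mx.
      have ltz : X x b < X x z by apply: (leq_trans lt); apply: (mx d P0).
      case Wz: (win z).
        have [w [[Hw Lw Xw _ _] _]] := win_home Gz Wz.
        by exists w; rewrite Hw Lw Lz Xw -Xb neq_ltn ltz orbT -lt0n (leq_ltn_trans (leq0n _) ltz).
      have [_ _ [[w [Hw Lw Xw]]|[y [Ay Dy Ly lty]]]] := loseP Gz (negbT Wz).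
        have Xw2 : X x w != l by rewrite -Xb; apply/eqP=> E; case: (fresh_b w Hw E); rewrite Lw Lz.
        by exists w; have [-> -> /(_ Xw) [-> _ _]] := old_home Hw; rewrite Lw.
      have /= le : geq (X x z) (X x y) by apply: mx; rewrite /g Ay Dy Ly Lz eqxx.
      by rewrite ltnNge le in lty.
    have [w [E1 E2 E3 E4]] := tw.
    exists (D b).-1, w; split=> //; split; rewrite -?Lb // chh prednK ?lt0n //.
  - move=> nos; have [_ E _] := loseP Gb (negbT W).
    by have := nos b; rewrite E Xb eqxx => /(_ isT).
(* conquering a node *)
have [z [[Hz Lz Xz Pz Cz] nz]] := win_home Gb W.
rewrite Xb in Xz nz.
have inT a : H x' a -> X x' a = l -> a <> z -> H x a /\ X x a = l.
  move=> Ha Xa az; case E: (H x a && (X x a == l)); first by case/andP: E => -> /eqP.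
  have [|c [Gc Wc Xc Lc]] := newP l0 Ha Xa; first by case=> E1 E2; rewrite E1 E2 eqxx in E.
  have [_ Ec] := allW c Gc Xc.
  by case: az; apply: (bd_inj bd_step) => //; rewrite Lc Ec Lz.
have [rlt rE] := rport_back adjS portP pd; rewrite -/(tgt b) in rlt rE.
have lz : link x' z h.
  exists (rport (tgt b) (L x b)), (D b).-1; rewrite Pz Lz chh Lh' -Lb prednK ?lt0n //.
  by split; split=> //; move: pd; rewrite prednK ?lt0n.
have zs : z \notin h :: s by apply/negP=> /(g_T G) /nz.
exists z, (h :: s); split.
- by move=> a; rewrite inE => /orP[/eqP-> //|/T'].
- by rewrite cons_uniq zs; apply: (g_uniq G).
- by split.
- exact: (root_keep l0 Hr Xr (g_root G)).
- move=> a Ha Xa; case: (eqVneq a z) => [->|/eqP az] /=; last first.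
    by have [Ha0 Xa0] := inT a Ha Xa az; apply: (climb_keep l0 Xa0 (g_climb G Ha0 Xa0)).
  have [p [q [[E1 E2 E3] _]]] := lz; apply: (ClimbS E1 E2 E3) => //; first by rewrite Xh' Xz.
  exact: (climb_keep l0 Xh (g_climb G Hh Xh)).
- move=> a Ha Xa; rewrite inE negb_or => /andP[/eqP az na] v.
  by have [Ha0 Xa0] := inT a Ha Xa az; apply: closed_old.
- move=> c Hc'; have [Hc ->] := old_spare Hc' => Xc.
  have [Ac Dc Lc] := allb c Hc Xc.
  have Gc : g c by rewrite /g Ac Dc.
  have [Wc tc] := allW c Gc Xc; rewrite W in Wc.
  have [-> Ec] := winS Gc Wc; rewrite Lz tc; split=> //.
  have -> : fr x' c = false.
    case: Ec => [[_ ->]|[_]]; first exact: act_fr.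
    by case: ifP => _ ->; first exact: act_fr.
  have -> : [set a | H x' a && (X x' a == l)] = z |: [set a | H x a && (X x a == l)].
    apply/setP=> a; rewrite !inE; case: (eqVneq a z) => [->|/eqP az] /=; first by rewrite Hz Xz eqxx.
    apply/idP/idP => /andP[Ha /eqP Xa].
      by have [-> ->] := inT a Ha Xa az; rewrite eqxx.
    by have [-> ->] := newT_old l0 Ha Xa; rewrite eqxx.
  rewrite cardsU1.
  have -> : z \notin [set a | H x a && (X x a == l)].
    by rewrite inE; apply/negP=> /andP[Hz0 /eqP Xz0]; case: nz.
  exact: count_push.
- by move=> _.
Qed.

Lemma inv_step : ginv x' j.+1.
Proof.
split; first exact: bd_step.
- move=> l a l0 Ha Xa; case: (boolP (H x a && (X x a == l))) => [/andP[Ha0 /eqP Xa0]|na].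
    by have [h [s G]] := inv_grp I l0 Ha0 Xa0; apply: grp_step G.
  have [|b [Gb W Xb _]] := newP l0 Ha Xa; first by case=> E1 E2; rewrite E1 E2 eqxx in na.
  have [_ [h0 [Hh0 _ Xh0]]] := bd_sp B (g_H Gb).
  by have [h [s G]] := inv_grp I l0 Hh0 (etrans Xh0 Xb); apply: grp_step G.
- move=> a Xa; case Ha': (H x' a); last first.
    have [Ha E] := old_spare (negbT Ha'); rewrite E in Xa *.
    exact: (inv_lab I).
  case: (boolP (H x a && (X x a == X x' a))) => [/andP[Ha0 /eqP Xa0]|na].
    by rewrite -Xa0 in Xa *; apply: (inv_lab I).
  have [|b [Gb W Xb _]] := newP Xa Ha' erefl; first by case=> E1 E2; rewrite E1 E2 eqxx in na.
  by rewrite -Xb in Xa *; apply: (inv_lab I).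
- move=> r /(inv_Q I) [Hr Xr]; have [Hr' _] := old_home Hr; rewrite Xr -lt0n id_pos => /(_ isT) [-> _ _].
  by [].
- move=> a Ha'; have [Ha ->] := old_spare Ha'; rewrite (ms_wk M).
  exact: (inv_wk I).
Qed.
End Step.
End Groups.

(** * Dispersion: merging blocked groups *)

Section Orbit.
Variables (T : finType) (f : T -> T) (key : T -> nat) (M : nat).
Hypothesis M_card : #|T| <= M.

(** An orbit has at most [#|T|] points, so [M] steps lead past its preperiod. *)
Lemma iter_periodic z : exists p, [/\ 0 < p, p <= M & iter p f (iter M f z) = iter M f z].
Proof.
have /trajectP[i lt E] : looping f z (order f z) by apply: looping_order.
have le : order f z <= M by apply: leq_trans M_card; apply: max_card.
exists (order f z - i); rewrite subn_gt0; split=> //; first lia.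
rewrite -iterD (_ : order f z - i + M = (M - i) + order f z); last lia.
by rewrite iterD E -iterD subnK //; apply: ltnW (leq_trans lt le).
Qed.

Definition topkey z := \max_(i < M) key (iter i f z).

(* Follow [f] until the limit cycle is reached, look for the maximal key on the
   cycle, and stop there. *)
Definition settle z0 :=
  let z := iter M f z0 in
  iter M (fun w => if key w == topkey z then w else f w) (iter M f z).

Lemma iter_mod p z t : iter p f z = z -> iter t f z = iter (t %% p) f z.
Proof.
move=> E; rewrite {1}(divn_eq t p) addnC iterD; congr iter.
by elim: (t %/ p) => // q IH; rewrite mulSn iterD IH.
Qed.

(** A walker on a cycle of length at most [M] passes all its points within [M] steps, so a key
    occurring on the cycle is not missed. *)
Lemma stop_reach z p K t : iter p f z = z -> 0 < p <= M -> key (iter t f z) = K ->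
  exists s, iter M (fun w => if key w == K then w else f w) z = iter s f z /\ key (iter s f z) = K.
Proof.
move=> E /andP[p0 pM] Kt.
have key_tp : key (iter (t %% p) f z) = K by rewrite -iter_mod.
pose g w := if key w == K then w else f w.
have gen k : (exists s, s < k /\ iter k g z = iter s f z /\ key (iter s f z) = K) \/
   (iter k g z = iter k f z /\ forall s, s < k -> key (iter s f z) != K).
  elim: k => [|k [[s [sk [E1 E2]]]|[E1 E2]]]; first by right.
    by left; exists s; split; [exact: ltnW|rewrite iterS E1 /g E2 eqxx].
  rewrite iterS E1 /g; case: eqP => [Kk|nK]; first by left; exists k.
  right; split=> // s; rewrite ltnS leq_eqVlt => /orP[/eqP->|/E2//].
  by apply/eqP.
case: (gen M) => [[s [_ [E1 E2]]]|[_ nk]]; first by exists s.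
have := nk (t %% p); rewrite key_tp eqxx => /(_ _) H; have /= := H (leq_trans (ltn_pmod t p0) pM).
by [].
Qed.

Lemma settleP z0 : 0 < M -> exists s, settle z0 = iter s f (iter M f z0) /\
  key (settle z0) = topkey (iter M f z0).
Proof.
move=> M0; have [p [p0 pM E]] := iter_periodic z0.
have [p' [p0' pM' E']] := iter_periodic (iter M f z0).
set z := iter M f z0 in E p' p0' pM' E' *.
have [i Ei] : exists i : 'I_M, topkey z = key (iter i f z).
  have [|i Ei] := @eq_bigmax _ (fun i : 'I_M => key (iter i f z)); first by rewrite card_ord.
  by exists i.
(* Together with the [M] steps already made, these complete [M] whole periods and [i] further steps,
   which is the point of maximal key. *)
have : key (iter (p * M - M + i) f (iter M f z)) = topkey z.
  rewrite -iterD (_ : p * M - M + i + M = i + p * M); last by case: p p0 {E pM} => // p _; rewrite mulSn; lia.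
  by rewrite iterD (iter_mod (p * M) E) mulnC modnMl.
move/(stop_reach E') => []; first by rewrite p0'.
move=> s [E1 E2]; exists (s + M); rewrite /settle -/z E1 iterD E2.
by [].
Qed.

(** A window of [M] steps covers a full period wherever it starts, so all points of a cycle compute
    the same maximum. *)
Lemma topkey_shift z0 k : topkey (iter k f (iter M f z0)) = topkey (iter M f z0).
Proof.
have [p [p0 pM E]] := iter_periodic z0; set z := iter M f z0 in E *.
have le q r : exists2 r', r' < M & iter r f (iter q f z) = iter r' f z.
  exists ((r + q) %% p); first by apply: leq_trans pM; rewrite ltn_pmod.
  by rewrite -iterD -iter_mod.
have le' q r : exists2 r', r' < M & iter r f z = iter r' f (iter q f z).
  (* The term [p * q] vanishes modulo [p] and keeps the subtraction from truncating. *)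
  exists ((r + p * q - q) %% p); first by apply: leq_trans pM; rewrite ltn_pmod.
  rewrite -iterD (iter_mod _ E) [RHS](iter_mod _ E); congr iter.
  rewrite modnDml subnK; last by case: p p0 {E pM} => // p _; rewrite mulSn; lia.
  by rewrite addnC mulnC modnMDl.
apply/eqP; rewrite eqn_leq; apply/andP; split; apply/bigmax_leqP => i _.
  have [r rM ->] := le k i.
  exact: (@leq_bigmax_cond _ predT (fun i : 'I_M => key (iter i f z)) (Ordinal rM)).
have [r rM ->] := le' k i.
exact: (@leq_bigmax_cond _ predT (fun i : 'I_M => key (iter i f (iter k f z))) (Ordinal rM)).
Qed.

Lemma settle_shift z0 k : 0 < M ->
  (forall s t, key (iter s f z0) = key (iter t f z0) -> iter s f z0 = iter t f z0) ->
  settle (iter k f z0) = settle z0.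
Proof.
move=> M0 inj; have [s [E1 K1]] := settleP z0 M0.
have [t [E2 K2]] := settleP (iter k f z0) M0.
have C : iter M f (iter k f z0) = iter k f (iter M f z0) by rewrite -!iterD addnC.
rewrite C topkey_shift -K1 in K2.
move: K2; rewrite E1 E2 C -!iterD; exact: inj.
Qed.

(** Orbits that meet share their limit cycle, hence its maximal key, and injectivity of the key
    along the orbits leaves a single point to stop at. *)
Lemma settle_merge z0 z1 i j : 0 < M ->
  (forall s t, key (iter s f z0) = key (iter t f z0) -> iter s f z0 = iter t f z0) ->
  (forall s t, key (iter s f z1) = key (iter t f z1) -> iter s f z1 = iter t f z1) ->
  iter i f z0 = iter j f z1 -> settle z0 = settle z1.
Proof.
by move=> M0 i0 i1 E; rewrite -(settle_shift i M0 i0) E settle_shift.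
Qed.
End Orbit.

(** * Initial groups, and the searches of one phase *)

Section Phase.
Variables (V : finType) (adj : rel V) (port : V -> nat -> V).
Hypothesis adjS : symmetric adj.
Hypothesis adjI : irreflexive adj.
Hypothesis portP : port_labeling adj port.
Hypothesis conn : connected_graph adj.
Notation deg := (deg adj).
Notation rport := (rport adj port).
Notation N := #|V|.
Variable id : 'I_N -> nat.
Hypothesis id_inj : injective id.
Hypothesis id_pos : forall a, 0 < id a.
Variable e : nat.
Hypothesis Ne : N <= 2 ^ e.
Notation conf := ('I_N -> cell V st1).
Notation rstep := (rstep adj port id).
Notation rrun := (rrun adj port id).
Notation H x a := (hom (co (cs (x a)))).
Notation X x a := (lab (co (cs (x a)))).
Notation L x a := (cl (x a)).
Notation act x a := (actv (cs (x a))).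
Notation pr x a := (par (co (cs (x a)))).
Notation ch x a := (chd (co (cs (x a)))).
Notation fr x a := (frz (co (cs (x a)))).
Notation ginv := (ginv adj port id).
Notation grp := (grp adj port id).

Definition piles (S : Type) (x : 'I_N -> cell V S) := [set v | 1 < #|[set a | cl (x a) == v]|].

Lemma rrun_eq S (tr tr' : nat -> nat -> S -> nat -> option nat -> seq (nat * S) -> S * option nat) t t' k x :
  (forall i, i < k -> tr (t + i) = tr' (t' + i)) -> rrun tr t k x = rrun tr' t' k x.
Proof.
elim: k => //= k IH E; rewrite IH ?E // => i ik.
by apply: E; apply: ltnW.
Qed.

Section Init.
Variable x0 : conf.
Let x1 := rstep tr_init x0.

Let L1 a : L x1 a = L x0 a.
Proof. by rewrite /x1 rstepE. Qed.

Let H1 a : H x1 a = [forall b, (b != a) && (L x0 b == L x0 a) ==> (id b < id a)].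
Proof.
rewrite /x1 rstepE /=; apply/idP/forallP => [lt b|all].
  apply/implyP=> /andP[ba /eqP E]; apply: leq_ltn_trans lt.
  exact: (maxo_view_ge id fst ba E).
case: (maxo_viewP id fst x0 a) => [->|[b [ba E ->]]] /=; first exact: id_pos.
by have := all b; rewrite ba E eqxx.
Qed.

Let homeP a : H x1 a -> forall b, L x0 b = L x0 a -> id b <= id a.
Proof.
rewrite H1 => /forallP all b E; case: (eqVneq b a) => [->//|ba].
by have := all b; rewrite ba E eqxx => /ltnW.
Qed.

Let X1 a h : H x1 h -> L x0 h = L x0 a -> X x1 a = if [exists b, (b != a) && (L x0 b == L x0 a)] then id h else 0.
Proof.
move=> Hh E; rewrite /x1 rstepE /=.
case: existsP => [[b /andP[ba /eqP Eb]]|none].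
  case Ev: (view id x0 a) => [|o s].
    have := has_view id predT x0 a; rewrite Ev /= => /esym/existsP[]; exists b.
    by rewrite ba Eb eqxx.
  rewrite -Ev; apply/eqP; rewrite eqn_leq; apply/andP; split.
    rewrite geq_max (homeP Hh) // andbT; apply: maxo_view_le => c ca Ec /=.
    by apply: (homeP Hh); rewrite Ec.
  rewrite leq_max; case: (eqVneq h a) => [->|ha]; first by rewrite leqnn orbT.
  by rewrite (maxo_view_ge id fst ha E).
case Ev: (view id x0 a) => [//|o s].
have := has_view id predT x0 a; rewrite Ev /= => /esym/existsP[b /and3P[ba Eb _]].
by case: none; exists b; rewrite ba.
Qed.

Let home_ex a : exists2 h, H x1 h & L x0 h = L x0 a.
Proof.
case: (@arg_maxnP _ a (fun b => L x0 b == L x0 a) id (eqxx _)) => h /eqP Eh mx.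
exists h => //; rewrite H1; apply/forallP => b; apply/implyP=> /andP[bh /eqP Eb].
have /= le : geq (id h) (id b) by apply: mx; rewrite Eb Eh.
by rewrite ltn_neqAle le andbT; apply: contraNneq bh => /id_inj ->.
Qed.

Let rest1 a : [/\ pr x1 a = 0, ch x1 a = 0, fr x1 a = false & wk (cs (x1 a)) = Wlk false (X x1 a) 0].
Proof. by rewrite /x1 rstepE. Qed.

(** Lone agents are homes too, but with label 0, and identifiers are positive; so only the homes
    that start a group remain. *)
Let Q := [set a | H x1 a && (X x1 a == id a)].

Let home_lab a : H x1 a -> X x1 a != 0 -> X x1 a = id a.
Proof. by move=> Ha; rewrite (X1 Ha erefl); case: ifP. Qed.

Let spare_lab b : ~~ H x1 b -> exists a, [/\ H x1 a, L x0 a = L x0 b, X x1 a = id a & X x1 b = id a].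
Proof.
move=> Hb; have [h Hh Lh] := home_ex b; exists h.
have hb : h != b by apply: contraNneq Hb => <-.
rewrite (X1 Hh Lh) (X1 Hh erefl); split=> //.
  by case: existsP => // -[]; exists b; rewrite eq_sym hb Lh eqxx.
by case: existsP => // -[]; exists h; rewrite hb Lh eqxx.
Qed.

Lemma init_inv : ginv Q x1 0.
Proof.
have injH a b : H x1 a -> H x1 b -> L x0 a = L x0 b -> a = b.
  by move=> Ha Hb E; apply: id_inj; apply/eqP; rewrite eqn_leq (homeP Ha) ?(homeP Hb).
have labP a : X x1 a != 0 -> exists2 r, r \in Q & id r = X x1 a.
  case Ha: (H x1 a) => Xa.
    by exists a; rewrite ?inE ?Ha home_lab ?eqxx.
  have [h [Hh Lh Xh ->]] := spare_lab (negbT Ha).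
  by exists h; rewrite // inE Hh Xh eqxx.
split=> //.
- split.
  + by move=> a; rewrite /x1 rstepE.
  + by move=> a b Ha Hb; rewrite !L1; apply: injH.
  + move=> b Hb; have [a [Ha La Xa Xb]] := spare_lab Hb.
    by rewrite Xb -lt0n id_pos; split=> //; exists a; rewrite !L1 La Xa.
  + move=> b c Hb Hc; have [a [Ha La Xa ->]] := spare_lab Hb.
    have [a' [Ha' La' Xa' ->]] := spare_lab Hc => /id_inj E.
    have [_ _ -> _] := rest1 b; have [_ _ -> _] := rest1 c.
    by rewrite !L1 -La -La' E.
- move=> l a l0 Ha Xa; have ida : id a = l by rewrite -Xa home_lab // Xa.
  have T1 b : H x1 b -> X x1 b = l -> b = a.
    by move=> Hb Xb; apply: id_inj; rewrite ida -Xb home_lab // Xb.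
  have [P1 C1 F1 _] := rest1 a.
  exists a, [::]; split=> //.
  + by move=> b; rewrite inE => /eqP->.
  + by move=> b Hb Xb; rewrite (T1 b Hb Xb); apply: Climb0.
  + by move=> b Hb Xb; rewrite (T1 b Hb Xb) inE eqxx.
  + move=> b Hb Xb; have [h [Hh Lh _ Xb']] := spare_lab Hb.
    have Eh : h = a by apply: id_inj; rewrite ida -Xb -Xb'.
    have [_ _ -> _] := rest1 b; rewrite !L1 -Lh Eh.
    have -> : [set c | H x1 c && (X x1 c == l)] = [set a]; last by rewrite cards1; split.
    apply/setP=> c; rewrite !inE; apply/andP/eqP => [[Hc /eqP Xc]|->]; first exact: T1.
    by rewrite Ha Xa.
- by move=> r; rewrite inE => /andP[-> /eqP].
- by move=> a _; case: (rest1 a).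
Qed.

(** Roots stand on distinct nodes, and a root has company, since its label is nonzero. *)
Lemma init_card : #|Q| <= #|piles x0|.
Proof.
rewrite -(card_in_imset (f := fun a => L x0 a) (D := Q)); last first.
  move=> a b; rewrite !inE => /andP[Ha _] /andP[Hb _] E.
  by apply: id_inj; apply/eqP; rewrite eqn_leq (homeP Ha) ?(homeP Hb).
apply: subset_leq_card; apply/subsetP => v /imsetP[a]; rewrite inE => /andP[Ha /eqP Xa] ->.
rewrite inE; move: Xa; rewrite (X1 Ha erefl); case: existsP => [[b /andP[ba Lb]] _|_ E]; last first.
  by have := id_pos a; rewrite -E.
rewrite (cardsD1 a) inE eqxx ltnS; apply/card_gt0P; exists b.
by rewrite !inE ba.
Qed.
End Init.

Section OneMacro.
Variable Q : {set 'I_N}.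

Lemma macro_run x j : ginv Q x j -> ginv Q (rrun (tr_macro e) 0 (macroL e) x) j.+1.
Proof.
move=> I; have B := inv_bd I.
have bt k : k <= e -> batch_inv adj port x k (rrun (tr_macro e) 0 (3 * k) x).
  elim: k => [|k IH] ke; first exact: batch0.
  have -> : 3 * k.+1 = (3 * k).+3 by lia.
  rewrite /= !add0n.
  have lt : (3 * k).+2 < 3 * e by lia.
  rewrite /tr_macro (ltnW (ltnW lt)) (ltnW lt) lt.
  have -> : 3 * k %/ 3 = k by lia.
  have -> : 3 * k %% 3 = 0 by lia.
  have -> : (3 * k).+1 %/ 3 = k by lia.
  have -> : (3 * k).+1 %% 3 = 1 by lia.
  have -> : (3 * k).+2 %/ 3 = k by lia.
  have -> : (3 * k).+2 %% 3 = 2 by lia.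
  by apply: batchS => //; apply: IH; apply: ltnW.
have -> : macroL e = (3 * e).+4 by rewrite /macroL; lia.
have t0 : tr_macro e (3 * e) = tr_dec by rewrite /tr_macro ltnn subnn.
have t1 : tr_macro e (3 * e).+1 = tr_act by rewrite /tr_macro ltnNge leqnSn subSnn.
have t2 : tr_macro e (3 * e).+2 = tr_look2.
  by rewrite /tr_macro ltnNge -(addn2 (3 * e)) leq_addr addKn.
have t3 : tr_macro e (3 * e).+3 = tr_res.
  by rewrite /tr_macro ltnNge -(addn3 (3 * e)) leq_addr addKn.
rewrite /= !add0n t0 t1 t2 t3.
have M := macroP adjS adjI portP id_inj id_pos Ne B (bt e (leqnn e)).
by apply: inv_step I M.
Qed.

Lemma macro_runs x j : j <= walkL e -> ginv Q x 0 -> ginv Q (rrun (tr1 e) 1 (j * macroL e) x) j.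
Proof.
elim: j => [|j IH] je I; first by [].
rewrite mulSn addnC rrunD (rrun_eq (tr' := tr_macro e) (t' := 0)); last first.
  move=> i iL; rewrite -addnA add1n /= add0n.
  have -> : j * macroL e + i < walkL e * macroL e.
    by apply: (@leq_trans (j.+1 * macroL e)); rewrite ?leq_mul2r ?je ?orbT // mulSn addnC ltn_add2r.
  by rewrite modnMDl modn_small.
by apply: macro_run; apply: IH => //; apply: ltnW.
Qed.
End OneMacro.
End Phase.

(** The source of the factor two: [A] will be the set of roots and [P] the nodes still overcrowded
    at the end of the phase. *)
Lemma double_fibers (I J : finType) (A : {set I}) (F : I -> J) (P : {set J}) :
  (forall v, v \in P -> exists r r', [/\ r \in A, r' \in A, r != r', F r = v & F r' = v]) ->
  2 * #|P| <= #|A|.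
Proof.
move=> PF.
have -> : #|A| = \sum_(v in F @: A) #|[set r in A | F r == v]|.
  rewrite -sum1_card (partition_big_imset F) /=; apply: eq_bigr => v _.
  by rewrite -sum1_card; apply: eq_bigl => r; rewrite inE.
have sub : P \subset F @: A.
  by apply/subsetP=> v /PF [r [r' [rQ _ _ <- _]]]; apply: imset_f.
apply: (@leq_trans (\sum_(v in P) #|[set r in A | F r == v]|)).
  rewrite mulnC -sum_nat_const; apply: leq_sum => v /PF [r [r' [rQ r'Q ne E1 E2]]].
  rewrite (cardsD1 r) inE rQ E1 eqxx ltnS; apply/card_gt0P; exists r'.
  by rewrite !inE eq_sym ne r'Q E2 eqxx.
by rewrite [leqRHS](big_setID P) /= (setIidPr sub) leq_addr.
Qed.

(** * Walks of the spares, and halving of the overcrowded nodes *)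

Section Walk.
Variables (V : finType) (adj : rel V) (port : V -> nat -> V).
Hypothesis adjS : symmetric adj.
Hypothesis adjI : irreflexive adj.
Hypothesis portP : port_labeling adj port.
Hypothesis conn : connected_graph adj.
Notation deg := (deg adj).
Notation rport := (rport adj port).
Notation N := #|V|.
Variable id : 'I_N -> nat.
Hypothesis id_inj : injective id.
Hypothesis id_pos : forall a, 0 < id a.
Variable e : nat.
Hypothesis Ne : N <= 2 ^ e.
Notation conf := ('I_N -> cell V st1).
Notation rstep := (rstep adj port id).
Notation rrun := (rrun adj port id).
Notation H x a := (hom (co (cs (x a)))).
Notation X x a := (lab (co (cs (x a)))).
Notation L x a := (cl (x a)).
Notation pr x a := (par (co (cs (x a)))).
Notation ch x a := (chd (co (cs (x a)))).
Notation fr x a := (frz (co (cs (x a)))).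
Notation ginv := (ginv adj port id).
Notation grp := (grp adj port id).

Section Run.
Variables (Q : {set 'I_N}) (x : conf).
Hypothesis I : ginv Q x (walkL e).

(** Homes stand on distinct nodes, so this reads the home at [u], with 0 if there is none. *)
Definition hmax (F : nat -> core -> nat) u :=
  \max_(b | H x b && (L x b == u)) F (id b) (co (cs (x b))).

Lemma hmaxE F a u : H x a -> L x a = u -> hmax F u = F (id a) (co (cs (x a))).
Proof.
move=> Ha La; rewrite /hmax (big_pred1 a) // => b /=.
apply/andP/eqP => [[Hb /eqP Lb]|->]; last by rewrite Ha La eqxx.
by apply: (bd_inj (inv_bd I)) => //; rewrite La.
Qed.

Definition hy := hmax (fun _ c => lab c).
Definition hp := hmax (fun _ c => par c).
Definition hc := hmax (fun _ c => chd c).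
Definition hu := hmax (fun u _ => u).
Definition wdest u p := if p < deg u then port u p else u.

(* A walker in up mode ([true]) climbs to the root of the tree it is in; in down
   mode it descends along the stack to the head and crosses to the next tree. *)
Definition Phi (z : V * bool) : V * bool :=
  let: (u, m) := z in
  let up := m && (hp u != 0) in
  let u' := if up then wdest u (hp u).-1 else if hc u is q.+1 then wdest u q else u in
  (u', (hy u' != hy u) || up).

Definition wkey (z : V * bool) := 2 * hu z.1 + z.2.

Definition wstat (y : conf) := forall a,
  co (cs (y a)) = co (cs (x a)) /\ (H x a -> L y a = L x a).

(** The stored mode predates the last move, because a crossing is noticed only at the node reached.
    This is the mode that the next step will use, and it makes the walk an iteration of [Phi]. *)
Definition eff (y : conf) a := (L y a, (hy (L y a) != wl (wk (cs (y a)))) || md (wk (cs (y a)))).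

Lemma walk_view y a F : wstat y -> ~~ H x a ->
  maxo (fun o => if hom (co o.2) then F o.1 (co o.2) else 0) (view id y a) = hmax F (L y a).
Proof.
move=> S Ha; rewrite maxo_view /hmax /= -big_mkcondr /=.
rewrite (eq_bigr (fun b => F (id b) (co (cs (x b))))); last first.
  by move=> b _; have [-> _] := S b.
apply: eq_bigl => b; have [E Lb] := S b; rewrite E.
case Hb: (H x b); rewrite ?andbF // andbT Lb //=.
by rewrite (_ : b != a) //; apply: contraNneq Ha => <-.
Qed.

Lemma walk_step w y : wstat y -> let y' := rstep (tr_walk w) y in wstat y' /\
  forall a, ~~ H x a -> let W := wk (cs (y a)) in
   if (w == 2) && (wkey (eff y a) == wmx W) then eff y' a = eff y a /\ wmx (wk (cs (y' a))) = wmx W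
   else eff y' a = Phi (eff y a) /\
     wmx (wk (cs (y' a))) = if w == 1 then maxn (wmx W) (wkey (eff y a)) else wmx W.
Proof.
move=> S y'.
have sp a : ~~ H x a -> let W := wk (cs (y a)) in co (cs (y' a)) = co (cs (x a)) /\
   if (w == 2) && (wkey (eff y a) == wmx W) then eff y' a = eff y a /\ wmx (wk (cs (y' a))) = wmx W
   else eff y' a = Phi (eff y a) /\
     wmx (wk (cs (y' a))) = if w == 1 then maxn (wmx W) (wkey (eff y a)) else wmx W.
  move=> Ha W; rewrite /eff /y' !rstepE /tr_walk.
  have [E _] := S a; rewrite E (negbTE Ha).
  rewrite !(walk_view (fun u c => slab (S1 c (tm (cs (y a))) (wk (cs (y a))))) S Ha).
  rewrite !(walk_view (fun u c => par c) S Ha) !(walk_view (fun u c => chd c) S Ha).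
  rewrite !(walk_view (fun u c => u) S Ha) -/hp -/hc -/hu.
  have -> : hmax (fun u c => slab (S1 c (tm (cs (y a))) (wk (cs (y a))))) = hy by [].
  rewrite /wkey /=; set m := (_ || _); case: ((w == 2) && _) => //.
  case up: (m && (hp (L y a) != 0)) => /=.
    by rewrite /wdest; case: ifP.
  case: (hc (L y a)) => [|q] //=.
  by rewrite /wdest; case: ifP.
split=> [a|a Ha]; last by case: (sp a Ha).
case Ha: (H x a); last by have [-> _] := sp a (negbT Ha).
have [E La] := S a; rewrite /y' rstepE /tr_walk E Ha /= E.
by split=> // _; apply: La.
Qed.

Let T0 := (walkL e * macroL e).+1.
Let M := walkL e.
Let y k := rrun (tr1 e) T0 k x.

Lemma tr1_walk k : tr1 e (T0 + k) = tr_walk (k %/ M).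
Proof. by rewrite /T0 addSn /= ltnNge leq_addr /= addKn. Qed.

Lemma yS k : y k.+1 = rstep (tr_walk (k %/ M)) (y k).
Proof. by rewrite -tr1_walk. Qed.

Lemma M_gt0 : 0 < M.
Proof. by rewrite /M /walkL muln_gt0 expn_gt0. Qed.

Lemma M_card : #|{: V * bool}| <= M.
Proof. by rewrite card_prod card_bool mulnC leq_mul2l Ne orbT. Qed.

Lemma walk_run : wstat (y (3 * M)) /\ forall a, ~~ H x a ->
  eff (y (3 * M)) a = settle Phi wkey M (eff x a).
Proof.
have M0 := M_gt0.
have w0 k : k <= M -> wstat (y k) /\ forall a, ~~ H x a ->
   eff (y k) a = iter k Phi (eff x a) /\ wmx (wk (cs (y k a))) = 0.
  elim: k => [|k IH] kM.
    by split=> // a Ha; split=> //; rewrite (inv_wk I).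
  have [S E] := IH (ltnW kM).
  have Ey : y k.+1 = rstep (tr_walk 0) (y k) by rewrite yS divn_small.
  have [S' E'] := walk_step 0 S; rewrite Ey; split=> // a Ha.
  have [-> ->] : eff (rstep (tr_walk 0) (y k)) a = Phi (eff (y k) a) /\
    wmx (wk (cs (rstep (tr_walk 0) (y k) a))) = wmx (wk (cs (y k a))) := E' a Ha.
  by have [-> ->] := E a Ha.
have w1 k : k <= M -> wstat (y (M + k)) /\ forall a, ~~ H x a ->
   eff (y (M + k)) a = iter k Phi (iter M Phi (eff x a)) /\
   wmx (wk (cs (y (M + k) a))) = \max_(i < k) wkey (iter i Phi (iter M Phi (eff x a))).
  elim: k => [|k IH] kM.
    rewrite addn0; have [S E] := w0 M (leqnn M); split=> // a Ha.
    by have [-> ->] := E a Ha; rewrite big_ord0.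
  have [S E] := IH (ltnW kM).
  have Ey : y (M + k.+1) = rstep (tr_walk 1) (y (M + k)).
    by rewrite addnS yS -[M in M + k]mul1n divnMDl // divn_small.
  have [S' E'] := walk_step 1 S; rewrite Ey; split=> // a Ha.
  have [-> ->] : eff (rstep (tr_walk 1) (y (M + k))) a = Phi (eff (y (M + k)) a) /\
    wmx (wk (cs (rstep (tr_walk 1) (y (M + k)) a))) = maxn (wmx (wk (cs (y (M + k) a)))) (wkey (eff (y (M + k)) a)) := E' a Ha.
  by have [-> ->] := E a Ha; rewrite big_ord_recr.
have w2 k : k <= M -> wstat (y (M + M + k)) /\ forall a, ~~ H x a ->
   let K := topkey Phi wkey M (iter M Phi (eff x a)) in
   eff (y (M + M + k)) a = iter k (fun w => if wkey w == K then w else Phi w) (iter M Phi (iter M Phi (eff x a))) /\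
   wmx (wk (cs (y (M + M + k) a))) = K.
  elim: k => [|k IH] kM.
    by rewrite addn0; have [S E] := w1 M (leqnn M); split=> // a Ha; apply: E.
  have [S E] := IH (ltnW kM).
  have Ey : y (M + M + k.+1) = rstep (tr_walk 2) (y (M + M + k)).
    by rewrite addnS yS (_ : M + M + k = 2 * M + k) ?divnMDl // ?divn_small // mul2n addnn.
  have [S' E'] := walk_step 2 S; rewrite Ey; split=> // a Ha K.
  have := E' a Ha; have [E1 E2] := E a Ha; cbv zeta.
  by rewrite E1 E2 -/K eqxx andTb iterS; case: ifP => _ [-> ->].
have [] := w2 M (leqnn M); rewrite (_ : M + M + M = 3 * M); last lia.
by move=> S E; split=> // a Ha; have [-> _] := E a Ha.
Qed.

(** Child pointers are sure to lead to the head only along the stack, so descent is confined to it.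
    Climbing may start anywhere in a tree, as it ends at the root, which is on the stack. *)
Definition good (z : V * bool) := exists l h s a,
  [/\ l != 0, grp x M l h s, H x a, X x a = l & L x a = z.1 /\ (z.2 = false -> a \in h :: s)].

(** An active spare would give [M + size s + 2 = 2 * #homes], but the group has at most [2 ^ e]
    homes and [M = 2 * 2 ^ e]. *)
Lemma spare_frozen l h s b : grp x M l h s -> ~~ H x b -> X x b = l -> fr x b.
Proof.
move=> G Hb Xb; have [_] := g_spare G Hb Xb; case: ifP => // _ E.
have : #|[set a | H x a && (X x a == l)]| <= 2 ^ e.
  by apply: leq_trans Ne; apply: leq_trans (max_card _) _; rewrite card_ord.
by move: E; rewrite /M /walkL; lia.
Qed.

Lemma head_cases l h s : l != 0 -> grp x M l h s -> ch x h = 0 \/ exists q w,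
  [/\ ch x h = q.+1, q < deg (L x h), L x w = port (L x h) q, H x w & X x w != l /\ X x w != 0].
Proof.
move=> l0 G; case: (pickP [pred b | ~~ H x b && (X x b == l)]) => [b /andP[Hb /eqP Xb]|none].
  have [_] := g_spare G Hb Xb; rewrite (spare_frozen G Hb Xb).
  by case=> q [w [[E1 E2 E3] [E4 E5 E6]]]; right; exists q, w.
left; apply: (g_exh G) => b Hb; apply/negP=> Xb.
by have := none b; rewrite /= Hb Xb.
Qed.

Lemma links_above h s a : links adj port x h s -> a \in s -> exists2 c, c \in h :: s & link adj port x c a.
Proof.
elim: s h => //= u s IH h [lk lks]; rewrite inE => /orP[/eqP->|as_].
  by exists h; rewrite ?mem_head.
by have [c cs lc] := IH u lks as_; exists c; rewrite // inE cs orbT.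
Qed.

Section At.
Variables (l : nat) (h : 'I_N) (s : seq 'I_N) (a : 'I_N).
Hypothesis l0 : l != 0.
Hypothesis G : grp x M l h s.
Hypothesis Ha : H x a.
Hypothesis Xa : X x a = l.

Lemma Phi_up p u : pr x a = p.+1 -> p < deg (L x a) -> port (L x a) p = L x u -> H x u -> X x u = X x a ->
  Phi (L x a, true) = (L x u, true).
Proof.
move=> Ep pd pu Hu Xu; rewrite /Phi /= /hp (hmaxE _ Ha erefl) Ep /= /wdest pd pu.
by rewrite orbT.
Qed.

Lemma Phi_root m : pr x a = 0 -> Phi (L x a, m) = Phi (L x a, false).
Proof. by move=> E; rewrite /Phi /= /hp (hmaxE _ Ha erefl) E /= andbF. Qed.

Lemma Phi_down c : H x c -> X x c = l -> link adj port x c a -> Phi (L x a, false) = (L x c, false).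
Proof.
move=> Hc Xc [p [q [_ [Eq qd qc]]]].
by rewrite /Phi /= /hc (hmaxE _ Ha erefl) Eq /wdest qd qc /hy !(hmaxE _ _ erefl) // Xa Xc eqxx.
Qed.

Lemma Phi_exh : ch x a = 0 -> Phi (L x a, false) = (L x a, false).
Proof. by move=> E; rewrite /Phi /= /hc (hmaxE _ Ha erefl) E eqxx. Qed.

Lemma Phi_cross q w : ch x a = q.+1 -> q < deg (L x a) -> L x w = port (L x a) q -> H x w -> X x w != l ->
  Phi (L x a, false) = (L x w, true).
Proof.
move=> Eq qd qw Hw Xw; rewrite /Phi /= /hc (hmaxE _ Ha erefl) Eq /wdest qd -qw.
by rewrite /hy !(hmaxE _ _ erefl) // Xa Xw.
Qed.
End At.

Lemma good_down l h s a : l != 0 -> grp x M l h s -> a \in h :: s -> good (Phi (L x a, false)).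
Proof.
move=> l0 G as_; have [Ha Xa] := g_T G as_.
case: (eqVneq a h) as_ => [-> _|ah].
  have [Hh Xh] := g_T G (mem_head h s).
  case: (head_cases l0 G) => [Ec|[q [w [Ec qd Lw Hw [Xw Xw0]]]]].
    by rewrite Phi_exh //; exists l, h, s, h; rewrite mem_head.
  rewrite (Phi_cross Hh Xh Ec qd Lw Hw Xw).
  have [h' [s' G']] := inv_grp I Xw0 Hw erefl.
  by exists (X x w), h', s', w.
rewrite inE (negbTE ah) orFb => as_.
have [c cs_ lc] := links_above (g_links G) as_; have [Hc Xc] := g_T G cs_.
by rewrite (Phi_down Ha Xa Hc Xc lc); exists l, h, s, c.
Qed.

Lemma good_Phi z : good z -> good (Phi z).
Proof.
case: z => u m [l [h [s [a [l0 G Ha Xa [La st]]]]]].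
simpl in La, st; rewrite -La => {u La}; case: m st => [_|/(_ erefl) as_]; last exact: good_down G as_.
have C := g_climb G Ha Xa; case: C Ha Xa => [|c v p Ec pd pv Hv Xv _] Hc Xc.
  by rewrite (Phi_root Hc); [apply: good_down G (mem_last _ _)|case: (g_root G)].
by rewrite (Phi_up Hc Ec pd pv Hv Xv); exists l, h, s, v; split; rewrite // Xv.
Qed.

Lemma good_iter k z : good z -> good (iter k Phi z).
Proof. by elim: k => //= k IH gz; apply: good_Phi; apply: IH. Qed.

(** The parity of the key is the mode, and its half is the identifier of the home, which determines
    the node. *)
Lemma good_key z z' : good z -> good z' -> wkey z = wkey z' -> z = z'.
Proof.
case: z z' => u m [u' m'] [l [h [s [a [_ _ Ha _ /= [La _]]]]]] [l' [h' [s' [a' [_ _ Ha' _ /= [La' _]]]]]].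
rewrite /wkey /= /hu (hmaxE _ Ha La) (hmaxE _ Ha' La').
case: m; case: m' => /= E; try lia.
  by rewrite -La -La'; have -> : a = a' by apply: id_inj; lia.
by rewrite -La -La'; have -> : a = a' by apply: id_inj; lia.
Qed.

Lemma good_settle z z' i j : good z -> good z' -> iter i Phi z = iter j Phi z' ->
  settle Phi wkey M z = settle Phi wkey M z'.
Proof.
move=> gz gz'; apply: settle_merge; [exact: M_card|exact: M_gt0|..] => k k' E.
  by apply: good_key => //; apply: good_iter.
by apply: good_key => //; apply: good_iter.
Qed.

Lemma down_head l h s a : grp x M l h s -> a \in h :: s -> exists i, iter i Phi (L x a, false) = (L x h, false).
Proof.
move=> G as_; have lk := g_links G.
have T b : b \in h :: s -> H x b /\ X x b = l by move=> bs; exact: (g_T G bs).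
clear G; elim: s h lk T as_ => [|u s IH] h lk T.
  by rewrite inE => /eqP->; exists 0.
rewrite inE => /orP[/eqP->|as_]; first by exists 0.
have [l1 l2] := lk; have [|i Ei] := IH u l2 _ as_.
  by move=> b bs; apply: T; rewrite inE bs orbT.
have [Hh Xh] := T h (mem_head _ _).
have [|Hu Xu] := T u; first by rewrite !inE eqxx orbT.
by exists i.+1; rewrite iterS Ei (Phi_down Hu Xu Hh Xh l1).
Qed.

(** The climb ends at the root, where [Phi] ignores the mode, and then follows the stack; both
    orbits thus pass through [Phi (L x h, false)]. *)
Lemma meet_head l h s a : l != 0 -> grp x M l h s -> H x a -> X x a = l ->
  exists i j, iter i Phi (L x a, true) = iter j Phi (L x h, false).
Proof.
move=> l0 G Ha Xa; have C := g_climb G Ha Xa.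
elim: C Ha Xa => {a} [|c u p Ec pd pu Hu Xu _ IH] Hc Xc.
  have [_ pr0] := g_root G.
  have [i Ei] := down_head G (mem_last h s).
  exists i.+1, 1; rewrite iterSr (Phi_root Hc _ pr0) -iterSr iterS Ei.
  by [].
have [|i [j E]] := IH Hu; first by rewrite Xu.
by exists i.+1, j; rewrite iterSr (Phi_up Hc Ec pd pu Hu Xu).
Qed.

Definition goal r := settle Phi wkey M (L x r, true).

Lemma good_home a : H x a -> X x a != 0 -> good (L x a, true).
Proof. by move=> Ha Xa; have [h [s G]] := inv_grp I Xa Ha erefl; exists (X x a), h, s, a. Qed.

Lemma good_head l h s : l != 0 -> grp x M l h s -> good (L x h, false).
Proof. by move=> l0 G; have [Hh Xh] := g_T G (mem_head h s); exists l, h, s, h; rewrite mem_head. Qed.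

Lemma settle_head l h s a : l != 0 -> grp x M l h s -> H x a -> X x a = l ->
  settle Phi wkey M (L x a, true) = settle Phi wkey M (L x h, false).
Proof.
move=> l0 G Ha Xa; have [i [j E]] := meet_head l0 G Ha Xa.
apply: good_settle E; first by apply: good_home; rewrite ?Xa.
exact: good_head G.
Qed.

(** The spare is frozen at the head of its group, whose child pointer crosses to another group. The
    orbits of the two roots therefore merge, and no spare stops at a place that belongs to one root
    alone. *)
Lemma spare_goal b r : ~~ H x b -> r \in Q -> id r = X x b -> settle Phi wkey M (eff x b) = goal r /\
  exists r', [/\ r' \in Q, r' != r & goal r' = goal r].
Proof.
move=> Hb rQ ir; have [Hr Xr] := inv_Q I rQ.
have l0 : X x r != 0 by rewrite Xr -lt0n.
have [h [s G]] := inv_grp I l0 Hr erefl.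
have Xb : X x b = X x r by rewrite Xr.
have [Hh Xh] := g_T G (mem_head h s).
have [Lb] := g_spare G Hb Xb; rewrite (spare_frozen G Hb Xb).
case=> q [w [[Ec qd Lw] [Hw Xw Xw0]]].
have Eb : eff x b = (L x h, false).
  by rewrite /eff Lb (inv_wk I Hb) /= /hy (hmaxE _ Hh erefl) Xh Xb eqxx.
rewrite Eb /goal (settle_head l0 G Hr erefl); split=> //.
have [r' r'Q ir'] := inv_lab I Xw0.
have [Hr' Xr'] := inv_Q I r'Q; exists r'; split=> //.
  by apply: contraNneq Xw => <-; rewrite Xr' ir'.
have [h' [s' G']] := inv_grp I Xw0 Hw erefl.
rewrite /goal (settle_head Xw0 G' Hr') ?Xr' // -(settle_head Xw0 G' Hw erefl).
apply: (@good_settle _ _ 0 1); [exact: good_home|exact: good_head G|].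
by rewrite iterS [iter 0 _ (L x h, _)]/iter (Phi_cross Hh Xh Ec qd Lw Hw Xw).
Qed.

Lemma walk_halves : 2 * #|piles (y (3 * M))| <= #|Q|.
Proof.
have [S E] := walk_run.
pose F r := (goal r).1.
pose P := piles (y (3 * M)).
have PF v : v \in P -> exists r r', [/\ r \in Q, r' \in Q, r != r', F r = v & F r' = v].
  rewrite inE => lt.
  (* Homes do not walk and occupy distinct nodes, so of two agents on a node one is a spare. *)
  have [b Hb Lb] : exists2 b, ~~ H x b & L (y (3 * M)) b = v.
    case: (pickP [pred b | ~~ H x b && (L (y (3 * M)) b == v)]) => [b /andP[Hb /eqP Lb]|none].
      by exists b.
    have allH b : L (y (3 * M)) b = v -> H x b.
      by move=> Lb; have := none b; rewrite /= Lb eqxx andbT => /negbFE.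
    have [b bv] : exists b, L (y (3 * M)) b == v.
      by have /card_gt0P[b] := ltnW lt; rewrite inE => bv; exists b.
    move: lt; rewrite (cardsD1 b) inE bv ltnS => /card_gt0P[c]; rewrite !inE => /andP[cb /eqP cv].
    have Hb := allH b (eqP bv); have Hc := allH c cv.
    have [_ Lb] := S b; have [_ Lc] := S c.
    case/eqP: cb; apply: (bd_inj (inv_bd I)) => //.
    by rewrite -Lb // -Lc // cv (eqP bv).
  have [X0 _] := bd_sp (inv_bd I) Hb.
  have [r rQ ir] := inv_lab I X0.
  have [E1 [r' [r'Q ne E2]]] := spare_goal Hb rQ ir.
  exists r, r'; split=> //; first by rewrite eq_sym.
    by rewrite /F -E1 -E.
  by rewrite /F E2 -E1 -E.
exact: (double_fibers PF).
Qed.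
End Run.

Lemma phase_halves x : 2 * #|piles (rrun (tr1 e) 0 (phaseL e) x)| <= #|piles x|.
Proof.
have -> : phaseL e = 1 + walkL e * macroL e + 3 * walkL e by rewrite /phaseL; lia.
have I0 := init_inv adj port id_inj id_pos x.
have I := macro_runs adjS adjI portP conn id_inj id_pos Ne (leqnn _) I0.
rewrite (rrunD _ _ _ _ _ _ (3 * walkL e)) (rrunD _ _ _ _ _ 1).
apply: leq_trans (walk_halves I) _.
exact: init_card.
Qed.
End Walk.

(** * Depth-first search computing a maximal independent set *)

Section DFS.
Variables (V : finType) (adj : rel V) (port : V -> nat -> V).
Hypothesis adjS : symmetric adj.
Hypothesis adjI : irreflexive adj.
Hypothesis portP : port_labeling adj port.
Hypothesis conn : connected_graph adj.
Notation deg := (deg adj).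

(* [dm v] is 0 while [v] has no known neighbour in the independent set, and
   otherwise one more than a port leading to such a neighbour; a node enters the
   set when it leaves the stack with [dm v = 0]. *)
Record ds := DS { stk : seq V; pt : V -> nat; dm : V -> nat; vs : {set V} }.

Definition upd (f : V -> nat) x k := fun y => if y == x then k else f y.

Definition dinit r := DS [:: r] (fun _ => 0) (fun _ => 0) [set r].

Definition dstep D :=
  if stk D is x :: s then
    if pt D x < deg x then
      let w := port x (pt D x) in
      if w \in vs D then
        DS (stk D) (upd (pt D) x (pt D x).+1)
          (upd (dm D) x (if [&& dm D x == 0, pt D w == deg w & dm D w == 0]
                         then (pt D x).+1 else dm D x)) (vs D)
      else DS (w :: stk D) (pt D) (dm D) (w |: vs D)
    else if s is y :: _ then
      DS s (upd (pt D) y (pt D y).+1)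
        (upd (dm D) y (if (dm D y == 0) && (dm D x == 0) then (pt D y).+1 else dm D y)) (vs D)
    else D
  else D.

Definition dfin D := if stk D is [:: x] then pt D x == deg x else false.

Definition dfsn r k := iter k dstep (dinit r).

Fixpoint chain (D : ds) w s :=
  if s is x :: s' then [/\ port x (pt D x) = w, pt D x < deg x & chain D x s'] else True.

(** [d_dom] and [d_in] become domination and independence at the end. [d_order] is used when a node
    leaves the stack: no node below it, its parent excepted, has explored an edge to it. [d_cnt] is
    the clock: each step advances one port or visits one node. *)
Record dinv r k D : Prop := DInv {
  d_nil : stk D != [::];
  d_uniq : uniq (stk D);
  d_last : last r (stk D) = r;
  d_sub : {subset stk D <= vs D};
  d_chain : if stk D is w :: s then chain D w s else True;
  d_out : forall v, v \notin vs D -> pt D v = 0 /\ dm D v = 0;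
  d_done : forall v, v \in vs D -> v \notin stk D -> pt D v = deg v;
  d_le : forall v, pt D v <= deg v;
  d_vis : forall v i, v \in vs D -> i < pt D v -> port v i \in vs D;
  d_dom : forall v p, dm D v = p.+1 ->
    [/\ p < deg v, port v p \in vs D, port v p \notin stk D & dm D (port v p) = 0];
  d_in : forall v i, v \in vs D -> i < pt D v -> port v i \notin stk D -> dm D (port v i) = 0 -> dm D v != 0;
  d_order : forall s1 y s2, stk D = s1 ++ y :: s2 -> forall i, i < pt D y -> port y i \notin s1;
  d_cnt : \sum_v pt D v + #|vs D| = k.+1 \/ dfin D
}.

Lemma sum_upd f x k : \sum_v upd f x k v + f x = \sum_v f v + k.
Proof.
rewrite (bigD1 x) //= [in RHS](bigD1 x) //= /upd eqxx.
rewrite (eq_bigr f); last by move=> v /negbTE ->.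
lia.
Qed.

Lemma dinv0 r : dinv r 0 (dinit r).
Proof.
split=> //=.
- by move=> v; rewrite !inE.
- by move=> v; rewrite !inE => ->.
- by left; rewrite sum_nat_const muln0 cards1.
Qed.

Lemma chain_upd D D' w s : (forall v, v \in s -> pt D' v = pt D v) -> chain D w s -> chain D' w s.
Proof.
elim: s w => //= x s IH w E [E1 E2 E3].
rewrite !E ?mem_head //; split=> //; apply: IH => // v vs_.
by apply: E; rewrite inE vs_ orbT.
Qed.

Lemma dinvS r k D : dinv r k D -> dinv r k.+1 (dstep D).
Proof.
move=> I; case: (boolP (dfin D)) => fin.
  have -> : dstep D = D.
    move: fin; rewrite /dfin /dstep; case: (stk D) => [//|x [|//]] /eqP ->.
    by rewrite ltnn.
  by case: I => *; split=> //; right.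
case: (d_cnt I) => [cnt|]; last by rewrite (negbTE fin).
have := d_nil I; have := d_chain I; have := d_uniq I; have := d_sub I.
have := d_last I; have := d_order I; have := d_in I; have := d_dom I; have := d_done I.
move: fin; rewrite /dfin /dstep.
case Es: (stk D) => [//|x s] fin dn dom din ord lst sub un chn _.
have xv : x \in vs D by apply: sub; rewrite mem_head.
have lst' : last x s = r by [].
case: ltnP => [pd|dp].
  case: ifP => wv.
  (* visited neighbour *)
    set w := port x (pt D x) in wv *.
    have wx : w != x by apply: port_neq.
    set d := (if _ then _ else _).
    have dE v : v != x -> upd (dm D) x d v = dm D v by rewrite /upd => /negbTE ->.
    have pE v : v != x -> upd (pt D) x (pt D x).+1 v = pt D v by rewrite /upd => /negbTE ->.
    have d0 p : d = p.+1 -> dm D x = p.+1 \/ [/\ dm D x = 0, p = pt D x, pt D w = deg w & dm D w = 0].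
      rewrite /d; case: ifP => [/and3P[/eqP E1 /eqP E2 /eqP E3] [<-]|_]; last by left.
      by right.
    have w_done : w \notin x :: s -> pt D w = deg w by apply: dn.
    (* This makes the test in [dstep] local: below the top, stack nodes still have a port in
       progress, so an exhausted pointer means that [w] has left the stack. *)
    have done_w : pt D w = deg w -> w \notin x :: s.
      move=> E; rewrite inE (negbTE wx) /=; apply/negP=> ws.
      have : pt D w < deg w.
        have lt : forall y t, chain D y t -> w \in t -> pt D w < deg w.
          move=> y t; elim: t y => //= z t IH y [_ lt c]; rewrite inE => /orP[/eqP->//|].
          exact: IH c.
        exact: lt chn ws.
      by rewrite E ltnn.
    split=> //=.
    - apply: chain_upd chn => v vs_ /=; apply: pE.
      by apply: contraTneq vs_ => ->; case/andP: un.
    - move=> v nv; have vx : v != x by apply: contraNneq nv => ->.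
      by rewrite dE // pE //; apply: (d_out I).
    - move=> v vv nv; rewrite pE; first exact: dn.
      by apply: contraNneq nv => ->; rewrite mem_head.
    - move=> v; case: (eqVneq v x) => [->|vx]; first by rewrite /upd eqxx.
      by rewrite pE //; apply: (d_le I).
    - move=> v i vv; case: (eqVneq v x) => [->|vx]; last by rewrite pE //; apply: (d_vis I).
      by rewrite {1}/upd eqxx ltnS leq_eqVlt => /orP[/eqP->//|]; apply: (d_vis I).
    - move=> v p; case: (eqVneq v x) => [->|vx].
        rewrite {1}/upd eqxx => /d0 [/dom [E1 E2 E3 E4]|[E1 -> E3 E4]].
          split=> //; rewrite dE //; apply: contraNneq E3 => ->; exact: mem_head.
        by split=> //; [apply: done_w|rewrite dE].
      rewrite dE // => /dom [E1 E2 E3 E4]; split=> //.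
      by rewrite dE //; apply: contraNneq E3 => ->; rewrite mem_head.
    - move=> v i vv; case: (eqVneq v x) => [->|vx].
        rewrite {1}/upd eqxx ltnS leq_eqVlt => /orP[/eqP->|lt] ns.
          rewrite -/w dE // => dw; rewrite /upd eqxx /d dw (w_done ns) !eqxx andbT.
          by case: (eqVneq (dm D x) 0).
        rewrite dE; last by apply: contraNneq ns => ->; rewrite mem_head.
        move=> E; have := din x i xv lt ns E; rewrite /upd eqxx /d.
        by case: ifP => // /and3P[/eqP ->].
      rewrite pE // => lt ns; rewrite !dE //; first exact: din.
      by apply: contraNneq ns => ->; rewrite mem_head.
    - move=> s1 y s2 E i; case: (eqVneq y x) => [yx|yx]; last by rewrite pE //; apply: ord E i.
      case: s1 E => // z s1 [zx E] _; move: un; rewrite /= E mem_cat inE yx eqxx.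
      by rewrite orbT.
    - by left; have := sum_upd (pt D) x (pt D x).+1; lia.
  (* unvisited neighbour: descend *)
  set w := port x (pt D x) in wv *.
  have /negbT nw := wv; have [pw dw] := d_out I nw.
  split=> //=.
  - by move: un => /= ->; rewrite andbT; apply: contra nw; apply: sub.
  - move=> v; rewrite inE => /orP[/eqP->|/sub vs_]; first by rewrite setU11.
    by rewrite inE vs_ orbT.
  - by split=> //; apply: chain_upd chn.
  - by move=> v; rewrite !inE negb_or => /andP[_]; apply: (d_out I).
  - move=> v; rewrite !inE negb_or => /orP[/eqP->|vv]; first by rewrite eqxx.
    by move=> /andP[_]; apply: dn.
  - exact: (d_le I).
  - move=> v i; rewrite !inE => /orP[/eqP->|vv]; first by rewrite pw.
    by move=> /(d_vis I vv) ->; rewrite orbT.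
  - move=> v p /dom [E1 E2 E3 E4]; rewrite inE [_ \in _ :: _]inE E2 orbT negb_or E3 andbT; split=> //.
    by apply: contraNneq nw => <-.
  - move=> v i; rewrite !inE => /orP[/eqP->|vv]; first by rewrite pw.
    by move=> lt; rewrite negb_or => /andP[_ ns]; apply: din lt ns.
  - move=> -[|z s1] y s2 /= E i lt; first by [].
    case: E => <- E; rewrite inE negb_or (ord s1 y s2) // andbT.
    apply: contraNneq nw => <-; apply: (d_vis I) lt; apply: sub.
    by rewrite E mem_cat inE eqxx orbT.
  - by left; rewrite cardsU1 nw; lia.
have px : pt D x = deg x by apply/eqP; rewrite eqn_leq (d_le I).
case: s Es fin dn dom din ord lst sub un chn lst' => [|y s] Es fin dn dom din ord lst sub un chn lst'.
  by rewrite px eqxx in fin.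
(* backtrack *)
have [py yd chy] := chn; have /= /andP[xs /andP[ys us]] := un.
have xy : x != y by apply: contraNneq xs => ->; rewrite mem_head.
have yv : y \in vs D by apply: sub; rewrite !inE eqxx orbT.
set d := (if _ then _ else _).
have dE v : v != y -> upd (dm D) y d v = dm D v by rewrite /upd => /negbTE ->.
have pE v : v != y -> upd (pt D) y (pt D y).+1 v = pt D v by rewrite /upd => /negbTE ->.
have d0 p : d = p.+1 -> dm D y = p.+1 \/ [/\ dm D y = 0, p = pt D y & dm D x = 0].
  by rewrite /d; case: ifP => [/andP[/eqP E1 /eqP E2] [<-]|_]; [right|left].
have dx : upd (dm D) y d x = dm D x by apply: dE.
split=> //=.
- by rewrite ys.
- move=> v vs_; apply: sub; by rewrite inE vs_ orbT.
- apply: chain_upd chy => v vs_ /=; apply: pE; by apply: contraTneq vs_ => ->.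
- move=> v nv; have vy : v != y by apply: contraNneq nv => ->.
  by rewrite dE // pE //; apply: (d_out I).
- move=> v vv; rewrite inE negb_or => /andP[vy nv]; rewrite pE //.
  by case: (eqVneq v x) => [->//|vx]; apply: dn => //; rewrite !inE !negb_or vx vy.
- move=> v; case: (eqVneq v y) => [->|vy]; first by rewrite /upd eqxx.
  by rewrite pE //; apply: (d_le I).
- move=> v i vv; case: (eqVneq v y) => [->|vy]; last by rewrite pE //; apply: (d_vis I).
  by rewrite {1}/upd eqxx ltnS leq_eqVlt => /orP[/eqP->|]; [rewrite py|apply: (d_vis I)].
- move=> v p; case: (eqVneq v y) => [->|vy].
    rewrite {1}/upd eqxx => /d0 [/dom [E1 E2]|[E1 -> E3]].
      rewrite inE negb_or => /andP[E3 E4] E5; split=> //; rewrite dE //.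
      by apply: contraNneq E4 => ->; rewrite mem_head.
    by rewrite py dE.
  rewrite dE // => /dom [E1 E2]; rewrite inE negb_or => /andP[_ E4] E5; split=> //.
  by rewrite dE //; apply: contraNneq E4 => ->; rewrite mem_head.
- move=> v i vv; case: (eqVneq v y) => [->|vy].
    rewrite {1}/upd eqxx ltnS leq_eqVlt => /orP[/eqP->|lt] ns.
      rewrite py dE // => E; rewrite /upd eqxx /d E eqxx andbT.
      by case: (eqVneq (dm D y) 0).
    rewrite dE; last by apply: contraNneq ns => ->; rewrite mem_head.
    move=> E; have nx : port y i != x.
      apply: contraTneq lt => Ei; rewrite -leqNgt.
      have yi := leq_ltn_trans (leq0n _) yd.
      case: (ltnP i (deg y)) => [id|]; last exact: leq_trans (d_le I y).
      by rewrite (port_inj portP id yd) // Ei py.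
    have := din y i yv lt _ E; rewrite inE negb_or nx => /(_ ns).
    by rewrite /upd eqxx /d; case: ifP => // /andP[/eqP ->].
  rewrite pE // => lt ns.
  have pvy : port v i != y by apply: contraNneq ns => ->; rewrite mem_head.
  rewrite !dE //; case: (eqVneq (port v i) x) => [Ei|nx]; last first.
    by apply: din => //; rewrite inE negb_or nx.
  (* [x] has just left the stack *)
  rewrite Ei => dx0; case: (eqVneq v x) => [vx|vx].
    have id : i < deg v by apply: leq_trans lt (d_le I v).
    by have := port_neq adjI portP id; rewrite Ei vx eqxx.
  case vs_: (v \in s).
    have [s1 [s2 Es2]] : exists s1 s2, s = s1 ++ v :: s2.
      by case/splitPr: vs_ => s1 s2; exists s1, s2.
    have := ord [:: x, y & s1] v s2; rewrite Es2 => /(_ erefl i lt).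
    by rewrite Ei inE eqxx.
  have vn : v \notin x :: y :: s by rewrite !inE vs_ (negbTE vx) (negbTE vy).
  have id : i < deg v by apply: leq_trans lt (d_le I v).
  have xv' : adj x v by rewrite adjS -Ei; apply: port_adj portP _ _ id.
  have [q qd xq] := port_surj portP xv'.
  (* Here [v] left the stack before [x]. With [dm D v = 0] it would dominate [x], whose ports have
     all been explored. *)
  apply/negP=> /eqP dv0.
  by have := din x q xv; rewrite px xq => /(_ qd vn dv0); rewrite dx0.
- move=> s1 z s2 E i; case: (eqVneq z y) => [zy|zy].
    case: s1 E => // u s1 [uy E] _; move: ys; rewrite E mem_cat inE zy eqxx.
    by rewrite orbT.
  rewrite pE // => lt; have := ord (x :: s1) z s2; rewrite E => /(_ erefl i lt).
  by rewrite inE negb_or => /andP[].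
- by left; have := sum_upd (pt D) y (pt D y).+1; lia.
Qed.

Lemma dfs_inv r k : dinv r k (dfsn r k).
Proof. by elim: k => [|k IH]; [apply: dinv0|apply: dinvS]. Qed.

Lemma dfs_fin_step r k : dfin (dfsn r k) -> dfsn r k.+1 = dfsn r k.
Proof.
rewrite /dfsn iterS; set D := iter _ _ _.
rewrite /dfin /dstep; case: (stk D) => [//|x [|//]] /eqP ->.
by rewrite ltnn.
Qed.

(** The count in [d_cnt] would exceed its maximum, all ports plus all nodes. *)
Lemma dfs_finishes r k : \sum_v deg v + #|V| <= k -> dfin (dfsn r k).
Proof.
move=> le; have I := dfs_inv r k.
case: (d_cnt I) => // E.
have : \sum_v pt (dfsn r k) v <= \sum_v deg v by apply: leq_sum => v _; apply: (d_le I).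
by move=> le1; have := leq_trans (leq_add le1 (max_card (mem (vs (dfsn r k))))) le; rewrite E ltnn.
Qed.

Lemma dfs_fin_all r k v : dfin (dfsn r k) -> v \in vs (dfsn r k) /\ pt (dfsn r k) v = deg v.
Proof.
move=> fin; have I := dfs_inv r k; set D := dfsn r k in fin I *.
have [x Es px] : exists2 x, stk D = [:: x] & pt D x = deg x.
  by move: fin; rewrite /dfin; case: (stk D) => [//|x [|//]] /eqP; exists x.
have full u : u \in vs D -> pt D u = deg u.
  move=> uv; case: (eqVneq u x) => [->//|ux]; apply: (d_done I) => //.
  by rewrite Es inE.
suff vv : v \in vs D by split=> //; apply: full.
have xv : x \in vs D by apply: (d_sub I); rewrite Es mem_head.
have /connectP[p] := conn x v; elim: p x xv {Es px} => [|w p IH] x xv /= => [_ ->//|/andP[xw pth] E].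
apply: (IH w) => //; have [i id <-] := port_surj portP xw.
by apply: (d_vis I) => //; rewrite full.
Qed.

(** The root never leaves the stack, but of two adjacent nodes at least one is off it; the other,
    fully explored, has then been marked by [d_in]. *)
Lemma dfs_fin_mis r k : dfin (dfsn r k) ->
  (forall u v, dm (dfsn r k) u = 0 -> dm (dfsn r k) v = 0 -> ~~ adj u v) /\
  (forall v p, dm (dfsn r k) v = p.+1 -> p < deg v /\ dm (dfsn r k) (port v p) = 0).
Proof.
move=> fin; have I := dfs_inv r k; have all v := dfs_fin_all v fin.
set D := dfsn r k in fin I all *.
have [x Es] : exists x, stk D = [:: x].
  by move: fin; rewrite /dfin; case: (stk D) => [//|x [|//]]; exists x.
split=> [u v du dv|v p /(d_dom I) [E1 _ _ E4]] //; apply/negP=> uv.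
have key a b : adj a b -> dm D a = 0 -> dm D b = 0 -> b \notin stk D -> False.
  move=> ab da db ns; have [i id E] := port_surj portP ab.
  have [va pa] := all a; have := d_in I va (i := i); rewrite pa E => /(_ id ns db).
  by rewrite da.
case: (eqVneq v x) => [vx|vx]; last by apply: (key u v) => //; rewrite Es inE.
apply: (key v u) => //; first by rewrite adjS.
by rewrite Es inE -vx; apply/negP=> /eqP E; rewrite E adjI in uv.
Qed.
End DFS.

(** * Leader election *)

(* [hm] marks homes, [key] is the key of the traversal that owns the home, [pr2] is one
   more than the port to the parent, [ptr] the next port to explore, [dom] the value
   [dm] of the traversal, [tok] marks the home whose agent currently moves, and [rty]
   that its last attempt found nobody at the target. During a slot [out2] is 1 for an
   agent exploring a port and 2 for one returning to its parent. *)
Record st2 := S2 { hm : bool; key : nat; pr2 : nat; ptr : nat; dom : nat;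
  tok : bool; rty : bool; out2 : nat; en2 : nat; fin2 : bool }.

Definition trans2 := nat -> st2 -> nat -> option nat -> seq (nat * st2) -> st2 * option nat.

Definition tr2_init : trans2 := fun u s d en oth =>
  let h := maxo fst oth < u in (S2 h (2 * u) 0 0 0 h false 0 0 false, None).

(** In a slow slot everybody except retriers stays at home. A retrier is therefore disappointed
    again only by a target that is itself a retrier with its bit set. *)
Definition elig (slow : bool) (bit : nat -> bool) u (s : st2) :=
  [&& hm s, tok s & if slow then rty s && bit u else ~~ rty s].

Definition set_out s o := S2 (hm s) (key s) (pr2 s) (ptr s) (dom s) (tok s) (rty s) o (en2 s) (fin2 s).

Definition tr2_go slow bit : trans2 := fun u s d en oth =>
  if elig slow bit u s then
    if ptr s < d then (set_out s 1, Some (ptr s))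
    else if pr2 s is p.+1 then (set_out s 2, Some p)
    else (S2 (hm s) (key s) (pr2 s) (ptr s) (dom s) false (rty s) (out2 s) (en2 s) true, None)
  else (s, None).

Definition tr2_rec : trans2 := fun u s d en oth =>
  (S2 (hm s) (key s) (pr2 s) (ptr s) (dom s) (tok s) (rty s) (out2 s) (odflt 0 en) (fin2 s), None).

Definition inhome (s : st2) := hm s && (out2 s == 0).

(** A visitor gives up its token on capturing a home, on returning to its parent, and on meeting a
    larger key. In the first two cases the visited home takes the token over; in the last the
    traversal dies. *)
Definition tr2_res : trans2 := fun u s d en oth =>
  let hk f := maxo (fun o => if inhome o.2 then f o.2 else 0) oth in
  let vk := maxo (fun o => if out2 o.2 != 0 then key o.2 else 0) oth in
  if out2 s != 0 then
    if ~~ has (fun o => inhome o.2) oth then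
      (S2 (hm s) (key s) (pr2 s) (ptr s) (dom s) (tok s) true 0 (en2 s) (fin2 s), Some (en2 s))
    else if (out2 s == 1) && (key s == hk key) then
      (S2 (hm s) (key s) (pr2 s) (ptr s).+1
         (if [&& dom s == 0, hk ptr == d & hk dom == 0] then (ptr s).+1 else dom s)
         (tok s) false 0 (en2 s) (fin2 s), Some (en2 s))
    else (S2 (hm s) (key s) (pr2 s) (ptr s) (dom s) false false 0 (en2 s) (fin2 s), Some (en2 s))
  else if hm s then
    if key s < vk then
      (S2 true vk (maxo (fun o => if (out2 o.2 != 0) && (key o.2 == vk) then en2 o.2 else 0) oth).+1
         0 0 true false 0 (en2 s) false, None)
    else if has (fun o => (out2 o.2 == 2) && (key o.2 == key s)) oth then
      (S2 true (key s) (pr2 s) (ptr s).+1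
        (if (dom s == 0) && (maxo (fun o => if (out2 o.2 == 2) && (key o.2 == key s) then dom o.2 else 0) oth == 0)
         then (ptr s).+1 else dom s) true (rty s) 0 (en2 s) (fin2 s), None)
    else (s, None)
  else (s, None).

(** * The effect of one slot of the election *)

Section Slot.
Variables (V : finType) (adj : rel V) (port : V -> nat -> V).
Hypothesis adjS : symmetric adj.
Hypothesis adjI : irreflexive adj.
Hypothesis portP : port_labeling adj port.
Notation deg := (deg adj).
Notation rport := (rport adj port).
Notation N := #|V|.
Variable id : 'I_N -> nat.
Notation conf := ('I_N -> cell V st2).
Notation rstep := (rstep adj port id).
Notation H x a := (hm (cs (x a))).
Notation K x a := (key (cs (x a))).
Notation L x a := (cl (x a)).

Variables (slow : bool) (bit : nat -> bool).

Definition tgt2 (y : conf) a :=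
  port (L y a) (if ptr (cs (y a)) < deg (L y a) then ptr (cs (y a)) else (pr2 (cs (y a))).-1).
Definition goer (y : conf) a := elig slow bit (id a) (cs (y a)) &&
  ((ptr (cs (y a)) < deg (L y a)) || (pr2 (cs (y a)) != 0)).
Definition finisher (y : conf) a := elig slow bit (id a) (cs (y a)) &&
  ((deg (L y a) <= ptr (cs (y a))) && (pr2 (cs (y a)) == 0)).

(** [w_uniq] allows one token per key, so visitors with a given key are unique and the maxima over
    visitors read off a single agent. *)
Record wf2 (y : conf) : Prop := Wf2 {
  w_out : forall a, out2 (cs (y a)) = 0;
  w_inj : forall a b, H y a -> H y b -> L y a = L y b -> a = b;
  w_par : forall a p, H y a -> pr2 (cs (y a)) = p.+1 -> p < deg (L y a);
  w_uniq : forall a b, H y a -> H y b -> tok (cs (y a)) -> tok (cs (y b)) -> K y a = K y b -> a = b;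
  w_key : forall a, H y a -> 0 < K y a
}.

(** A goer fails exactly when no home stays at its target, for instance when two goers exchange
    nodes. *)
Record slot_spec (y y' : conf) : Prop := SlotSpec {
  s_L : forall a, L y' a = L y a;
  s_H : forall a, H y' a = H y a;
  s_out : forall a, out2 (cs (y' a)) = 0;
  s_goer : forall a, goer y a ->
    [/\ K y' a = K y a, pr2 (cs (y' a)) = pr2 (cs (y a)) & fin2 (cs (y' a)) = fin2 (cs (y a))];
  s_absent : forall a, goer y a -> (forall b, H y b -> L y b = tgt2 y a -> goer y b) ->
    [/\ tok (cs (y' a)), rty (cs (y' a)), ptr (cs (y' a)) = ptr (cs (y a)) & dom (cs (y' a)) = dom (cs (y a))];
  s_present : forall a b, goer y a -> H y b -> L y b = tgt2 y a -> ~~ goer y b ->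
    if (ptr (cs (y a)) < deg (L y a)) && (K y a == K y b) then
      [/\ tok (cs (y' a)), ~~ rty (cs (y' a)), ptr (cs (y' a)) = (ptr (cs (y a))).+1 &
        dom (cs (y' a)) = if [&& dom (cs (y a)) == 0, ptr (cs (y b)) == deg (L y b) & dom (cs (y b)) == 0]
          then (ptr (cs (y a))).+1 else dom (cs (y a))]
    else [/\ ~~ tok (cs (y' a)), ~~ rty (cs (y' a)), ptr (cs (y' a)) = ptr (cs (y a)) & dom (cs (y' a)) = dom (cs (y a))];
  s_home : forall b, H y b -> ~~ goer y b ->
   [\/ exists v, [/\ goer y v, tgt2 y v = L y b, K y b < K y v,
        (forall v', goer y v' -> tgt2 y v' = L y b -> K y v' <= K y v) &
        cs (y' b) = S2 true (K y v) (rport (L y b) (L y v)).+1 0 0 true false 0 (en2 (cs (y' b))) false],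
     (forall v, goer y v -> tgt2 y v = L y b -> K y v <= K y b) /\
      exists v, [/\ goer y v, tgt2 y v = L y b, K y v = K y b, deg (L y v) <= ptr (cs (y v)) &
        cs (y' b) = let s := cs (y b) in S2 true (key s) (pr2 s) (ptr s).+1
         (if (dom s == 0) && (dom (cs (y v)) == 0) then (ptr s).+1 else dom s) true (rty s) 0 (en2 (cs (y' b)))
         (fin2 s || finisher y b)] |
     [/\ (forall v, goer y v -> tgt2 y v = L y b -> K y v <= K y b),
       (forall v, goer y v -> tgt2 y v = L y b -> K y v = K y b -> ptr (cs (y v)) < deg (L y v)) &
       cs (y' b) = let s := cs (y b) in S2 true (key s) (pr2 s) (ptr s) (dom s)
         (tok s && ~~ finisher y b) (rty s) 0 (en2 (cs (y' b))) (fin2 s || finisher y b)]]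
}.

Section OneSlot.
Variable y : conf.
Hypothesis W : wf2 y.

Let y1 := rstep (tr2_go slow bit) y.
Let y2 := rstep tr2_rec y1.
Let y3 := rstep tr2_res y2.
Let g := goer y.
Let oc a := if ptr (cs (y a)) < deg (L y a) then 1 else 2.

Lemma goer_H a : g a -> H y a. Proof. by case/andP=> /andP[]. Qed.

Lemma goer_port a : g a ->
  (if ptr (cs (y a)) < deg (L y a) then ptr (cs (y a)) else (pr2 (cs (y a))).-1) < deg (L y a).
Proof.
move=> Ga; have Ha := goer_H Ga; case: (ltnP (ptr _) _) => // le.
case/andP: Ga => _; rewrite ltnNge le /=.
by case E: (pr2 _) => [//|q] _; apply: (w_par W Ha E).
Qed.

Lemma go_recE a : y2 a = if g a then
    Cell (tgt2 y a) (Some (rport (tgt2 y a) (L y a)))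
      (let s := cs (y a) in S2 (hm s) (key s) (pr2 s) (ptr s) (dom s) (tok s) (rty s) (oc a) (rport (tgt2 y a) (L y a)) (fin2 s))
  else Cell (L y a) (ce (y a)) (let s := cs (y a) in S2 (hm s) (key s) (pr2 s) (ptr s) (dom s)
     (tok s && ~~ finisher y a) (rty s) 0 (odflt 0 (ce (y a))) (fin2 s || finisher y a)).
Proof.
have -> : y2 a = Cell (L y1 a) (ce (y1 a)) (let s := cs (y1 a) in
  S2 (hm s) (key s) (pr2 s) (ptr s) (dom s) (tok s) (rty s) (out2 s) (odflt 0 (ce (y1 a))) (fin2 s)).
  by rewrite /y2 rstepE.
have Wo := w_out W a; have gp := @goer_port a.
rewrite /y1 rstepE /tr2_go /g /goer /finisher.
case El: (elig _ _ _ _) => /=; last first.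
  by rewrite Wo andbT orbF.
rewrite /g /goer El /= in gp; rewrite /oc /tgt2; case: ltnP gp => [lt _|le] /=.
  by rewrite lt.
case Ep: (pr2 _) => [|p] /=; first by rewrite Wo andbF orbT.
by move=> /(_ isT) -> /=; rewrite Ep.
Qed.

Lemma inhE b : inhome (cs (y2 b)) = H y b && ~~ g b.
Proof.
rewrite /inhome go_recE; case: (g b) => /=; last by rewrite andbT.
by rewrite /oc; case: ifP; rewrite !andbF.
Qed.

Let L2 a : L y2 a = if g a then tgt2 y a else L y a.
Proof. by rewrite go_recE; case: ifP. Qed.
Let K2 a : K y2 a = K y a.
Proof. by rewrite go_recE; case: ifP. Qed.
Let out_g a : (out2 (cs (y2 a)) != 0) = g a.
Proof. by rewrite go_recE /oc; case: ifP => //= _; case: ifP. Qed.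

Lemma hk_view f a b : g a -> H y b -> L y b = tgt2 y a -> ~~ g b ->
  maxo (fun o => if inhome o.2 then f o.2 else 0) (view id y2 a) = f (cs (y2 b)).
Proof.
move=> Ga Hb Lb Gb; apply: (@maxo_view_eq _ _ id _ _ y2 a b).
- by apply: contraTneq Ga => <-.
- by rewrite !L2 Ga (negbTE Gb).
- by rewrite /= inhE Hb Gb.
move=> c ca Lc /=; rewrite inhE; case: ifP => // /andP[Hc Gc].
have -> // : c = b; apply: (w_inj W) => //.
by move: Lc; rewrite !L2 Ga (negbTE Gc) => ->.
Qed.

Lemma has_home a : g a -> has (fun o => inhome o.2) (view id y2 a) = [exists b, [&& H y b, L y b == tgt2 y a & ~~ g b]].
Proof.
move=> Ga; rewrite has_view; apply/existsP/existsP => -[b].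
  case/and3P=> ba; rewrite !L2 Ga /= inhE => Lb /andP[Hb Gb].
  by exists b; move: Lb; rewrite (negbTE Gb) Hb => ->.
case/and3P=> Hb Lb Gb; exists b; rewrite !L2 Ga (negbTE Gb) Lb /= inhE Hb Gb !andbT.
by apply: contraTneq Ga => <-.
Qed.

Local Arguments moveto : simpl never.

Lemma y3_goer a : g a -> let s := cs (y a) in exists en c, y3 a = Cell (L y a) c
  (if ~~ [exists b, [&& H y b, L y b == tgt2 y a & ~~ g b]] then
    S2 (hm s) (key s) (pr2 s) (ptr s) (dom s) (tok s) true 0 en (fin2 s)
   else if (ptr s < deg (L y a)) && (key s == maxo (fun o => if inhome o.2 then key o.2 else 0) (view id y2 a)) then
     S2 (hm s) (key s) (pr2 s) (ptr s).+1 (if [&& dom s == 0,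
        maxo (fun o => if inhome o.2 then ptr o.2 else 0) (view id y2 a) == deg (tgt2 y a) &
        maxo (fun o => if inhome o.2 then dom o.2 else 0) (view id y2 a) == 0] then (ptr s).+1 else dom s)
        (tok s) false 0 en (fin2 s)
   else S2 (hm s) (key s) (pr2 s) (ptr s) (dom s) false false 0 en (fin2 s)).
Proof.
move=> Ga s; exists (rport (tgt2 y a) (L y a)).
have pd := goer_port Ga; have [lt pE] := rport_back adjS portP pd.
exists (Some (rport (L y a) (tgt2 y a))).
rewrite /y3 rstepE /tr2_res out_g Ga has_home //.
have mv s' : moveto adj port (L y2 a) (ce (y2 a)) s' (Some (en2 (cs (y2 a)))) = Cell (L y a) (Some (rport (L y a) (tgt2 y a))) s'.
  by rewrite go_recE Ga /= /moveto; rewrite -/(tgt2 y a) in lt pE; rewrite lt pE.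
case: (~~ _) => /=; first by rewrite mv go_recE Ga.
have -> : (out2 (cs (y2 a)) == 1) = (ptr s < deg (L y a)).
  by rewrite go_recE Ga /= /oc -/s; case: ifP.
rewrite K2; case: ifP => _ /=; rewrite mv; last by rewrite go_recE Ga.
by rewrite L2 Ga; move: (maxo _ _) (maxo _ _) => ? ?; rewrite go_recE Ga.
Qed.

Lemma vk_view b : H y b -> ~~ g b ->
  maxo (fun o => if out2 o.2 != 0 then key o.2 else 0) (view id y2 b) =
  \max_(v | g v && (tgt2 y v == L y b)) K y v.
Proof.
move=> Hb Gb; rewrite maxo_view /=.
rewrite (eq_bigr (fun v => if g v then K y v else 0)); last by move=> v _; rewrite out_g K2.
rewrite -big_mkcondr; apply: eq_bigl => v; rewrite !L2 (negbTE Gb).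
case Gv: (g v); rewrite ?andbF // andbT.
by case: (eqVneq v b) => [E|//]; rewrite E (negbTE Gb) in Gv.
Qed.

Lemma visitor_uniq v v' : g v -> g v' -> K y v = K y v' -> v = v'.
Proof.
move=> Gv Gv'; apply: (w_uniq W); rewrite ?goer_H //; [move: Gv|move: Gv'].
  by case/andP => /and3P[].
by case/andP => /and3P[].
Qed.

Lemma slotP : slot_spec y y3.
Proof.
have ned v b : ~~ g b -> g v -> v != b by move=> Gb Gv; apply: contraTneq Gv => ->.
have gtok v : g v -> tok (cs (y v)) by case/andP => /and3P[].
have y3_non a : ~~ H y a -> y3 a = y2 a.
  move=> Ha; have Ga : ~~ g a by apply: contra Ha; apply: goer_H.
  rewrite /y3 rstepE /tr2_res out_g (negbTE Ga) (_ : H y2 a = false) /=.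
    by case: (y2 a).
  by rewrite go_recE (negbTE Ga); apply/negbTE.
have home b : H y b -> ~~ g b -> L y3 b = L y b /\
   [\/ exists v, [/\ goer y v, tgt2 y v = L y b, K y b < K y v,
        (forall v', goer y v' -> tgt2 y v' = L y b -> K y v' <= K y v) &
        cs (y3 b) = S2 true (K y v) (rport (L y b) (L y v)).+1 0 0 true false 0 (en2 (cs (y3 b))) false],
     (forall v, goer y v -> tgt2 y v = L y b -> K y v <= K y b) /\
      exists v, [/\ goer y v, tgt2 y v = L y b, K y v = K y b, deg (L y v) <= ptr (cs (y v)) &
        cs (y3 b) = let s := cs (y b) in S2 true (key s) (pr2 s) (ptr s).+1
         (if (dom s == 0) && (dom (cs (y v)) == 0) then (ptr s).+1 else dom s) true (rty s) 0 (en2 (cs (y3 b)))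
         (fin2 s || finisher y b)] |
     [/\ (forall v, goer y v -> tgt2 y v = L y b -> K y v <= K y b),
       (forall v, goer y v -> tgt2 y v = L y b -> K y v = K y b -> ptr (cs (y v)) < deg (L y v)) &
       cs (y3 b) = let s := cs (y b) in S2 true (key s) (pr2 s) (ptr s) (dom s)
         (tok s && ~~ finisher y b) (rty s) 0 (en2 (cs (y3 b))) (fin2 s || finisher y b)]].
  move=> Hb Gb.
  have E2 : cs (y2 b) = let s := cs (y b) in S2 true (key s) (pr2 s) (ptr s) (dom s)
     (tok s && ~~ finisher y b) (rty s) 0 (odflt 0 (ce (y b))) (fin2 s || finisher y b).
    by rewrite go_recE (negbTE Gb) /= Hb.
  rewrite /y3 rstepE /tr2_res out_g (negbTE Gb) E2 /= vk_view // L2 (negbTE Gb).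
  case: ifP => [lt|/negbT ge] /=.
    split=> //; constructor 1.
    case: (pickP [pred v | g v && (tgt2 y v == L y b)]) => [v0 Hv0|none]; last first.
      by move: lt; rewrite big_pred0.
    move: lt; rewrite (bigmax_eq_arg v0) //; case: arg_maxnP => // v /andP[Gv /eqP Lv] mx lt.
    exists v; split=> //; first by move=> v' Gv' Lv'; apply: mx; rewrite Lv' eqxx andbT.
    congr (S2 _ _ _.+1 _ _ _ _ _ _ _).
    apply: (@maxo_view_eq _ _ id _ _ y2 b v) => /=; first exact: ned.
    - by rewrite !L2 Gv (negbTE Gb).
    - by rewrite out_g Gv K2 eqxx /= go_recE Gv /= Lv.
    move=> c cb Lc; rewrite out_g K2; case: ifP => // /andP[Gc /eqP Kc].
    by rewrite (visitor_uniq Gc Gv Kc) go_recE Gv /= Lv.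
  have le v : goer y v -> tgt2 y v = L y b -> K y v <= K y b.
    move=> Gv Lv; move: ge; rewrite -leqNgt; apply: leq_trans.
    by apply: (@leq_bigmax_cond _ _ (fun v => K y v)); rewrite Lv eqxx andbT.
  have out_2 v : g v -> (out2 (cs (y2 v)) == 2) = (deg (L y v) <= ptr (cs (y v))).
    by move=> Gv; rewrite go_recE Gv /= /oc; case: ltnP.
  case: ifP => [hs|/negbT nh] /=; split=> //.
    move: hs; rewrite has_view => /existsP[v /and3P[vb /eqP Lv /andP[ov /eqP Kv]]].
    have Gv : g v by rewrite -out_g (eqP ov).
    rewrite !L2 Gv (negbTE Gb) in Lv; rewrite /= K2 in Kv.
    constructor 2; split=> //; exists v; split=> //; first by rewrite -out_2.
    congr (S2 _ _ _ _ _ _ _ _ _ _); congr (if _ && (_ == _) then _ else _).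
    have dv : dom (cs (y2 v)) = dom (cs (y v)) by rewrite go_recE Gv.
    apply: (@maxo_view_eq _ _ id _ _ y2 b v) => //=.
    - by rewrite !L2 Gv (negbTE Gb).
    - by rewrite K2 ov Kv eqxx.
    move=> c cb Lc; case: ifP => // /andP[oc_ /eqP Kc].
    have Gc : g c by rewrite -out_g (eqP oc_).
    by rewrite K2 in Kc; rewrite (visitor_uniq Gc Gv) ?dv // Kc.
  constructor 3; split=> // v Gv Lv Kv; rewrite ltnNge -out_2 //.
  apply: contra nh => ov; rewrite has_view; apply/existsP; exists v.
  by rewrite !L2 [g v]Gv (negbTE Gb) Lv eqxx /= ov K2 Kv eqxx (ned v b).
have gcase a : g a -> L y3 a = L y a /\ [/\ H y3 a = H y a, out2 (cs (y3 a)) = 0, K y3 a = K y a, pr2 (cs (y3 a)) = pr2 (cs (y a)) & fin2 (cs (y3 a)) = fin2 (cs (y a))].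
  by move=> Ga; have [en [c ->]] := y3_goer Ga => /=; split=> //; do 2 (case: ifP => _ //=).
split.
- move=> a; case Ga: (g a); first by case: (gcase a Ga).
  case Ha: (H y a); first by case: (home a Ha (negbT Ga)).
  by rewrite y3_non ?Ha // L2 Ga.
- move=> a; case Ga: (g a); first by case: (gcase a Ga) => _ [].
  case Ha: (H y a); last by rewrite y3_non ?Ha // go_recE Ga.
  case: (home a Ha (negbT Ga)) => _ [[v [_ _ _ _ ->]]|[_ [v [_ _ _ _ ->]]]|[_ _ ->]] //.
- move=> a; case Ga: (g a); first by case: (gcase a Ga) => _ [].
  case Ha: (H y a); last by rewrite y3_non ?Ha // go_recE Ga.
  case: (home a Ha (negbT Ga)) => _ [[v [_ _ _ _ ->]]|[_ [v [_ _ _ _ ->]]]|[_ _ ->]] //.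
- by move=> a /gcase [_ []].
- move=> a Ga ab; have [en [c ->]] := y3_goer Ga.
  have -> : [exists b, [&& H y b, L y b == tgt2 y a & ~~ g b]] = false.
    by apply/existsP => -[b /and3P[Hb /eqP Lb]]; rewrite [g b]ab.
  by rewrite /= gtok.
- move=> a b Ga Hb Lb Gb; have [en [c ->]] := y3_goer Ga.
  have -> : [exists b, [&& H y b, L y b == tgt2 y a & ~~ g b]].
    by apply/existsP; exists b; rewrite Hb Lb eqxx.
  rewrite !(hk_view _ Ga Hb Lb Gb) K2 -Lb.
  have -> : ptr (cs (y2 b)) = ptr (cs (y b)) by rewrite go_recE [g b](negbTE Gb).
  have -> : dom (cs (y2 b)) = dom (cs (y b)) by rewrite go_recE [g b](negbTE Gb).
  rewrite /=; case C: (_ && (_ == K y b)); first by rewrite gtok.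
  by [].
- by move=> b Hb Gb; case: (home b Hb Gb).
Qed.
End OneSlot.
End Slot.

(** * Simulation of the sequential traversal by the tokens *)

Section Inv2.
Variables (V : finType) (adj : rel V) (port : V -> nat -> V).
Hypothesis adjS : symmetric adj.
Hypothesis adjI : irreflexive adj.
Hypothesis portP : port_labeling adj port.
Notation deg := (deg adj).
Notation rport := (rport adj port).
Notation N := #|V|.
Variable id : 'I_N -> nat.
Notation conf := ('I_N -> cell V st2).
Notation H x a := (hm (cs (x a))).
Notation K x a := (key (cs (x a))).
Notation L x a := (cl (x a)).
Notation dfsn := (dfsn adj port).
Notation dstep := (dstep adj port).
Notation dinv := (dinv adj port).
Notation dfin := (dfin adj).
Notation wf2 := (wf2 adj).
Notation tgt2 := (tgt2 adj port).

(* The value [pr2] prescribed by the stack. *)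
Fixpoint parof (s : seq V) v :=
  if s is x :: s' then
    if x == v then (if s' is y :: _ then (rport x y).+1 else 0) else parof s' v
  else 0.

(** Visited homes may have been lost to larger keys, so [m_vis] bounds keys only from below, and
    pointers are compared on the homes still owned. The bound on [2 * id b] survives such losses and
    later shows that no home started a larger key. *)
Record kmatch (y : conf) (k : nat) (D : ds V) : Prop := KMatch {
  m_vis : forall u, u \in vs D -> exists b, [/\ H y b, L y b = u, k <= K y b & 2 * id b <= k];
  m_key : forall b, H y b -> K y b = k ->
    [/\ L y b \in vs D, ptr (cs (y b)) = pt D (L y b), dom (cs (y b)) = dm D (L y b) &
        L y b \in stk D -> pr2 (cs (y b)) = parof (stk D) (L y b)]
}.

Variable Pk : nat -> Prop.

(** [sl] counts slots and bounds the steps of each simulated traversal. [Pk] is a side condition on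
    keys, [Pk0] before the switch and trivial after it. *)
Record inv2 (y : conf) (sl : nat) : Prop := Inv2 {
  i_wf : wf2 y;
  i_key : forall a, H y a -> 2 * id a <= K y a /\ Pk (K y a);
  i_tok : forall a, H y a -> tok (cs (y a)) -> exists r k,
    [/\ H y r, id r = (K y a)./2, k <= sl, kmatch y (K y a) (dfsn (L y r) k) &
        ohead (stk (dfsn (L y r) k)) = Some (L y a)];
  i_fin : forall a, H y a -> fin2 (cs (y a)) ->
    [/\ id a = (K y a)./2, (forall b, H y b -> tok (cs (y b)) -> K y b <> K y a) &
        exists k, [/\ k <= sl, dfin (dfsn (L y a) k) & kmatch y (K y a) (dfsn (L y a) k)]];
  i_rty : forall a, H y a -> rty (cs (y a)) -> tok (cs (y a)) || fin2 (cs (y a))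
}.

Section Step.
Variables (slow : bool) (bit : nat -> bool) (y y' : conf).
Notation goer := (goer adj id slow bit).
Notation finisher := (finisher adj id slow bit).
Hypothesis W : wf2 y.
Hypothesis S : slot_spec adj port id slow bit y y'.

Inductive hchange c : Prop :=
| Hsame of K y' c = K y c & pr2 (cs (y' c)) = pr2 (cs (y c)) & ptr (cs (y' c)) = ptr (cs (y c)) &
   dom (cs (y' c)) = dom (cs (y c)) &
   (tok (cs (y' c)) -> [/\ tok (cs (y c)), ~~ finisher y c & goer y c ->
       forall b, H y b -> L y b = tgt2 y c -> goer y b]) &
   (fin2 (cs (y' c)) = fin2 (cs (y c)) || finisher y c) &
   (rty (cs (y' c)) -> tok (cs (y' c)) || rty (cs (y c)) && (tok (cs (y c)) ==> finisher y c))
| Hcap v of goer y v & tgt2 y v = L y c & K y c < K y v & ~~ goer y c &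
   cs (y' c) = S2 true (K y v) (rport (L y c) (L y v)).+1 0 0 true false 0 (en2 (cs (y' c))) false
| Hvis b of goer y c & H y b & L y b = tgt2 y c & ~~ goer y b & ptr (cs (y c)) < deg (L y c) &
   K y b = K y c & K y' c = K y c & pr2 (cs (y' c)) = pr2 (cs (y c)) &
   ptr (cs (y' c)) = (ptr (cs (y c))).+1 &
   dom (cs (y' c)) = (if [&& dom (cs (y c)) == 0, ptr (cs (y b)) == deg (L y b) & dom (cs (y b)) == 0]
          then (ptr (cs (y c))).+1 else dom (cs (y c))) &
   tok (cs (y' c)) & rty (cs (y' c)) = false & fin2 (cs (y' c)) = fin2 (cs (y c))
| Hres v of goer y v & ~~ goer y c & tgt2 y v = L y c & K y v = K y c & deg (L y v) <= ptr (cs (y v)) &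
   cs (y' c) = let s := cs (y c) in S2 true (key s) (pr2 s) (ptr s).+1
         (if (dom s == 0) && (dom (cs (y v)) == 0) then (ptr s).+1 else dom s) true (rty s) 0 (en2 (cs (y' c)))
         (fin2 s || finisher y c).

Lemma goer_tok a : goer y a -> tok (cs (y a)).
Proof. by case/andP => /and3P[]. Qed.

Lemma goer_nfin a : goer y a -> ~~ finisher y a.
Proof.
case/andP=> El; rewrite /finisher El /=; by case: ltnP.

Qed.

Lemma hchangeP c : H y c -> hchange c.
Proof.
move=> Hc; case: (boolP (goer y c)) => [Gc|Gc].
  have [Kc pc fc] := s_goer S Gc; have nf := goer_nfin Gc.
  case: (pickP [pred b | [&& H y b, L y b == tgt2 y c & ~~ goer y b]]) => [b /and3P[Hb /eqP Lb Gb]|none].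
    have := s_present S Gc Hb Lb Gb; case: ifP => [/andP[lt /eqP E]|_] [t r p d].
      by apply: (Hvis (b := b)) => //; apply/negbTE.
    apply: Hsame => //; first by rewrite (negbTE t).
      by rewrite fc (negbTE nf) orbF.
    by rewrite (negbTE r).
  have ab b : H y b -> L y b = tgt2 y c -> goer y b.
    by move=> Hb Lb; have := none b; rewrite /= Hb Lb eqxx /= => /negbFE.
  have [t r p d] := s_absent S Gc ab.
  apply: Hsame => //; first by rewrite goer_tok.
    by rewrite fc (negbTE nf) orbF.
  by rewrite t.
case: (s_home S Hc Gc) => [[v [Gv Lv lt _ E]]|[_ [v [Gv Lv Kv dv E]]]|[_ _ E]].
- exact: (Hcap Gv).
- exact: (Hres Gv).
apply: Hsame; rewrite E //=.
  by move=> /andP[t nf]; split=> //; rewrite (negbTE Gc).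
by move=> r; rewrite r; case: (tok _) (finisher _ _) => [] [].
Qed.

Lemma key_mono c : H y c -> K y c <= K y' c.
Proof.
move=> Hc; case: (hchangeP Hc) => [-> //|v _ _ lt _ ->|b *|v _ _ _ _ _ -> //].
  exact: ltnW.
by lia.
Qed.

Lemma goer_uniq v a : goer y v -> tok (cs (y a)) -> H y a -> K y v = K y a -> v = a.
Proof. by move=> Gv t Ha; apply: (w_uniq W) => //; [apply: goer_H Gv|apply: goer_tok]. Qed.

Lemma tgt_adj a : goer y a -> adj (L y a) (tgt2 y a).
Proof. by move=> Ga; apply: (port_adj portP); apply: (goer_port W Ga). Qed.

Lemma key_change a c : H y a -> tok (cs (y a)) -> H y c -> K y' c = K y a ->
  K y c = K y a \/ [/\ goer y a, tgt2 y a = L y c, K y c < K y a, ~~ goer y c &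
   cs (y' c) = S2 true (K y a) (rport (L y c) (L y a)).+1 0 0 true false 0 (en2 (cs (y' c))) false].
Proof.
move=> Ha ta Hc; case: (hchangeP Hc) => [-> //|v Gv Lv lt Gc E|b _ _ _ _ _ _ -> //|v _ _ _ _ _ -> //]; try by left.
rewrite E /= => Kv; right.
have va := goer_uniq Gv ta Ha Kv; by move: Gv Lv lt E; rewrite va.
Qed.

Lemma vis_mono u k D : (u \in vs D -> exists b, [/\ H y b, L y b = u, k <= K y b & 2 * id b <= k]) ->
  u \in vs D -> exists b, [/\ H y' b, L y' b = u, k <= K y' b & 2 * id b <= k].
Proof.
move=> h /h [b [Hb Lb Kb ib]]; exists b; rewrite (s_H S) (s_L S); split=> //.
by apply: leq_trans Kb _; apply: key_mono.
Qed.

Section Token.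
Variables (r : V) (k : nat) (a : 'I_N) (s : seq V).
Let D := dfsn r k.
Hypothesis Ha : H y a.
Hypothesis ta : tok (cs (y a)).
Hypothesis M : kmatch y (K y a) D.
Hypothesis stkD : stk D = L y a :: s.
Let I : dinv r k D := dfs_inv adjS adjI portP r k.

Let aD : [/\ L y a \in vs D, ptr (cs (y a)) = pt D (L y a), dom (cs (y a)) = dm D (L y a) &
        pr2 (cs (y a)) = parof (stk D) (L y a)].
Proof. by have [h1 h2 h3 h4] := m_key M Ha erefl; split=> //; apply: h4; rewrite stkD mem_head. Qed.

Let home_key b u : H y b -> L y b = u -> u \in vs D -> K y a <= K y b /\ 2 * id b <= K y a.
Proof.
move=> Hb Lb /(m_vis M) [c [Hc Lc Kc ic]].
by have <- : c = b by apply: (w_inj W) => //; rewrite Lc.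
Qed.

Lemma ret_spec : goer y a -> deg (L y a) <= ptr (cs (y a)) ->
  exists2 s', s = tgt2 y a :: s' & tgt2 y a \in vs D.
Proof.
move=> Ga le; have [_ _ _ pE] := aD.
have p0 : pr2 (cs (y a)) != 0 by case/andP: Ga => _; rewrite ltnNge le.
rewrite stkD /= eqxx in pE; case: s pE stkD => [E|x s' pE sE]; first by rewrite E in p0.
have [E1 E2 _] : chain adj port D (L y a) (x :: s') by have := d_chain I; rewrite sE.
have tE : tgt2 y a = x.
  rewrite /tgt2 ltnNge le /= pE /=; apply: (proj2 (rportP portP _)).
  by rewrite adjS -E1; apply: (port_adj portP).
by exists s'; rewrite tE //; apply: (d_sub I); rewrite sE !inE eqxx orbT.
Qed.

Lemma finisher_spec : finisher y a -> dfin D /\ L y a = r.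
Proof.
case/andP=> _ /andP[le /eqP p0]; have [_ pE _ prE] := aD.
rewrite p0 stkD /= eqxx in prE; case: s prE stkD => [_ sE|//].
split; last by have := d_last I; rewrite sE /= => ->.
by rewrite /dfin sE eqn_leq (d_le I) -pE.
Qed.

Lemma kmatch_same : (goer y a -> forall b, H y b -> L y b = tgt2 y a -> goer y b) ->
  kmatch y' (K y a) D.
Proof.
move=> ab; split; first by move=> u; apply: vis_mono; apply: (m_vis M).
move=> b; rewrite (s_H S) (s_L S) => Hb K'b; case: (key_change Ha ta Hb K'b) => [Kb|[Ga Lb _ Gb _]]; last first.
  by rewrite (ab Ga b) in Gb.
have [h1 h2 h3 h4] := m_key M Hb Kb.
case: (hchangeP Hb) => [_ -> -> -> //|v _ _ lt _ E|c Gb Hc Lc Gc _ _ _ _ _ _ _ _ _|v Gv Gb Lv Kv _ _].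
- by move: K'b lt; rewrite E /= Kb => ->; rewrite ltnn.
- have ba := goer_uniq Gb ta Ha Kb.
  by rewrite ba in Gb Lc; rewrite (ab Gb c) in Gc.
have va : v = a by apply: goer_uniq => //; rewrite Kv.
by rewrite va in Gv Lv; rewrite (ab Gv b) in Gb.
Qed.

Lemma vs_step u : u \in vs D -> u \in vs (dstep D).
Proof.
rewrite /dstep; case: (stk D) => [//|x t] uv.
case: ifP => _; last by case: t.
by case: ifP => //= _; rewrite inE uv orbT.
Qed.

Lemma kmatch_vis c : goer y a -> H y c -> L y c = tgt2 y a -> ptr (cs (y a)) < deg (L y a) ->
  K y c = K y a -> H y' a -> K y' a = K y a -> pr2 (cs (y' a)) = pr2 (cs (y a)) ->
   ptr (cs (y' a)) = (ptr (cs (y a))).+1 ->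
   dom (cs (y' a)) = (if [&& dom (cs (y a)) == 0, ptr (cs (y c)) == deg (L y c) & dom (cs (y c)) == 0]
          then (ptr (cs (y a))).+1 else dom (cs (y a))) ->
  ~~ goer y c -> kmatch y' (K y a) (dstep D) /\ ohead (stk (dstep D)) = Some (L y' a).
Proof.
move=> Ga Hc Lc lt Kc _ K'a p'a t'a d'a Gc.
have [xv pE dE prE] := aD.
have [cv cp cd _] := m_key M Hc Kc.
have wE : port (L y a) (pt D (L y a)) = L y c by rewrite Lc /tgt2 lt pE.
have -> : dstep D = DS (stk D) (upd (pt D) (L y a) (pt D (L y a)).+1)
          (upd (dm D) (L y a) (dom (cs (y' a)))) (vs D).
  by rewrite /dstep {1}stkD -pE lt pE wE cv d'a dE cp cd pE.
split; last by rewrite /= stkD (s_L S).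
split=> [u|b]; first by apply: vis_mono; apply: (m_vis M).
rewrite (s_H S) (s_L S) => Hb K'b; case: (key_change Ha ta Hb K'b) => [Kb|[_ Lb Kb _ _]]; last first.
  have cb : c = b by apply: (w_inj W) => //; rewrite Lc.
  by move: Kb; rewrite -cb Kc ltnn.
case: (eqVneq b a) => [->|ba]; first by rewrite /= /upd eqxx t'a p'a pE; split.
have Lba : L y b != L y a by apply: contraNneq ba => E; apply/eqP/(w_inj W).
have [h1 h2 h3 h4] := m_key M Hb Kb.
rewrite /= /upd (negbTE Lba).
case: (hchangeP Hb) => [_ -> -> -> //|v _ _ lt' _ E|e Gb He Le Ge _ _ _ _ _ _ _ _ _|v Gv Gb Lv Kv dv _].
- by move: K'b lt'; rewrite E /= Kb => ->; rewrite ltnn.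
- by have /eqP := goer_uniq Gb ta Ha Kb; rewrite (negbTE ba).
have va : v = a by apply: goer_uniq => //; rewrite Kv.
by move: dv; rewrite va leqNgt lt.
Qed.

Lemma parof_cons u t v : v \in t -> u \notin t -> parof (u :: t) v = parof t v.
Proof. by move=> vt ut /=; case: eqP => // uv; rewrite uv vt in ut. Qed.

(** Visited nodes carry keys at least [K y a], so a home with a smaller key is new to [D]. For the
    same reason [a] was exploring: a return leads to a visited node. *)
Lemma kmatch_push c : 2 * id c <= K y c -> goer y a -> H y c -> L y c = tgt2 y a -> K y c < K y a -> ~~ goer y c ->
  K y' c = K y a ->
  [/\ ptr (cs (y a)) < deg (L y a), tgt2 y a \notin vs D, vs (dstep D) = tgt2 y a |: vs D,
   kmatch y' (K y a) (dstep D) & ohead (stk (dstep D)) = Some (L y' c)].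
Proof.
move=> ic Ga Hc Lc Kc Gc K'c; have [xv pE dE prE] := aD.
have nv : tgt2 y a \notin vs D.
  by apply/negP => /(home_key Hc Lc) [le _]; rewrite leqNgt Kc in le.
have lt : ptr (cs (y a)) < deg (L y a).
  by rewrite ltnNge; apply/negP => /(ret_spec Ga) [s' _]; apply/negP.
have wE : port (L y a) (pt D (L y a)) = tgt2 y a by rewrite /tgt2 lt pE.
have -> : dstep D = DS (tgt2 y a :: stk D) (pt D) (dm D) (tgt2 y a |: vs D).
  by rewrite /dstep stkD -pE lt pE wE (negbTE nv).
split=> //=; last by rewrite (s_L S) Lc.
have i_c : 2 * id c <= K y a by apply: leq_trans (ltnW Kc).
split=> [u|b].
  rewrite !inE => /orP[/eqP->|uv]; last by apply: vis_mono uv; apply: (m_vis M).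
  by exists c; rewrite (s_H S) (s_L S) K'c.
rewrite (s_H S) (s_L S) => Hb K'b; case: (key_change Ha ta Hb K'b) => [Kb|[_ Lb Kb _ E]]; last first.
  have [p0 d0] := d_out I nv.
  by rewrite /= Lb setU11 E /= eqxx -Lb p0 d0 stkD; split.
have [h1 h2 h3 h4] := m_key M Hb Kb.
have Lb : L y b != tgt2 y a by apply: contraNneq nv => <-.
have pb : L y b \in tgt2 y a :: stk D -> parof (tgt2 y a :: stk D) (L y b) = parof (stk D) (L y b).
  rewrite inE (negbTE Lb) /= => bs; apply: parof_cons => //.
  by apply: contra nv; apply: (d_sub I).
case: (hchangeP Hb) => [_ -> -> -> _ _ _|v _ _ lt' _ E|e Gb He Le Ge _ Ke _ _ _ _ _ _ _|v Gv Gb Lv Kv dv _].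
- split=> //; first by rewrite inE h1 orbT.
  by move=> bs; rewrite pb //; apply: h4; move: bs; rewrite inE (negbTE Lb).
- by move: K'b lt'; rewrite E /= Kb => ->; rewrite ltnn.
- have ba := goer_uniq Gb ta Ha Kb; rewrite ba in Le Ke.
  have ec : e = c by apply: (w_inj W) => //; rewrite Lc.
  by move: Kc; rewrite -ec Ke ltnn.
have va : v = a by apply: goer_uniq => //; rewrite Kv.
by move: dv; rewrite va leqNgt lt.
Qed.

Lemma kmatch_pop c : goer y a -> ~~ goer y c -> tgt2 y a = L y c -> K y a = K y c ->
  deg (L y a) <= ptr (cs (y a)) -> H y c -> K y' c = K y a ->
  cs (y' c) = (let s := cs (y c) in S2 true (key s) (pr2 s) (ptr s).+1
         (if (dom s == 0) && (dom (cs (y a)) == 0) then (ptr s).+1 else dom s) true (rty s) 0 (en2 (cs (y' c)))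
         (fin2 s || finisher y c)) ->
  kmatch y' (K y a) (dstep D) /\ ohead (stk (dstep D)) = Some (L y' c).
Proof.
move=> Ga Gc Lc Kc le Hc K'c Ec; have [xv pE dE prE] := aD.
have [s' sE _] := ret_spec Ga le; rewrite Lc in sE.
have [cv cp cd cr] := m_key M Hc (esym Kc).
have un : uniq (stk D) := d_uniq I.
have -> : dstep D = DS s (upd (pt D) (L y c) (pt D (L y c)).+1)
          (upd (dm D) (L y c) (dom (cs (y' c)))) (vs D).
  rewrite /dstep stkD -pE ltnNge le /= {1 2}sE Ec /= cd dE cp; congr (DS _ _ _ _).
  by rewrite sE.
split; last by rewrite /= sE (s_L S).
split=> [u|b]; first by apply: vis_mono; apply: (m_vis M).
have sub v : v \in s -> parof (stk D) v = parof s v.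
  by move: un; rewrite stkD /= => /andP[ns _] vs_; apply: parof_cons.
rewrite (s_H S) (s_L S) => Hb K'b; case: (key_change Ha ta Hb K'b) => [Kb|[_ Lb Kb _ _]]; last first.
  have cb : c = b by apply: (w_inj W) => //; rewrite -Lc.
  by move: Kb; rewrite -cb Kc ltnn.
case: (eqVneq b c) => [->|bc].
  have -> : ptr (cs (y' c)) = (ptr (cs (y c))).+1 by rewrite Ec.
  have -> : pr2 (cs (y' c)) = pr2 (cs (y c)) by rewrite Ec.
  rewrite /= /upd eqxx -cp; split=> // cs_; rewrite -sub //; apply: cr.
  by rewrite stkD inE cs_ orbT.
have Lbc : L y b != L y c by apply: contraNneq bc => E; apply/eqP/(w_inj W).
have [h1 h2 h3 h4] := m_key M Hb Kb.
rewrite /= /upd (negbTE Lbc).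
case: (hchangeP Hb) => [_ -> -> -> _ _ _|v _ _ lt' _ E|e Gb He Le Ge lt' _ _ _ _ _ _ _ _|v Gv Gb Lv Kv dv _].
- split=> // bs; rewrite -sub //; apply: h4; by rewrite stkD inE bs orbT.
- by move: K'b lt'; rewrite E /= Kb => ->; rewrite ltnn.
- have ba := goer_uniq Gb ta Ha Kb.
  by move: lt'; rewrite ba ltnNge le.
have va : v = a by apply: goer_uniq => //; rewrite Kv.
have cb : c = b by apply: (w_inj W) => //; rewrite -Lv va.
by rewrite cb eqxx in bc.
Qed.
End Token.

(** A traversal without token is inert and can only lose homes to larger keys, which [kmatch]
    tolerates. *)
Lemma kmatch_keep k D : (forall a, H y a -> tok (cs (y a)) -> K y a <> k) -> kmatch y k D -> kmatch y' k D.
Proof.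
move=> nt M; split; first by move=> u; apply: vis_mono; apply: (m_vis M).
have ng v : goer y v -> K y v <> k by move=> Gv; apply: nt; [apply: goer_H Gv|apply: goer_tok].
move=> b; rewrite (s_H S) (s_L S) => Hb.
case: (hchangeP Hb) => [-> -> -> -> _ _ _|v Gv _ _ _ ->|e Gb _ _ _ _ _ -> _ _ _ _ _ _|v Gv _ _ Kv _ ->] /= E.
- exact: (m_key M).
- by have := ng v Gv.
- by have := ng b Gb.
by have := ng v Gv; rewrite Kv E.
Qed.

(** The position of the token of [a] after the slot. By [tok_src] every new token is the image of an
    old one with the same key, so uniqueness of tokens is inherited. *)
Definition dest a :=
  if goer y a then
    if [pick c | [&& H y c, L y c == tgt2 y a & ~~ goer y c]] is Some c then
      if (ptr (cs (y a)) < deg (L y a)) && (K y a == K y c) then a else c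
    else a
  else a.

Lemma dest_present a c : goer y a -> H y c -> L y c = tgt2 y a -> ~~ goer y c ->
  dest a = if (ptr (cs (y a)) < deg (L y a)) && (K y a == K y c) then a else c.
Proof.
move=> Ga Hc Lc Gc; rewrite /dest Ga; case: pickP => [d /and3P[Hd /eqP Ld _]|/(_ c)].
  by have -> : d = c by apply: (w_inj W) => //; rewrite Lc.
by rewrite Hc Lc eqxx Gc.
Qed.

Lemma tok_src b : H y b -> tok (cs (y' b)) ->
  exists a, [/\ H y a, tok (cs (y a)), K y a = K y' b, dest a = b & ~~ finisher y a].
Proof.
move=> Hb tb; case: (hchangeP Hb) => [Kb _ _ _ /(_ tb) [t nf ab] _ _|v Gv Lv lt Gb E|c Gb Hc Lc Gc lt Kc Kb _ _ _ _ _ _|v Gv Gb Lv Kv le E].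
- exists b; split=> //; rewrite /dest; case: ifP => // Gb.
  case: pickP => // c /and3P[Hc /eqP Lc]; by rewrite (ab Gb c Hc Lc).
- exists v; rewrite (goer_H Gv) (goer_tok Gv) (goer_nfin Gv) E; split=> //.
  by rewrite (dest_present Gv Hb (esym Lv) Gb) (gtn_eqF lt) andbF.
- exists b; rewrite (goer_tok Gb) (goer_nfin Gb) (dest_present Gb Hc Lc Gc) Kc eqxx lt; split=> //.
exists v; rewrite (goer_H Gv) (goer_tok Gv) (goer_nfin Gv) E; split=> //.
by rewrite (dest_present Gv Hb (esym Lv) Gb) ltnNge le.
Qed.

Lemma ohead_cons (T : Type) (s : seq T) x : ohead s = Some x -> s = x :: behead s.
Proof. by case: s => //= z s [->]. Qed.

Lemma inv2_step sl : inv2 y sl -> inv2 y' sl.+1.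
Proof.
move=> J; split.
- split; first exact: (s_out S).
  + by move=> a b; rewrite !(s_H S) !(s_L S); apply: (w_inj W).
  + move=> a p; rewrite (s_H S) (s_L S) => Ha; have wp := w_par W Ha.
    case: (hchangeP Ha) => [_ ->|v Gv Lv _ _ ->|b _ _ _ _ _ _ _ ->|v _ _ _ _ _ ->] //=; try by move=> *; apply: wp.
    move=> [<-]; apply: (proj1 (rportP portP _)).
    by rewrite adjS -Lv; apply: tgt_adj.
  + move=> a b; rewrite !(s_H S) => Ha Hb ta tb Kab.
    have [a' [Ha' ta' Ka' <- _]] := tok_src Ha ta; have [b' [Hb' tb' Kb' <- _]] := tok_src Hb tb.
    by rewrite (w_uniq W Ha' Hb' ta' tb') // Ka' Kb'.
  + by move=> a; rewrite (s_H S) => Ha; apply: leq_trans (w_key W Ha) (key_mono Ha).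
- move=> a; rewrite (s_H S) => Ha; split.
    by apply: leq_trans (key_mono Ha); case: (i_key J Ha).
  case: (hchangeP Ha) => [->|v Gv Lv _ _ ->|b _ _ _ _ _ _ ->|v _ _ _ _ _ ->] //=; try by case: (i_key J Ha).
  by case: (i_key J (goer_H Gv)).
- move=> a; rewrite (s_H S) => Ha ta.
  have src v : H y v -> tok (cs (y v)) -> K y v = K y' a ->
    (forall r k s, kmatch y (K y v) (dfsn r k) -> stk (dfsn r k) = L y v :: s ->
      exists2 k', k' <= k.+1 & kmatch y' (K y v) (dfsn r k') /\ ohead (stk (dfsn r k')) = Some (L y' a)) ->
    exists r k, [/\ H y' r, id r = (K y' a)./2, k <= sl.+1, kmatch y' (K y' a) (dfsn (L y' r) k) &
        ohead (stk (dfsn (L y' r) k)) = Some (L y' a)].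
    move=> Hv tv Kv st; have [r [k [Hr ir kl M hd]]] := i_tok J Hv tv.
    have [k' kl' [M' hd']] := st _ _ _ M (ohead_cons hd).
    exists r, k'; rewrite (s_H S) -Kv (s_L S); split=> //.
    exact: leq_trans kl' _.
  case: (hchangeP Ha) => [Ka _ _ _ /(_ ta) [t nf ab] _ _|v Gv Lv lt Ga E|c Ga Hc Lc Gc lt Kc Ka pa pta da _ _ _|v Gv Ga Lv Kv le E].
  + apply: (src a) => // r k s M st; exists k => //; split; last by rewrite st (s_L S).
    exact: kmatch_same.
  + have ia := proj1 (i_key J Ha).
    have K'a : K y' a = K y v by rewrite E.
    apply: (src v); rewrite ?(goer_H Gv) ?(goer_tok Gv) ?K'a // => r k s M st; exists k.+1 => //.
    by case: (kmatch_push (goer_H Gv) (goer_tok Gv) M st ia Gv Ha (esym Lv)).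
  + apply: (src a); rewrite ?(goer_tok Ga) // => r k s M st; exists k.+1 => //.
    by apply: (kmatch_vis Ha (goer_tok Ga) M st Ga Hc) => //; rewrite (s_H S).
  + have K'a : K y' a = K y v by rewrite E.
    apply: (src v); rewrite ?(goer_H Gv) ?(goer_tok Gv) ?K'a // => r k s M st; exists k.+1 => //.
    by apply: (kmatch_pop (goer_H Gv) (goer_tok Gv) M st Gv Ga).
- move=> a; rewrite (s_H S) => Ha fa.
  have notok : K y' a = K y a -> (forall b, H y b -> tok (cs (y b)) -> K y b = K y a -> finisher y b) ->
    forall b, H y' b -> tok (cs (y' b)) -> K y' b <> K y' a.
    move=> Ka nt b; rewrite (s_H S) => Hb tb.
    have [c [Hc tc <- _ nf]] := tok_src Hb tb; rewrite Ka => E.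
    by rewrite (nt c) in nf.
  case: (hchangeP Ha) fa => [Ka _ _ _ _ -> _|v _ _ _ _ -> //|c Ga _ _ _ _ _ _ _ _ _ _ _ ->|v Gv Ga Lv Kv _ ->].
  + case/orP => [fa|fi].
      have [ia nt [k [kl fin M]]] := i_fin J Ha fa.
      rewrite Ka; split=> //.
        by rewrite -Ka; apply: (notok Ka) => b Hb tb /(nt b Hb tb).
      exists k; rewrite (s_L S); split=> //; first exact: leqW.
      exact: kmatch_keep.
    have ta : tok (cs (y a)) by case/andP: fi => /and3P[].
    have [r [k [Hr ir kl M hd]]] := i_tok J Ha ta.
    have st := ohead_cons hd; have [fin Lr] := finisher_spec Ha M st fi.
    have ar : a = r by apply: (w_inj W).
    rewrite Ka {1}ar; split=> //.
      rewrite -Ka; apply: (notok Ka) => // b Hb tb Kb.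
      by rewrite (w_uniq W Hb Ha tb ta Kb).
    exists k; rewrite (s_L S) Lr; split=> //; first exact: leqW.
    apply: (kmatch_same Ha ta M) => Ga; by rewrite (negbTE (goer_nfin Ga)) in fi.
  + by move=> fa; have [_ nt _] := i_fin J Ha fa; case: (nt a Ha (goer_tok Ga)).
  + case/orP => [fa|/andP[/and3P[_ ta _] _]].
      by have [_ nt _] := i_fin J Ha fa; case: (nt v (goer_H Gv) (goer_tok Gv)).
    by move: (Gv) Ga; rewrite (goer_uniq Gv ta Ha Kv) => ->.
- move=> a; rewrite (s_H S) => Ha.
  case: (hchangeP Ha) => [_ _ _ _ _ -> r'|v _ _ _ _ -> //|c _ _ _ _ _ _ _ _ _ _ _ -> //|v _ _ _ _ _ -> //].
  move=> /r' /orP[-> //|/andP[ra tf]].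
  case/orP: (i_rty J Ha ra) => [ta|->]; last by rewrite orbT.
  by rewrite ta in tf; rewrite (implyP tf) ?orbT.
Qed.
End Step.
End Inv2.

(* The bits of [u] followed by their complements: the words of distinct numbers form
   an antichain, so each of two competitors is at some point the only one moving. *)
Definition code B i u :=
  let j := i %% (2 * B) in if j < B then odd (u %/ 2 ^ j) else ~~ odd (u %/ 2 ^ (j - B)).

Lemma bits_differ B u v : u < 2 ^ B -> v < 2 ^ B -> u != v ->
  exists2 j, j < B & odd (u %/ 2 ^ j) != odd (v %/ 2 ^ j).
Proof.
elim: B u v => [|B IH] u v; first by rewrite expn0 !ltnS !leqn0 => /eqP-> /eqP->.
move=> uB vB uv; case: (boolP (odd u == odd v)) => [/eqP E|ne]; last first.
  by exists 0; rewrite // expn0 !divn1.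
have [|||j jB ne] := IH (u %/ 2) (v %/ 2).
- by rewrite ltn_divLR // -expnSr.
- by rewrite ltn_divLR // -expnSr.
- apply: contraNneq uv => E2; rewrite (divn_eq u 2) (divn_eq v 2) E2 !modn2 E; exact: eqxx.
by exists j.+1; rewrite // expnS !divnMA.
Qed.

Lemma code_antichain B c u v : u < 2 ^ B -> v < 2 ^ B -> u != v ->
  exists i, [/\ c <= i, i < c + 2 * B, code B i u & ~~ code B i v].
Proof.
move=> uB vB uv; have [j jB ne] := bits_differ uB vB uv.
have B0 : 0 < 2 * B by lia.
have idx t : t < 2 * B -> exists i, [/\ c <= i, i < c + 2 * B & i %% (2 * B) = t].
  move=> tB; have cm := ltn_pmod c B0; have cE := divn_eq c (2 * B).
  have mE q : (q * (2 * B) + t) %% (2 * B) = t by rewrite modnMDl modn_small.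
  case: (leqP (c %% (2 * B)) t) => le.
    by exists (c %/ (2 * B) * (2 * B) + t); split => //; lia.
  by exists ((c %/ (2 * B)).+1 * (2 * B) + t); split => //; lia.
case: (boolP (odd (u %/ 2 ^ j))) ne => [uj|uj] ne.
  have [|i [ci ic im]] := idx j; first by lia.
  by exists i; rewrite /code im jB uj; split=> //; case: (odd _) ne.
have [|i [ci ic im]] := idx (B + j); first by lia.
have cE w : code B i w = ~~ odd (w %/ 2 ^ j).
  by rewrite /code im /= addKn; have -> : (B + j < B) = false by lia.
by exists i; rewrite !cE uj; split=> //; move: ne; case: (odd _).
Qed.

(** * Progress of the traversal with the largest key *)

Section Live.
Variables (V : finType) (adj : rel V) (port : V -> nat -> V).
Hypothesis adjS : symmetric adj.
Hypothesis adjI : irreflexive adj.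
Hypothesis portP : port_labeling adj port.
Notation deg := (deg adj).
Notation rport := (rport adj port).
Notation N := #|V|.
Variable id : 'I_N -> nat.
Notation conf := ('I_N -> cell V st2).
Notation H x a := (hm (cs (x a))).
Notation K x a := (key (cs (x a))).
Notation L x a := (cl (x a)).
Notation dfsn := (dfsn adj port).
Notation dstep := (dstep adj port).
Notation dinv := (dinv adj port).
Notation dfin := (dfin adj).
Notation wf2 := (wf2 adj).
Notation tgt2 := (tgt2 adj port).
Variable Pk : nat -> Prop.
Notation inv2 := (inv2 adj port id Pk).
Notation kmatch := (kmatch adj port id).

Definition live (y : conf) q r k a :=
  [/\ H y a, tok (cs (y a)), K y a = q, kmatch y q (dfsn r k) & ohead (stk (dfsn r k)) = Some (L y a)].

Section Step.
Variables (slow : bool) (bit : nat -> bool) (y y' : conf).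
Notation goer := (goer adj id slow bit).
Notation finisher := (finisher adj id slow bit).
Hypothesis S : slot_spec adj port id slow bit y y'.
Variable sl : nat.
Hypothesis J : inv2 y sl.
Let W := i_wf J.
Variable q : nat.
Hypothesis top : forall b, H y b -> K y b <= q.

Lemma top_next b : H y' b -> K y' b <= q.
Proof.
rewrite (s_H S) => Hb.
case: (hchangeP S Hb) => [->|v Gv _ _ _ ->|c _ _ _ _ _ _ ->|v _ _ _ _ _ ->] *; try exact: top.
by apply: top; apply: (goer_H Gv).
Qed.

Lemma fin_next a : H y a -> K y a = q -> fin2 (cs (y a)) -> [/\ H y' a, K y' a = q & fin2 (cs (y' a))].
Proof.
move=> Ha Ka fa; rewrite (s_H S).
case: (hchangeP S Ha) => [-> _ _ _ _ ->|v Gv _ lt _ _|c _ _ _ _ _ _ -> _ _ _ _ _ ->|v _ _ _ _ _ ->] //=.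
- by rewrite fa.
- by have := top (goer_H Gv); rewrite -Ka leqNgt lt.
by rewrite fa.
Qed.

Hypothesis all_homes : forall u, exists2 b, H y b & L y b = u.

(** The largest key is never captured, so its traversal follows [dfsn] except when the target is
    absent. In that case the target is unvisited, and every delay can be charged to a future
    capture. *)
Lemma top_step r k a : live y q r k a ->
  [\/ finisher y a /\ [/\ H y' a, K y' a = q & fin2 (cs (y' a))],
      [/\ ~~ elig slow bit (id a) (cs (y a)), live y' q r k a & rty (cs (y' a)) = rty (cs (y a))],
      exists c, [/\ [/\ goer y c, H y c, c != a & elig slow bit (id a) (cs (y a))], L y c = port (L y a) (pt (dfsn r k) (L y a)),
         vs (dfsn r k.+1) = L y c |: vs (dfsn r k), L y c \notin vs (dfsn r k) &
         live y' q r k a /\ rty (cs (y' a))] |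
      [/\ elig slow bit (id a) (cs (y a)), ~~ dfin (dfsn r k) & exists a', live y' q r k.+1 a' /\ ~~ rty (cs (y' a'))]].
Proof.
move=> [Ha ta Ka M hd]; have st := ohead_cons hd.
have I := dfs_inv adjS adjI portP r k.
have [av pE dE prE] := m_key M Ha Ka.
have M' : kmatch y (K y a) (dfsn r k) by rewrite Ka.
have uniq_a v : goer y v -> K y v = q -> v = a.
  by move=> Gv Kv; apply: (goer_uniq W Gv ta Ha); rewrite Ka.
case: (boolP (goer y a)) => Ga; last first.
  case: (s_home S Ha Ga) => [[v [Gv _ lt _ _]]|[_ [v [Gv _ Kv _ _]]]|[_ _ E]].
  - by have := top (goer_H Gv); rewrite -Ka leqNgt lt.
  - by move: (Gv) Ga; rewrite Ka in Kv; rewrite (uniq_a v Gv Kv) => ->.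
  have K'a : K y' a = q by rewrite E.
  case: (boolP (finisher y a)) => Fa.
    by constructor 1; split=> //; rewrite (s_H S); split=> //; rewrite E /= Fa orbT.
  constructor 2; split; last by rewrite E.
    by move: Ga Fa; rewrite /goer /finisher; case: elig => //=; case: ltnP => //= _ /negbNE ->.
  split; rewrite ?(s_H S) ?(s_L S) //; first by rewrite E /= ta Fa.
  by rewrite -Ka; apply: (kmatch_same W S Ha ta M') => Ga'; rewrite Ga' in Ga.
have [K'a p'a f'a] := s_goer S Ga; have El : elig slow bit (id a) (cs (y a)) by case/andP: Ga.
have nfin : ~~ dfin (dfsn r k).
  rewrite /dfin st; case: behead (st) => // st1.
  have := prE; rewrite st1 /= eqxx mem_head => /(_ isT) p0.
  by case/andP: Ga => _; rewrite p0 orbF pE; case: ltngtP.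
case: (pickP [pred c | [&& H y c, L y c == tgt2 y a & ~~ goer y c]]) => [c /and3P[Hc /eqP Lc Gc]|none].
  constructor 4; split=> //; have pres := s_present S Ga Hc Lc Gc.
  case: (ltngtP (K y c) (K y a)) => [lt|gt|Kca].
  - have K'c : K y' c = K y a /\ tok (cs (y' c)) /\ ~~ rty (cs (y' c)).
      case: (s_home S Hc Gc) => [[v [Gv Lv _ mx E]]|[mx _]|[mx _ _]].
      + have Kv : K y v = q.
          by apply/eqP; rewrite eqn_leq (top (goer_H Gv)) -Ka; apply: mx.
        by rewrite E /= Kv Ka.
      + by have := mx a Ga (esym Lc); rewrite leqNgt lt.
      by have := mx a Ga (esym Lc); rewrite leqNgt lt.
    have [K'c' [t'c r'c]] := K'c.
    have ic := proj1 (i_key J Hc).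
    have [_ _ _ kM kh] := kmatch_push adjS adjI portP W S Ha ta M' st ic Ga Hc Lc lt Gc K'c'.
    by exists c; split=> //; split; rewrite ?(s_H S) // ?K'c' // -Ka.
  - by have := top Hc; rewrite -Ka leqNgt gt.
  case: (ltnP (ptr (cs (y a))) (deg (L y a))) => [lt|le].
    move: pres; rewrite lt Kca eqxx /= => -[t' r' pt' d'].
    have H'a : H y' a by rewrite (s_H S).
    have [kM kh] := kmatch_vis W S Ha ta M' st Ga Hc Lc lt Kca H'a K'a p'a pt' d' Gc.
    by exists a; split=> //; split; rewrite // -?Ka.
  case: (s_home S Hc Gc) => [[v [Gv _ lt _ _]]|[_ [v [Gv Lv Kv dv E]]]|[_ mx _]].
  - by have := top (goer_H Gv); rewrite -Ka -Kca leqNgt lt.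
  - have va : v = a by apply: uniq_a; rewrite // Kv Kca.
    rewrite {}va in Gv Lv Kv dv E.
    have K'c : K y' c = K y a by rewrite E.
    have [kM kh] := kmatch_pop adjS adjI portP W S Ha ta M' st Ga Gc Lv Kv le Hc K'c E.
    exists c; split.
      by split; rewrite ?(s_H S) // -?Ka // E.
    rewrite E /=; apply/negP => rc; case/orP: (i_rty J Hc rc) => [tc|fc].
      by have ac := w_uniq W Ha Hc ta tc Kv; rewrite -ac Ga in Gc.
    by have [_ nt _] := i_fin J Hc fc; case: (nt a Ha ta).
  by have := mx a Ga (esym Lc) (esym Kca); rewrite ltnNge le.
have ab b : H y b -> L y b = tgt2 y a -> goer y b.
  by move=> Hb Lb; have := none b; rewrite /= Hb Lb eqxx /= => /negbFE.
have [c Hc Lc] := all_homes (tgt2 y a); have Gc := ab c Hc Lc.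
have ca : c != a.
  apply/eqP => E; have := tgt_adj portP W Ga.
  by rewrite -Lc E adjI.
(* The home of a visited node has key [q] exactly; being on the move it would hold the token of [q],
   hence be [a]. *)
have nv : tgt2 y a \notin vs (dfsn r k).
  apply/negP => /(m_vis M) [b [Hb Lb Kb _]].
  have bc : b = c by apply: (w_inj W) => //; rewrite Lc.
  by move: ca; rewrite (uniq_a c) ?eqxx // -bc; apply/eqP; rewrite eqn_leq Kb top.
have lt : ptr (cs (y a)) < deg (L y a).
  by rewrite ltnNge; apply/negP => le; have [s' _ h] := ret_spec adjS adjI portP Ha M' st Ga le; rewrite h in nv.
have tE : tgt2 y a = port (L y a) (pt (dfsn r k) (L y a)) by rewrite /tgt2 lt pE.
have vE : vs (dfsn r k.+1) = tgt2 y a |: vs (dfsn r k).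
  change (vs (dstep (dfsn r k)) = tgt2 y a |: vs (dfsn r k)).
  by rewrite /dstep st -pE lt pE -tE (negbTE nv).
have [t' r' pt' d'] := s_absent S Ga ab.
constructor 3; exists c; rewrite Lc; split=> //; split=> //; split; rewrite ?(s_H S) ?(s_L S) ?K'a //.
by rewrite -Ka; apply: (kmatch_same W S Ha ta M').
Qed.
End Step.

Definition slot slow bit y := rstep adj port id tr2_res (rstep adj port id tr2_rec (rstep adj port id (tr2_go slow bit) y)).
Definition cyc bit y := slot true bit (slot false bit y).

Lemma slot_inv slow bit y sl : inv2 y sl ->
  slot_spec adj port id slow bit y (slot slow bit y) /\ inv2 (slot slow bit y) sl.+1.
Proof.
move=> J; have S := slotP adjS portP id slow bit (i_wf J); split=> //.
exact: (inv2_step adjS adjI portP (i_wf J) S J).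
Qed.

Lemma cyc_inv bit y sl : inv2 y sl -> inv2 (cyc bit y) sl.+2.
Proof. by move=> /(slot_inv false bit) [_] /(slot_inv true bit) []. Qed.

Lemma cyc_static bit y sl : inv2 y sl -> forall a, H (cyc bit y) a = H y a /\ L (cyc bit y) a = L y a.
Proof.
move=> /(slot_inv false bit) [S J] a; have [S' _] := slot_inv true bit J.
by rewrite (s_H S') (s_H S) (s_L S') (s_L S).
Qed.

Variable B : nat.
Hypothesis id_inj : injective id.
Hypothesis id_lt : forall a, id a < 2 ^ B.

(** [c0] is the cycle of the first failure at the current edge. Since then [b] had its bit set
    whenever [a] had, a situation that [code_antichain] ends within [2 * B] cycles. *)
Definition wait (y : conf) r k a c := exists c0 b,
  [/\ L y b = port (L y a) (pt (dfsn r k) (L y a)), b != a & H y b] /\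
  [/\ vs (dfsn r k.+1) = L y b |: vs (dfsn r k), L y b \notin vs (dfsn r k), c0 <= c,
      c0 <= k + 2 * B * #|vs (dfsn r k)| &
      forall i, c0 <= i -> i < c -> code B i (id a) -> code B i (id b)].

(** An amortised clock: each cycle makes a step of the traversal or is one of the [2 * B] allotted
    to the next unvisited node. The condition on [k.-1] stops [k] from growing beyond completion. *)
Definition prog (y : conf) q r c :=
  (exists a, [/\ H y a, K y a = q & fin2 (cs (y a))]) \/
  exists a k, [/\ live y q r k a, (k == 0) || ~~ dfin (dfsn r k.-1) &
    if rty (cs (y a)) then wait y r k a c else c <= k + 2 * B * #|vs (dfsn r k)|].

Lemma vs_card r k : #|vs (dfsn r k)| <= #|vs (dfsn r k.+1)|.
Proof. by apply: subset_leq_card; apply/subsetP => u; apply: vs_step. Qed.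

Lemma wait_push r k (u : V) : u \notin vs (dfsn r k) -> vs (dfsn r k.+1) = u |: vs (dfsn r k) ->
  #|vs (dfsn r k.+1)| = #|vs (dfsn r k)|.+1.
Proof. by move=> nu ->; rewrite cardsU1 nu. Qed.

Lemma cyc_prog y sl q r c : inv2 y sl -> (forall b, H y b -> K y b <= q) ->
  (forall u, exists2 b, H y b & L y b = u) -> prog y q r c ->
  prog (cyc (code B c) y) q r c.+1.
Proof.
move=> J top hom P; have [S J1] := slot_inv false (code B c) J.
set y1 := slot false (code B c) y in S J1.
have [S' J2] := slot_inv true (code B c) J1.
rewrite /cyc -/y1; set y2 := slot true _ y1 in S' J2 *.
have top1 := top_next S top.
have hom1 u : exists2 b, H y1 b & L y1 b = u.
  by have [b] := hom u; exists b; rewrite ?(s_H S) ?(s_L S).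
have P1 : (exists a, [/\ H y1 a, K y1 a = q & fin2 (cs (y1 a))]) \/
  exists a k, [/\ live y1 q r k a, (k == 0) || ~~ dfin (dfsn r k.-1) &
    if rty (cs (y1 a)) then wait y1 r k a c else c < k + 2 * B * #|vs (dfsn r k)|].
  case: P => [[a [Ha Ka fa]]|[a [k [lv kf w]]]].
    by left; exists a; apply: (fin_next S top).
  have [Ha ta _ _ _] := lv.
  case: (top_step S J top hom lv) => [[_ fa]|[El lv' r']|[b [[Gb Hb ba El] Lb vE nv [lv' r']]]|[El nf [a' [lv' r']]]].
  - by left; exists a.
  - right; exists a, k; split=> //; rewrite r'.
    move: El; rewrite /elig Ha ta /= negbK => ra.
    rewrite ra in w *; case: w => c0 [b [[w1 w2 w3] w4]]; exists c0, b.
    by rewrite !(s_L S) (s_H S).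
  - right; exists a, k; split=> //; rewrite r'.
    move: El; rewrite /elig Ha ta /= => /negbTE ra; rewrite ra in w.
    by exists c, b; rewrite !(s_L S) (s_H S); split=> //; split=> // i ci; rewrite ltnNge ci.
  right; exists a', k.+1; rewrite (negbTE r') nf orbT; split=> //.
  move: El; rewrite /elig Ha ta /= => /negbTE ra; rewrite ra in w.
  by have := leq_mul (leqnn (2 * B)) (vs_card r k); rewrite /= => vc; lia.
case: P1 => [[a [Ha Ka fa]]|[a [k [lv kf w]]]].
  by left; exists a; apply: (fin_next S' top1).
have [Ha ta _ _ _] := lv.
case: (top_step S' J1 top1 hom1 lv) => [[_ fa]|[El lv' r']|[b [[Gb Hb ba El] Lb vE nv [lv' r']]]|[El nf [a' [lv' r']]]].
- by left; exists a.
- right; exists a, k; split=> //; rewrite r'.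
  case ra: (rty (cs (y1 a))) w => // -[c0 [b [[w1 w2 w3] [w4 w5 w6 w7 w8]]]].
  exists c0, b; rewrite !(s_L S') (s_H S'); split=> //; split=> //; first exact: leqW.
  move=> i ci; rewrite ltnS leq_eqVlt => /orP[/eqP->|]; last exact: w8.
  by move: El; rewrite /elig Ha ta ra /= => /negbTE ->.
- right; exists a, k; split=> //; rewrite r'.
  move: El; rewrite /elig Ha ta /= => /andP[ra ca]; rewrite ra in w.
  case: w => c0 [b' [[w1 w2 w3] [w4 w5 w6 w7 w8]]].
  have bb : b' = b by apply: (w_inj (i_wf J1)) => //; rewrite w1 Lb.
  rewrite {}bb in w1 w2 w3 w4 w5 w8.
  exists c0, b; rewrite !(s_L S') (s_H S'); split=> //; split=> //; first exact: leqW.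
  move=> i ci; rewrite ltnS leq_eqVlt => /orP[/eqP->|]; last exact: w8.
  by case/andP: Gb => /and3P[_ _ /andP[]].
right; exists a', k.+1; rewrite (negbTE r') nf orbT; split=> //.
move: El; rewrite /elig Ha ta /= => /andP[ra ca]; rewrite ra in w.
case: w => c0 [b [[w1 w2 w3] [w4 w5 w6 w7 w8]]].
have iab : id a != id b by apply: contraNneq w2 => /id_inj ->.
(* At cycle [i] the retrier [a] moves while [b] does not. So [i] is not yet past, the waiting took
   less than [2 * B] cycles, and the newly visited node pays for them. *)
have [i [ci ic ia ib]] := code_antichain c0 (id_lt a) (id_lt b) iab.
rewrite (wait_push w5 w4); case: (ltnP i c) => [ic'|ci'].
  by have := w8 i ci ic' ia; rewrite (negbTE ib).
by rewrite mulnS; move: w7 ci' ic; clear; lia.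
Qed.

Lemma prog_bound y q r c : prog y q r c -> \sum_v deg v + #|V| + 2 * B * #|V| < c ->
  exists a, [/\ H y a, K y a = q & fin2 (cs (y a))].
Proof.
case=> // -[a [k [lv kf w]]] lt; have {kf} kle : k <= \sum_v deg v + #|V|.
  case: k {lv w} kf => //= k; apply: contraNleq => le; exact: dfs_finishes le.
have vle : #|vs (dfsn r k)| <= #|V| by apply: max_card.
case: (rty _) w => [|le]; last by nia.
case=> c0 [b [[w1 w2 w3] [w4 w5 w6 w7 w8]]].
have iab : id a != id b by apply: contraNneq w2 => /id_inj ->.
have [i [ci ic ia ib]] := code_antichain c0 (id_lt a) (id_lt b) iab.
have : #|vs (dfsn r k.+1)| <= #|V| by apply: max_card.
rewrite (wait_push w5 w4) => vlt; case: (ltnP i c) => [ic'|ci'].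
  by have := w8 i ci ic' ia; rewrite (negbTE ib).
have := leq_mul (leqnn (2 * B)) vlt; rewrite mulnS => h.
move: lt kle w7 h ci' ic; clear; lia.
Qed.
End Live.

(* A winner [u] with key [2 * u] starts over with key [2 * u + 1], so that odd keys at
   the end certify a completed election. *)
Definition tr2_switch : trans2 := fun u s d en oth =>
  (if hm s && fin2 s then S2 true (2 * u).+1 0 0 0 true false 0 (en2 s) false else s, None).

Definition tr2_final : trans2 := fun u s d en oth =>
  (s, if hm s && odd (key s) then (if dom s is p.+1 then Some p else None) else None).

Definition slot_tr slow bit sub : trans2 :=
  match sub with 0 => tr2_go slow bit | 1 => tr2_rec | _ => tr2_res end.

Definition stage B r := slot_tr (3 <= r %% 6) (code B (r %/ 6)) (r %% 3).

(** The election needs more than [2 * m + 1 + n + 2 * (c * e).+1 * n] cycles. In units of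
    [2 ^ e * e.+1 ^ 2] these terms cost 2, 1, 1 and [2 * (c + 1)]; one more unit makes the
    inequality strict. *)
Definition cycles c e := (2 * c + 7) * 2 ^ e * e.+1 ^ 2.

(** Words of [(c * e).+1] bits hold identifiers up to [n ^ c] when [n <= 2 ^ e]. The second
    traversal gets twice as many cycles as the first because it is sure of one step per cycle only,
    while the first may have made one in each of the two slots. *)
Definition tr2 c e tau : trans2 :=
  if tau is r.+1 then
    let W := 6 * cycles c e in
    if r < W then stage (c * e).+1 r
    else if r == W then tr2_switch
    else if r < 3 * W + 1 then stage (c * e).+1 (r - W.+1)
    else tr2_final
  else tr2_init.

Definition len2 c e := 3 * (6 * cycles c e) + 3.

(** * Certificate, second traversal and final positions *)

Section Phase2.
Variables (V : finType) (adj : rel V) (port : V -> nat -> V).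
Hypothesis adjS : symmetric adj.
Hypothesis adjI : irreflexive adj.
Hypothesis portP : port_labeling adj port.
Hypothesis conn : connected_graph adj.
Notation deg := (deg adj).
Notation N := #|V|.
Variable id : 'I_N -> nat.
Hypothesis id_inj : injective id.
Hypothesis id_pos : forall a, 0 < id a.
Notation conf := ('I_N -> cell V st2).
Notation H x a := (hm (cs (x a))).
Notation K x a := (key (cs (x a))).
Notation L x a := (cl (x a)).
Notation dfsn := (dfsn adj port).
Notation dfin := (dfin adj).
Notation rstep := (rstep adj port id).
Notation rrun := (rrun adj port id).
Notation inv2 := (inv2 adj port id).
Notation cyc := (cyc adj port id).
Notation slot := (slot adj port id).
Notation kmatch := (kmatch adj port id).
Notation live := (live adj port id).

Fixpoint cycs B n y := if n is n'.+1 then cyc (code B n') (cycs B n' y) else y.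

Lemma stageE B n i : i < 6 -> stage B (6 * n + i) = slot_tr (3 <= i) (code B n) (i %% 3).
Proof.
move=> i6; rewrite /stage.
have -> : (6 * n + i) %% 6 = i by rewrite mulnC modnMDl modn_small.
have -> : (6 * n + i) %/ 6 = n by rewrite mulnC divnMDl // divn_small // addn0.
by have -> : (6 * n + i) %% 3 = i %% 3 by rewrite (_ : 6 * n = 2 * n * 3) ?modnMDl //; lia.
Qed.

Lemma rrun6 S (tr : nat -> nat -> S -> nat -> option nat -> seq (nat * S) -> S * option nat) t y :
  rrun tr t 6 y = rstep (tr (t + 5)) (rstep (tr (t + 4)) (rstep (tr (t + 3))
    (rstep (tr (t + 2)) (rstep (tr (t + 1)) (rstep (tr (t + 0)) y))))).
Proof. by []. Qed.

Lemma stage_cycs B n y : rrun (stage B) 0 (6 * n) y = cycs B n y.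
Proof.
elim: n => [|n IH]; first by rewrite muln0.
rewrite mulnS addnC rrunD {}IH add0n rrun6.
have E i : i < 6 -> _ := @stageE B n i.
by rewrite (E 0) // (E 1) // (E 2) // (E 3) // (E 4) // (E 5).
Qed.

Lemma cycs_inv Pk B n y sl : inv2 Pk y sl -> inv2 Pk (cycs B n y) (sl + 2 * n) /\
  forall a, H (cycs B n y) a = H y a /\ L (cycs B n y) a = L y a.
Proof.
move=> J; elim: n => [|n [IH st]]; first by rewrite muln0 addn0; split=> // a.
split; first by rewrite mulnS addnCA; apply: (cyc_inv adjS adjI portP).
move=> a /=; have [-> ->] := cyc_static adjS adjI portP (code B n) IH a.
exact: st.
Qed.

Lemma init2 (x : conf) : let y := rstep tr2_init x in
  [/\ forall a, L y a = L x a,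
      inv2 (fun q => ~~ odd q /\ exists2 r, H y r & id r = q./2) y 0 &
      forall a, H y a -> live y (2 * id a) (L y a) 0 a /\ ~~ rty (cs (y a))].
Proof.
move=> y.
have yE a : y a = let h := maxo fst (view id x a) < id a in
    Cell (L x a) (ce (x a)) (S2 h (2 * id a) 0 0 0 h false 0 0 false).
  by rewrite /y rstepE.
have keyE a : K y a = 2 * id a by rewrite yE.
have yL a : L y a = L x a by rewrite yE.
have key_inj a b : K y a = K y b -> a = b.
  by rewrite !keyE => E; apply: id_inj; lia.
have lv a : H y a -> live y (2 * id a) (L y a) 0 a.
  move=> Ha; split=> //; first by move: Ha; rewrite yE.
  split=> [u|b Hb].
    by rewrite inE => /eqP->; exists a; rewrite keyE.
  by rewrite -keyE => /key_inj->; rewrite yE /= !inE eqxx; split=> //; rewrite eqxx.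
split=> //.
  split.
  - split=> [a|a b Ha Hb Lab|a p _|a b _ _ _ _|a _]; last by rewrite keyE muln_gt0 id_pos.
    + by rewrite yE.
    + apply/eqP; apply: contraT => ab.
      have h c d : H y c -> d != c -> L x d = L x c -> id d < id c.
        rewrite yE /= => h dc Lc; apply: leq_ltn_trans h.
        exact: (@maxo_view_ge _ _ id _ fst x c d).
      have := h a b Ha; rewrite eq_sym ab -!yL Lab => /(_ isT erefl) l1.
      by have := h b a Hb ab; rewrite -!yL Lab => /(_ erefl) l2; lia.
    + by rewrite yE.
    exact: key_inj.
  - by move=> a Ha; rewrite keyE leqnn mul2n odd_double; split=> //; split=> //; exists a; rewrite ?doubleK.
  - move=> a Ha ta; have [_ _ _ M hd] := lv a Ha; exists a, 0; rewrite keyE.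
    by rewrite mul2n doubleK -mul2n.
  - by move=> a _; rewrite yE.
  by move=> a _; rewrite yE.
by move=> a Ha; split; [apply: lv|rewrite yE].
Qed.

Lemma dfin_mono r k k' : k <= k' -> dfin (dfsn r k) -> dfin (dfsn r k').
Proof.
by move=> /subnKC <- fin; elim: (k' - k) => [|j IH]; rewrite ?addn0 // addnS dfs_fin_step.
Qed.

(** Every key stems from an agent that is a home; [fin_all] needs this to compare a foreign key with
    the winning one. *)
Definition Pk0 (h : 'I_N -> bool) q := ~~ odd q /\ exists2 r, h r & id r = q./2.

Lemma even_half q : ~~ odd q -> q = 2 * q./2.
Proof. by move=> /negbTE o; rewrite -{1}(odd_double_half q) o add0n mul2n. Qed.

(** The finished traversal visited every node, so all keys are at least its own. Conversely each key
    is [2 * id r] for a home [r], which was visited too, and [m_vis] bounds [2 * id r] by the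
    winning key. *)
Lemma fin_all h (y : conf) sl a : inv2 (Pk0 h) y sl -> (forall b, H y b = h b) -> H y a -> fin2 (cs (y a)) ->
  [/\ forall u, exists2 b, H y b & L y b = u, forall b, H y b -> K y b = K y a,
      forall b, H y b -> ~~ tok (cs (y b)), K y a = 2 * id a &
      exists2 k, k <= sl & dfin (dfsn (L y a) k)].
Proof.
move=> J hE Ha fa; have [ia nt [k [ksl fin M]]] := i_fin J Ha fa.
have [_ [ev _]] := i_key J Ha; have Ka : K y a = 2 * id a by rewrite ia -even_half.
have vis u : u \in vs (dfsn (L y a) k) by case: (dfs_fin_all adjS adjI portP conn u fin).
have le b : H y b -> K y a <= K y b /\ 2 * id b <= K y a.
  move=> Hb; have [c [Hc Lc Kc ic]] := m_vis M (vis (L y b)).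
  by have <- : c = b by apply: (w_inj (i_wf J)).
have eq b : H y b -> K y b = K y a.
  move=> Hb; have [_ [evb [r hr ir]]] := i_key J Hb.
  have Hr : H y r by rewrite hE.
  apply/eqP; rewrite eqn_leq; case: (le b Hb) => -> _; rewrite andbT.
  by rewrite (even_half evb) -ir; case: (le r Hr).
split=> //; last by exists k.
  by move=> u; have [b [Hb Lb _ _]] := m_vis M (vis u); exists b.
by move=> b Hb; apply/negP => tb; apply: (nt b Hb tb); apply: eq.
Qed.

(** All keys equal [2 * id a] and no token is left, so raising the key of [a] by one starts a lone
    traversal that can capture every other home. *)
Lemma switch_fin h (y : conf) sl a : inv2 (Pk0 h) y sl -> (forall b, H y b = h b) -> H y a -> fin2 (cs (y a)) ->
  let y' := rstep tr2_switch y in let q := (2 * id a).+1 in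
  [/\ inv2 (fun _ => True) y' 0, live y' q (L y a) 0 a /\ ~~ rty (cs (y' a)),
      forall b, H y' b = H y b /\ L y' b = L y b,
      forall b, H y' b -> K y' b <= q & forall b, H y' b -> tok (cs (y' b)) -> K y' b = q].
Proof.
move=> J hE Ha fa; have [hom eqK ntok Ka [k ksl fin]] := fin_all J hE Ha fa.
move=> y' q.
have fin_a b : H y b -> fin2 (cs (y b)) -> b = a.
  move=> Hb /(i_fin J Hb) [ib _ _]; apply: id_inj; rewrite ib eqK // Ka mul2n doubleK //.
have ya : y' a = Cell (L y a) (ce (y a)) (S2 true q 0 0 0 true false 0 (en2 (cs (y a))) false).
  by rewrite /y' rstepE /tr2_switch Ha fa.
have yb b : b != a -> y' b = y b.
  move=> ba; rewrite /y' rstepE /tr2_switch; case: ifP => [/andP[Hb fb]|_].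
    by rewrite (fin_a b Hb fb) eqxx in ba.
  by case: (y b).
have HL b : H y' b = H y b /\ L y' b = L y b.
  by case: (eqVneq b a) => [->|/yb -> //]; rewrite ya Ha.
have [HE LE] : (forall b, H y' b = H y b) /\ (forall b, L y' b = L y b) by split=> b; case: (HL b).
have Kb b : H y b -> b != a -> K y' b = 2 * id a by move=> Hb ba; rewrite yb // eqK.
have tokE b : H y b -> tok (cs (y' b)) -> b = a.
  by move=> Hb; case: (eqVneq b a) => // ba; rewrite yb // => t; have := ntok b Hb; rewrite t.
have lv : live y' q (L y a) 0 a.
  split=> /=; rewrite ?ya //; split=> [u|b].
    by rewrite inE => /eqP->; exists a; rewrite ya leqnn leqnSn.
  rewrite HE => Hb; case: (eqVneq b a) => [->|ba]; last by rewrite (Kb b Hb ba) /q; lia.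
  by rewrite ya /= !inE eqxx; split=> //; rewrite eqxx.
split=> //.
- split.
  + split.
    * by move=> b; case: (eqVneq b a) => [->|/yb->]; [rewrite ya|apply: (w_out (i_wf J))].
    * by move=> b c; rewrite !HE !LE; apply: (w_inj (i_wf J)).
    * move=> b p; rewrite HE LE => Hb; case: (eqVneq b a) => [->|/yb->]; first by rewrite ya.
      exact: (w_par (i_wf J)).
    * by move=> b c; rewrite !HE => Hb Hc /(tokE b Hb)-> /(tokE c Hc)->.
    move=> b; rewrite HE => Hb; case: (eqVneq b a) => [->|/yb->]; first by rewrite ya.
    exact: (w_key (i_wf J)).
  + move=> b; rewrite HE => Hb; split=> //; case: (eqVneq b a) => [->|/yb->]; first by rewrite ya /= /q; lia.
    by case: (i_key J Hb).
  + move=> b; rewrite HE => Hb /(tokE b Hb)->; exists a, 0.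
    by have [h1 h2 h3 h4 h5] := lv; rewrite LE h3; split=> //; rewrite /q /=; lia.
  + move=> b; rewrite HE => Hb; case: (eqVneq b a) => [->|ba]; first by rewrite ya.
    by rewrite yb // => /(fin_a b Hb) E; rewrite E eqxx in ba.
  move=> b; rewrite HE => Hb; case: (eqVneq b a) => [->|ba]; first by rewrite ya.
  rewrite yb // => /(i_rty J Hb) /orP[t|/(fin_a b Hb) E]; last by rewrite E eqxx in ba.
  by have := ntok b Hb; rewrite t.
- by split=> //; rewrite ya.
- move=> b; rewrite HE => Hb; case: (eqVneq b a) => [->|ba]; first by rewrite ya.
  by rewrite (Kb b Hb ba) leqnSn.
by move=> b; rewrite HE => Hb /(tokE b Hb)->; rewrite ya.
Qed.

(** With one token in the whole graph no target is absent, so each fast slot makes a step. *)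
Definition single (y : conf) q r n :=
  [/\ forall b, H y b -> K y b <= q, forall b, H y b -> tok (cs (y b)) -> K y b = q,
      forall u, exists2 b, H y b & L y b = u &
      (exists b k, [/\ live y q r k b, ~~ rty (cs (y b)) & n <= k]) \/
      (exists b, [/\ H y b, K y b = q & fin2 (cs (y b))])].

Lemma single_slot slow bit Pk y sl q r n : inv2 Pk y sl -> single y q r n ->
  single (slot slow bit y) q r (if slow then n else n.+1).
Proof.
move=> J [top tq hom P]; have [S J'] := slot_inv adjS adjI portP slow bit J.
set y' := slot slow bit y in S J' *.
split.
- exact: (top_next S top).
- move=> b; rewrite (s_H S) => Hb tb; have [a [Ha ta <- _ _]] := tok_src (i_wf J) S Hb tb.
  exact: tq.
- by move=> u; have [b] := hom u; exists b; rewrite ?(s_H S) ?(s_L S).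
case: P => [[a [k [lv ra nk]]]|[a [Ha Ka fa]]]; last first.
  by right; exists a; apply: (fin_next S top).
have [Ha ta Ka _ _] := lv.
case: (top_step adjS adjI portP S J top hom lv) => [[_ fa]|[El lv' r']|[b [[Gb Hb ba El] Lb vE nv [lv' r']]]|[El nf [a' [lv' r']]]].
- by right; exists a.
- left; exists a, k; rewrite r'; split=> //.
  by move: El; rewrite /elig Ha ta /= (negbTE ra); case: (slow).
- have tb := goer_tok Gb; have ab := w_uniq (i_wf J) Hb Ha tb ta (etrans (tq b Hb tb) (esym Ka)).
  by rewrite ab eqxx in ba.
left; exists a', k.+1; split=> //; case: (slow) => //; exact: leqW.
Qed.

Lemma single_cycs B Pk y q r n : inv2 Pk y 0 -> single y q r 0 -> single (cycs B n y) q r n.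
Proof.
move=> J s0; elim: n => //= n IH; have [Jn _] := cycs_inv B n J.
have [_ J1] := slot_inv adjS adjI portP false (code B n) Jn.
exact: (single_slot true (code B n) J1 (single_slot false (code B n) Jn IH)).
Qed.

Lemma single_done Pk y sl q a n : inv2 Pk y sl -> single y q (L y a) n -> H y a -> id a = q./2 ->
  dfin (dfsn (L y a) n) ->
  exists k, [/\ dfin (dfsn (L y a) k), kmatch y q (dfsn (L y a) k) & forall b, H y b -> K y b = q].
Proof.
move=> J [top tq hom P] Ha ia fin.
have [k [fk M]] : exists k, dfin (dfsn (L y a) k) /\ kmatch y q (dfsn (L y a) k).
  case: P => [[b [k [[_ _ _ M _] _ nk]]]|[b [Hb Kb fb]]].
    by exists k; split=> //; apply: dfin_mono fin.
  have [ib _ [k [_ fk M]]] := i_fin J Hb fb.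
  have ab : b = a by apply: id_inj; rewrite ib Kb.
  by exists k; rewrite -Kb -ab.
exists k; split=> // b Hb; apply/eqP; rewrite eqn_leq top //=.
have [vb _] := dfs_fin_all adjS adjI portP conn (L y b) fk.
have [c [Hc Lc Kc _]] := m_vis M vb.
by have <- : c = b by apply: (w_inj (i_wf J)).
Qed.

(** The homes cover [n] nodes, and there are only [n] agents. *)
Lemma all_home (y : conf) : (forall u, exists2 b, H y b & L y b = u) -> forall a, H y a.
Proof.
move=> hom a; pose h := [set b | H y b].
suff: a \in h by rewrite inE.
suff -> : h = setT by rewrite inE.
apply/eqP; rewrite eqEcard subsetT cardsT [X in X <= _]card_ord.
apply: leq_trans (leq_imset_card (fun b => L y b) h).
rewrite -[X in X <= _]cardsT; apply: subset_leq_card.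
apply/subsetP => u _; have [b Hb <-] := hom u.
by apply: imset_f; rewrite inE.
Qed.

Lemma run2E c e x : let W := cycles c e in let B := (c * e).+1 in
  let x1 := cycs B W (rstep tr2_init x) in
  rrun (tr2 c e) 0 (len2 c e) x =
  rstep tr2_final (cycs B (2 * W) (rstep tr2_switch x1)).
Proof.
move=> W B x1; rewrite /len2 -/W.
have -> : 3 * (6 * W) + 3 = 1 + (6 * W) + 1 + 6 * (2 * W) + 1 by lia.
have rrun1 tr t y : rrun tr t 1 y = rstep (tr t) y by rewrite -[in RHS](addn0 t).
have hW : 6 * (2 * W) = 12 * W by lia.
rewrite (rrunD _ _ _ _ _ (_ + 6 * (2 * W))) (rrunD _ _ _ _ _ _ (6 * (2 * W))).
rewrite (rrunD _ _ _ _ _ (1 + 6 * W)) (rrunD _ _ _ _ _ 1) !rrun1 !add0n.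
have -> : rrun (tr2 c e) 1 (6 * W) (rstep (tr2 c e 0) x) = x1.
  rewrite /x1 -stage_cycs; apply: rrun_eq => i iW.
  by rewrite /tr2 add1n -/W iW.
have -> : tr2 c e (1 + 6 * W) = tr2_switch by rewrite add1n /tr2 -/W ltnn eqxx.
have -> : rrun (tr2 c e) (1 + 6 * W + 1) (6 * (2 * W)) (rstep tr2_switch x1) = cycs B (2 * W) (rstep tr2_switch x1).
  rewrite -stage_cycs; apply: rrun_eq => i iW.
  rewrite hW in iW.
  have -> : 1 + 6 * W + 1 + i = (6 * W + 1 + i).+1 by lia.
  rewrite /tr2 -/W; have -> : (6 * W + 1 + i < 6 * W) = false by lia.
  have -> : (6 * W + 1 + i == 6 * W) = false by lia.
  have -> : 6 * W + 1 + i < 3 * (6 * W) + 1 by lia.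
  by have -> : 6 * W + 1 + i - (6 * W).+1 = 0 + i by lia.
have -> : 1 + 6 * W + 1 + 6 * (2 * W) = (6 * W + 1 + 12 * W).+1 by lia.
rewrite [tr2 c e _]/tr2 -/W; have -> : (6 * W + 1 + 12 * W < 6 * W) = false by lia.
have -> : (6 * W + 1 + 12 * W == 6 * W) = false by lia.
by have -> : (6 * W + 1 + 12 * W < 3 * (6 * W) + 1) = false by lia.
Qed.

Lemma cycs_ext B n (y z : conf) : y =1 z -> cycs B n y =1 cycs B n z.
Proof. by move=> E; elim: n => //= n IH; do 6!apply: rstep_ext. Qed.

Lemma final_move y a : rstep tr2_final y a =
  let m := if H y a && odd (K y a) then (if dom (cs (y a)) is p.+1 then Some p else None) else None in
  moveto adj port (L y a) (ce (y a)) (cs (y a)) m.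
Proof. by rewrite rstepE. Qed.

Lemma moveto_cs (l : V) en (s : st2) m : cs (moveto adj port l en s m) = s.
Proof. by rewrite /moveto; case: m => // i; case: ifP. Qed.

Definition halting (y : conf) a := H y a && odd (K y a).

Definition elected c e x :=
  let x1 := cycs (c * e).+1 (cycles c e) (rstep tr2_init x) in [exists a, H x1 a && fin2 (cs (x1 a))].

(** Safety, in every epoch and from every configuration: a finished first traversal is itself the
    evidence that the second one has enough time, and without a winner all keys stay even. *)
Lemma phase2_fin c e x : let y := rrun (tr2 c e) 0 (len2 c e) x in
  if elected c e x then
    (forall a, halting y a) /\ maximal_independent adj [set v | [exists a, L y a == v]]
  else forall a, ~~ halting y a.
Proof.
move=> y; rewrite {}/y run2E /elected.
set W := cycles c e; set B := (c * e).+1; set x1 := cycs B W (rstep tr2_init x); cbv zeta.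
have [L0 J0 _] := init2 x; have [J1 st1] := cycs_inv B W J0; rewrite -/x1 in J1 st1.
have hE b : H x1 b = H (rstep tr2_init x) b by case: (st1 b).
case: ifP => [/existsP[a /andP[Ha fa]]|/negbT nf].
  have [hom _ _ _ [k0 k0W fin0]] := fin_all J1 hE Ha fa.
  have [J2 [lv nr] HL top tq] := switch_fin J1 hE Ha fa.
  set x2 := rstep tr2_switch x1 in J2 lv nr HL top tq *; set q := (2 * id a).+1 in lv top tq.
  have homx2 u : exists2 b, H x2 b & L x2 b = u.
    by have [b] := hom u; exists b; have [h1 h2] := HL b; rewrite ?h1 ?h2.
  have sg : single x2 q (L x1 a) 0 by split=> //; left; exists a, 0.
  have sgn := single_cycs B (2 * W) J2 sg.
  have [J3 st3] := cycs_inv B (2 * W) J2.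
  set x3 := cycs B (2 * W) x2 in sgn J3 st3 *.
  have hom3 u : exists2 b, H x3 b & L x3 b = u.
    by have [b] := homx2 u; exists b; have [h1 h2] := st3 b; rewrite ?h1 ?h2.
  have allH := all_home hom3.
  have La : L x3 a = L x1 a by case: (st3 a) => _ ->; case: (HL a).
  rewrite -La in sgn fin0.
  have ia : id a = q./2 by rewrite /q; lia.
  (* The first traversal from the same node finished within its [2 * W] slots, and the second has
     now made [2 * W] steps unless it finished earlier. *)
  have [|k [fk M Kq]] := single_done J3 sgn (allH a) ia.
    by apply: dfin_mono fin0; rewrite add0n in k0W.
  have domE b : dom (cs (x3 b)) = dm (dfsn (L x3 a) k) (L x3 b).
    by have [_ _ ->] := m_key M (allH b) (Kq b (allH b)).
  have odd3 b : odd (K x3 b) by rewrite Kq // /q /= mul2n odd_double.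
  split; first by move=> b; rewrite /halting final_move moveto_cs allH odd3.
  have [mi md] := dfs_fin_mis adjS adjI portP conn fk.
  set D := dfsn (L x3 a) k in domE mi md.
  have LE b : L (rstep tr2_final x3) b = if dm D (L x3 b) is p.+1 then port (L x3 b) p else L x3 b.
    rewrite final_move allH odd3 /= -domE; case Ed: (dom _) => [//|p] /=.
    by rewrite domE in Ed; have [pd _] := md _ _ Ed; rewrite pd.
  have -> : [set v | [exists b, L (rstep tr2_final x3) b == v]] = [set v | dm D v == 0].
    apply/setP => v; rewrite !inE; apply/existsP/eqP => [[b /eqP <-]|dv].
      by rewrite LE; case Ed: (dm D (L x3 b)) => [|p] //; have [_ ] := md _ _ Ed.
    by have [b _ Lb] := hom3 v; exists b; rewrite LE Lb dv.
  split=> [u v|v]; rewrite !inE; first by move=> /eqP du /eqP dv; apply: mi.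
  case Ed: (dm D v) => [|p] // _; have [pd d0] := md _ _ Ed.
  by exists (port v p); rewrite ?inE ?d0 //; apply: (port_adj portP).
have sw b : rstep tr2_switch x1 b = x1 b.
  rewrite rstepE /tr2_switch; case: ifP => [hf|_]; last by case: (x1 b).
  by case/existsP: nf; exists b.
have [J3 _] := cycs_inv B (2 * W) J1.
move=> b; rewrite /halting (rstep_ext _ _ _ _ (cycs_ext B (2 * W) sw)) final_move moveto_cs.
apply/negP => /andP[Hb].
by have [_ [/negbTE -> _]] := i_key J3 Hb.
Qed.

(** Distinct positions make every agent a home, so the agent with the largest identifier holds the
    top key. *)
Lemma phase2_live c e x : injective (fun a => L x a) -> 0 < #|V| -> (forall a, id a < 2 ^ (c * e).+1) ->
  \sum_v deg v + #|V| + 2 * (c * e).+1 * #|V| < cycles c e ->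
  elected c e x.
Proof.
move=> Linj n0 idB le; set W := cycles c e in le *; set B := (c * e).+1 in idB le *.
have [L0 J0 lv0] := init2 x; set x0 := rstep tr2_init x in L0 J0 lv0 *.
have H0 a : H x0 a.
  rewrite /x0 rstepE /= maxo_view big_pred0 ?id_pos // => b.
  by apply/negP => /andP[ba /eqP /Linj E]; rewrite E eqxx in ba.
have hom0 u : exists2 b, H x0 b & L x0 b = u.
  have inj0 : injective (fun a => L x0 a) by move=> a b; rewrite !L0; apply: Linj.
  have : codom (fun a => L x0 a) =i predT.
    by apply/subset_cardP; rewrite ?card_codom ?card_ord //; apply/subsetP.
  by move=> /(_ u) /codomP [b ->]; exists b.
pose a := [arg max_(b > Ordinal n0) id b].
have mx b : id b <= id a by rewrite /a; case: arg_maxnP => // i _ h; apply: h.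
pose q := 2 * id a.
have key0 b : K x0 b <= q.
  have [[_ _ -> _ _] _] := lv0 b (H0 b); by rewrite leq_mul2l mx.
have [lva ra] := lv0 a (H0 a).
have P0 : prog adj port id B x0 q (L x0 a) 0.
  by right; exists a, 0; rewrite (negbTE ra).
have main n : (forall b, H (cycs B n x0) b -> K (cycs B n x0) b <= q) /\ prog adj port id B (cycs B n x0) q (L x0 a) n.
  elim: n => // n [top P]; have [Jn stn] := cycs_inv B n J0.
  have homn u : exists2 b, H (cycs B n x0) b & L (cycs B n x0) b = u.
    by have [b] := hom0 u; exists b; have [h1 h2] := stn b; rewrite ?h1 ?h2.
  split; last exact: (cyc_prog adjS adjI portP id_inj idB Jn top homn P).
  have [S J1] := slot_inv adjS adjI portP false (code B n) Jn.
  have [S' J2] := slot_inv adjS adjI portP true (code B n) J1.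
  exact: (top_next S' (top_next S top)).
have [_ PW] := main W.
have [b [Hb _ fb]] := prog_bound adjS adjI portP id_inj idB PW le.
by apply/existsP; exists b; apply/andP.
Qed.
End Phase2.

(** * The complete algorithm *)

(** [k] is fuel; a number never has more digits than its value, hence the calls [bits n n]. *)
Fixpoint bits k n := if k is k'.+1 then
  if n == 0 then [::] else odd n :: bits k' n./2 else [::].

Definition unbits := foldr (fun (b : bool) n => b + n.*2) 0.

Lemma bitsK k n : n <= k -> unbits (bits k n) = n.
Proof.
elim: k n => [|k IH] [|n] //= nk; have h := odd_double_half n.
have hu := uphalf_half n; rewrite IH; rewrite -!mul2n in h *; lia.
Qed.

Lemma size_bits k n j : n < 2 ^ j -> size (bits k n) <= j.
Proof.
elim: k n j => //= k IH [|n] [|j] //=; rewrite ?ltnS ?expn0 // => le.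
apply: IH; rewrite expnS in le; have := odd_double_half n; rewrite uphalf_half -mul2n; case: odd => /=; lia.
Qed.

Definition dup (s : seq bool) := flatten [seq [:: true; b] | b <- s].

Lemma dup_inj s t r r' : dup s ++ false :: r = dup t ++ false :: r' -> s = t /\ r = r'.
Proof.
elim: s t => [|b s IH] [|b' t] //= [] => [->|-> /IH [-> ->]] //.
Qed.

(* Each number is written in binary, its bits marked by [true], and closed by [false]. *)
Definition encode_nats (l : seq nat) := flatten [seq rcons (dup (bits n n)) false | n <- l].

Lemma encode_nats_inj l l' : size l = size l' -> encode_nats l = encode_nats l' -> l = l'.
Proof.
elim: l l' => [|n l IH] [|n' l'] //= [sz]; rewrite /encode_nats /= !cat_rcons.
case/dup_inj=> E /(IH _ sz) ->; congr (_ :: _).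
by rewrite -(bitsK (leqnn n)) E bitsK.
Qed.

Lemma size_dup s : size (dup s) = 2 * size s.
Proof. by elim: s => //= b s; rewrite /dup => ->; rewrite mulnS. Qed.

Lemma size_encode_nats j l : all (fun n => n < 2 ^ j) l -> size (encode_nats l) <= size l * (2 * j).+1.
Proof.
elim: l => //= n l IH /andP[nj /IH le].
have -> : encode_nats (n :: l) = rcons (dup (bits n n)) false ++ encode_nats l by [].
rewrite size_cat size_rcons size_dup mulSn.
have h : 2 * size (bits n n) < (2 * j).+1 by rewrite ltnS leq_mul2l size_bits.
exact: leq_add h le.
Qed.

Record agent := Agent { uid : nat; epo : nat; clk : nat; sp1 : st1; sp2 : st2 }.

Definition fields1 (s : st1) : seq nat :=
  let c := co s in let t := tm s in let w := wk s in
  [:: hom c : nat; lab c; par c; chd c; frz c : nat; idx t; best t; out t; en1 t; dec t; fwd t : nat;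
      md w : nat; wl w; wmx w].

Definition fields2 (s : st2) : seq nat :=
  [:: hm s : nat; key s; pr2 s; ptr s; dom s; tok s : nat; rty s : nat; out2 s; en2 s; fin2 s : nat].

Definition fields (s : agent) := [:: uid s; epo s; clk s] ++ fields1 (sp1 s) ++ fields2 (sp2 s).

Lemma size_fields s : size (fields s) = 27. Proof. by []. Qed.

Lemma fields_inj s s' : fields s = fields s' -> s = s'.
Proof.
have bi (b b' : bool) : b = b' :> nat -> b = b' by case: b; case: b'.
case: s => u e t [[? ? ? ? ?] [? ? ? ? ? ?] [? ? ?]] [? ? ? ? ? ? ? ? ? ?].
case: s' => u' e' t' [[? ? ? ? ?] [? ? ? ? ? ?] [? ? ?]] [? ? ? ? ? ? ? ? ? ?].
case; do 3!move=> ->.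
move=> /bi-> -> -> -> /bi-> -> -> -> -> -> /bi-> /bi-> -> ->.
by move=> /bi-> -> -> -> -> /bi-> /bi-> -> -> /bi->.
Qed.

Definition encode_agent s := encode_nats (fields s).

Lemma encode_agent_inj : injective encode_agent.
Proof. by move=> s s' /encode_nats_inj E; apply: fields_inj; apply: E; rewrite !size_fields. Qed.

Definition zero1 := S1 (Core false 0 0 0 false) (Tmp 0 0 0 0 0 false) (Wlk false 0 0).
Definition zero2 := S2 false 0 0 0 0 false false 0 0 false.

Definition act_of (m : option nat) := if m is Some p then Move p else Stay.

Definition len1 e := e.+1 * phaseL e.

(** Each part has its own registers and overwrites them in its first round, so nothing is carried
    over from a failed epoch. The last round of an epoch is the verdict: an odd key means halt. *)
Definition agent_step c (s : agent) d en (oth : seq agent) : agent * action :=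
  let e := epo s in
  if clk s < len1 e then
    let r := tr1 e (clk s %% phaseL e) (uid s) (sp1 s) d en [seq (uid o, sp1 o) | o <- oth] in
    (Agent (uid s) e (clk s).+1 r.1 (sp2 s), act_of r.2)
  else if clk s < len1 e + len2 c e then
    let r := tr2 c e (clk s - len1 e) (uid s) (sp2 s) d en [seq (uid o, sp2 o) | o <- oth] in
    (Agent (uid s) e (clk s).+1 (sp1 s) r.1, act_of r.2)
  else if hm (sp2 s) && odd (key (sp2 s)) then (s, Halt)
  else (Agent (uid s) e.+1 0 (sp1 s) (sp2 s), Stay).

Definition election c : algorithm :=
  Algorithm encode_agent_inj (fun u => Agent u 0 0 zero1 zero2) (agent_step c).

(** * Growth of the registers *)

Section Bounds.
Variable F : nat.
Hypothesis F0 : 0 < F.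

Definition bnd G (l : seq nat) := all (fun n => n <= G) l.

Lemma maxo_all T (P : pred (nat * T)) f s G : all P s -> (forall o, P o -> f o <= G) -> maxo f s <= G.
Proof.
move=> al h; rewrite /maxo; elim: s al => [|o s IH] /=; first by rewrite big_nil.
by case/andP=> po al; rewrite big_cons geq_max h //= IH.
Qed.


(** The identifier is bounded with a factor two because keys have the form [2 * id] or
    [2 * id + 1]. *)
Definition ok1 (o : nat * st1) := bnd F (fields1 o.2) && (2 * o.1 < F).
Definition ok2 (o : nat * st2) := bnd F (fields2 o.2) && (2 * o.1 < F).

Lemma maxo1 f oth : all ok1 oth -> (forall o, ok1 o -> f o <= F) -> maxo f oth <= F.
Proof. exact: maxo_all. Qed.

Lemma leq_b1' (b : bool) G : 0 < G -> b <= G.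
Proof. by case: b. Qed.

Lemma ok1E u c t w : ok1 (u, S1 c t w) -> [/\ [/\ lab c <= F, par c <= F & chd c <= F],
  [/\ idx t <= F, best t <= F, out t <= F, en1 t <= F & dec t <= F], wl w <= F, wmx w <= F & 2 * u < F].
Proof. by case/andP=> /and5P[_ ? ? ? /and5P[_ ? ? ? /and5P[? ? _ _ /and3P[? ? _]]]] ?. Qed.

Variables (u d : nat) (en : option nat) (oth : seq (nat * st1)) (s : st1).
Hypothesis uF : 2 * u < F.
Hypothesis dF : d <= F.
Hypothesis enF : odflt 0 en < F.
Hypothesis othF : all ok1 oth.
Hypothesis sF : bnd F (fields1 s).

Lemma maxo1_if (b : nat * st1 -> bool) f : (forall o, ok1 o -> f o <= F) ->
  maxo (fun o => if b o then f o else 0) oth <= F.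
Proof. by move=> h; apply: (maxo1 othF) => o /h; case: (b o). Qed.

Ltac bound_maxo f :=
  first [apply: maxo1_if | apply: (maxo1 othF)];
  case=> v [c t w] /ok1E [[h1 h2 h3] [h4 h5 h6 h7 h8] h9 h10 h11];
  cbn [co tm wk lab par chd idx best out en1 dec wl wmx fst snd];
  first [done | lia].

Ltac bound_maxos :=
  unfold fwlab, slab; cbv zeta;
  repeat (let m := fresh "m" in let le := fresh "le" in
  match goal with |- context [maxo ?f ?o] =>
    have le : maxo f o <= F; [ bound_maxo f | move: (maxo f o) le => m le ] end).

Lemma fields1_le G s' : 0 < G ->
  [/\ lab (co s') <= G, par (co s') <= G & chd (co s') <= G] ->
  [/\ idx (tm s') <= G, best (tm s') <= G, out (tm s') <= G, en1 (tm s') <= G & dec (tm s') <= G] ->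
  wl (wk s') <= G -> wmx (wk s') <= G -> bnd G (fields1 s').
Proof.
move=> G0 [h1 h2 h3] [h4 h5 h6 h7 h8] h9 h10.
by rewrite /bnd /fields1 /= !leq_b1' // h1 h2 h3 h4 h5 h6 h7 h8 h9 h10.
Qed.

Lemma bnd_next (G : nat) l : bnd F l -> F <= G -> bnd G l.
Proof. by move=> h FG; apply: sub_all h => n /leq_trans; apply. Qed.

Let sE : [/\ [/\ lab (co s) <= F, par (co s) <= F & chd (co s) <= F],
  [/\ idx (tm s) <= F, best (tm s) <= F, out (tm s) <= F, en1 (tm s) <= F & dec (tm s) <= F], wl (wk s) <= F & wmx (wk s) <= F].
Proof. by case: s sF => c t w h; case: (@ok1E 0 c t w) => [|*]; [rewrite /ok1 h|]. Qed.

Let same : bnd F.+1 (fields1 s). Proof. exact: bnd_next sF (leqnSn F). Qed.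

Ltac bound_fields :=
  have [[? ? ?] [? ? ? ? ?] ? ?] := sE; repeat (case: ifP => _); cbn [fst];
  match goal with |- is_true (bnd _ (fields1 s)) => exact same | _ =>
  apply: fields1_le; cbn [co tm wk lab par chd idx best out en1 dec wl wmx]; try split;
  move: uF dF enF; clear uF dF enF othF sF sE same; lia end.

Ltac bnd1 := bound_maxos; bound_fields.

Lemma bnd_dec : bnd F.+1 (fields1 (tr_dec u s d en oth).1).
Proof. rewrite /tr_dec; bnd1. Qed.

Lemma bnd_init1 : bnd F.+1 (fields1 (tr_init u s d en oth).1).
Proof. by rewrite /tr_init; bound_maxos; case: (oth) => [|? ?]; bound_fields. Qed.

Lemma bnd_go k : bnd F.+1 (fields1 (tr_go k u s d en oth).1).
Proof.
rewrite /tr_go; case: ifP => [/andP[_ pd]|_]; last exact: same.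
bnd1.
Qed.

Lemma bnd_look : bnd F.+1 (fields1 (tr_look u s d en oth).1).
Proof. rewrite /tr_look; bnd1. Qed.
Lemma bnd_back : bnd F.+1 (fields1 (tr_back u s d en oth).1).
Proof. rewrite /tr_back; bnd1. Qed.
Lemma bnd_act : bnd F.+1 (fields1 (tr_act u s d en oth).1).
Proof. rewrite /tr_act; case E: (dec (tm s)) => [|p]; bnd1. Qed.
Lemma bnd_look2 : bnd F.+1 (fields1 (tr_look2 u s d en oth).1).
Proof. rewrite /tr_look2; bnd1. Qed.
Lemma bnd_res : bnd F.+1 (fields1 (tr_res u s d en oth).1).
Proof. rewrite /tr_res; bnd1. Qed.
Lemma bnd_walk k : bnd F.+1 (fields1 (tr_walk k u s d en oth).1).
Proof.
rewrite /tr_walk; set hu := maxo (fun o => if hom (co o.2) then o.1 else 0) oth.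
(* The generic bound [hu <= F] would let the key double in a round. *)
have : 2 * hu < F.
  suff : hu <= F.-1./2 by move: F0; clear; lia.
  by apply: (maxo_all othF) => o /andP[_]; case: ifP => _; lia.
move: hu => hu huF; bound_maxos; case: (_ || md _); bound_fields.
Qed.
(** Registers are copied, read off others, or set from a port or a key, so the common bound rises by
    at most one per round. Over polynomially many rounds this keeps them polynomial. *)
Lemma bnd_tr1 e tau : bnd F.+1 (fields1 (tr1 e tau u s d en oth).1).
Proof.
case: tau => [|t]; first exact: bnd_init1.
rewrite /tr1; case: ifP => _; last exact: bnd_walk.
rewrite /tr_macro; case: ifP => _.
  by case: (_ %% 3) => [|[|?]]; [apply: bnd_go|apply: bnd_look|apply: bnd_back].
by case: (_ - _) => [|[|[|?]]]; [apply: bnd_dec|apply: bnd_act|apply: bnd_look2|apply: bnd_res].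
Qed.
End Bounds.

Section Bounds2.
Variable F : nat.
Hypothesis F0 : 0 < F.
Notation ok2 := (ok2 F).

Lemma ok2E u s : ok2 (u, s) -> [/\ [/\ key s <= F, pr2 s <= F & ptr s <= F], dom s <= F, out2 s <= F, en2 s <= F & 2 * u < F].
Proof. by case/andP=> /and5P[_ ? ? ? /and5P[? _ _ ? /and3P[? _ _]]] ?. Qed.

Variables (u d : nat) (en : option nat) (oth : seq (nat * st2)) (s : st2).
Hypothesis uF : 2 * u < F.
Hypothesis enF : odflt 0 en < F.
Hypothesis othF : all ok2 oth.
Hypothesis sF : bnd F (fields2 s).

Lemma maxo2_if (b : nat * st2 -> bool) f : (forall o, ok2 o -> f o <= F) ->
  maxo (fun o => if b o then f o else 0) oth <= F.
Proof. by move=> h; apply: (maxo_all othF) => o /h; case: (b o). Qed.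

Ltac bound_maxo2 f :=
  first [apply: maxo2_if | apply: (maxo_all othF)];
  case=> ? ? /ok2E [[? ? ?] ? ? ? ?]; cbn [fst snd]; first [done | lia].

Ltac bound_maxos2 :=
  cbv beta zeta;
  repeat (let m := fresh "m" in let le := fresh "le" in
  match goal with |- context [maxo ?f ?o] =>
    have le : maxo f o <= F; [ bound_maxo2 f | move: (maxo f o) le => m le ] end).

Lemma fields2_le G s' : 0 < G ->
  [/\ [/\ key s' <= G, pr2 s' <= G & ptr s' <= G], dom s' <= G, out2 s' <= G & en2 s' <= G] ->
  bnd G (fields2 s').
Proof. by move=> G0 [[h1 h2 h3] h4 h5 h6]; rewrite /bnd /fields2 /= !leq_b1' // h1 h2 h3 h4 h5 h6. Qed.

Let sE : [/\ [/\ key s <= F, pr2 s <= F & ptr s <= F], dom s <= F, out2 s <= F & en2 s <= F].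
Proof. by case: (@ok2E 0 s) => [|h1 h2 h3 h4 _]; [rewrite /ok2 sF|]. Qed.

Let same : bnd F.+1 (fields2 s). Proof. exact: bnd_next sF (leqnSn F). Qed.

Ltac bound_fields2 :=
  have [[? ? ?] ? ? ?] := sE; repeat (case: ifP => _); cbn [fst];
  match goal with |- is_true (bnd _ (fields2 s)) => exact same | _ =>
  apply: fields2_le; cbn [key pr2 ptr dom out2 en2 set_out]; try split; try split;
  move: uF enF; clear uF enF othF sF sE same; lia end.

Lemma bnd_tr2 c e tau : bnd F.+1 (fields2 (tr2 c e tau u s d en oth).1).
Proof.
have go slow bit : bnd F.+1 (fields2 (tr2_go slow bit u s d en oth).1).
  by rewrite /tr2_go; case E: (pr2 s) => [|p]; rewrite -?E; bound_fields2.
have rec : bnd F.+1 (fields2 (tr2_rec u s d en oth).1) by rewrite /tr2_rec; bound_fields2.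
have res : bnd F.+1 (fields2 (tr2_res u s d en oth).1).
  by rewrite /tr2_res; bound_maxos2; bound_fields2.
have stg B r : bnd F.+1 (fields2 (stage B r u s d en oth).1).
  by rewrite /stage /slot_tr; case: (_ %% 3) => [|[|?]].
have sw : bnd F.+1 (fields2 (tr2_switch u s d en oth).1) by rewrite /tr2_switch; bound_fields2.
have init : bnd F.+1 (fields2 (tr2_init u s d en oth).1) by rewrite /tr2_init; bound_fields2.
case: tau => [|r]; first exact: init.
rewrite /tr2; case: ifP => _; first exact: stg.
by case: ifP => _; [exact: sw|case: ifP => _; [exact: stg|exact: same]].
Qed.
End Bounds2.

(** * From the two sub-protocols to the complete agents *)

Section Compose.
Variables (V : finType) (adj : rel V) (port : V -> nat -> V).
Hypothesis adjS : symmetric adj.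
Hypothesis adjI : irreflexive adj.
Hypothesis portP : port_labeling adj port.
Hypothesis conn : connected_graph adj.
Notation deg := (deg adj).
Notation N := #|V|.
Variables (pos0 : 'I_N -> V) (id : 'I_N -> nat).
Hypothesis id_inj : injective id.
Hypothesis id_pos : forall a, 0 < id a.
Variable c : nat.
Notation A := (election c).
Notation conf := ('I_N -> agent_conf V A).
Notation stp := (step_agent adj port).
Notation rstep := (rstep adj port id).
Notation rrun := (rrun adj port id).
Notation run := (run adj port A pos0 id).

Definition proj S (f : agent -> S) (x : conf) a : cell V S := Cell (loc (x a)) (entry (x a)) (f (st (x a))).

Definition sync (x : conf) e t := forall a,
  [/\ uid (st (x a)) = id a, epo (st (x a)) = e, clk (st (x a)) = t & halted (x a) = false].

Fixpoint steps k (x : conf) : conf := if k is k'.+1 then (fun a => stp (steps k' x) a) else x.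

Lemma run_steps k t : run (t + k) = steps k (run t).
Proof. by elim: k => [|k IH]; rewrite ?addn0 ?addnS //= IH. Qed.

Lemma stepsD k k' x : steps (k + k') x = steps k' (steps k x).
Proof. by elim: k' => [|k' IH]; rewrite ?addn0 ?addnS //= IH. Qed.

Lemma view_others S (f : agent -> S) x e t a : sync x e t ->
  view id (proj f x) a = [seq (uid o, f o) | o <- others x a].
Proof.
move=> sy; rewrite /view /others -map_comp; apply: eq_map => b /=.
by have [-> _ _ _] := sy b.
Qed.

Lemma sync1 x e t : sync x e t -> t < len1 e ->
  sync (fun a => stp x a) e t.+1 /\
  proj sp1 (fun a => stp x a) =1 rstep (tr1 e (t %% phaseL e)) (proj sp1 x).
Proof.
move=> sy lt; suff h a : let y := stp x a in
  [/\ uid (st y) = id a, epo (st y) = e, clk (st y) = t.+1 & halted y = false] /\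
  Cell (loc y) (entry y) (sp1 (st y)) = rstep (tr1 e (t %% phaseL e)) (proj sp1 x) a.
  by split=> a; case: (h a).
have [ua ea ta ha] := sy a.
rewrite /step_agent ha /= /agent_step ea ta lt ua rstepE /= -(view_others sp1 a sy).
case: (tr1 _ _ _ _ _ _ _) => s' [p|] //=; by case: ifP.
Qed.

Lemma sync2 x e t : sync x e t -> len1 e <= t -> t < len1 e + len2 c e ->
  sync (fun a => stp x a) e t.+1 /\
  proj sp2 (fun a => stp x a) =1 rstep (tr2 c e (t - len1 e)) (proj sp2 x).
Proof.
move=> sy le lt; suff h a : let y := stp x a in
  [/\ uid (st y) = id a, epo (st y) = e, clk (st y) = t.+1 & halted y = false] /\
  Cell (loc y) (entry y) (sp2 (st y)) = rstep (tr2 c e (t - len1 e)) (proj sp2 x) a.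
  by split=> a; case: (h a).
have [ua ea ta ha] := sy a.
rewrite /step_agent ha /= /agent_step ea ta (ltnNge t (len1 e)) le lt ua rstepE /= -(view_others sp2 a sy).
case: (tr2 _ _ _ _ _ _ _ _) => s' [p|] //=; by case: ifP.
Qed.

Lemma run1 x e i k : sync x e (i * phaseL e) -> i < e.+1 -> k <= phaseL e ->
  sync (steps k x) e (i * phaseL e + k) /\ proj sp1 (steps k x) =1 rrun (tr1 e) 0 k (proj sp1 x).
Proof.
move=> sy ie; elim: k => [|k IH] kL; first by rewrite addn0.
have [sk Ek] := IH (ltnW kL).
have lt : i * phaseL e + k < len1 e.
  apply: (@leq_trans (i.+1 * phaseL e)); first by rewrite mulSn addnC ltn_add2r.
  by rewrite leq_mul2r ie orbT.
have [sk' Ek'] := sync1 sk lt; rewrite addnS; split=> // a.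
rewrite [LHS]Ek' /= add0n modnMDl modn_small //.
exact: rstep_ext.
Qed.

Lemma run2 x e k : sync x e (len1 e) -> k <= len2 c e ->
  sync (steps k x) e (len1 e + k) /\ proj sp2 (steps k x) =1 rrun (tr2 c e) 0 k (proj sp2 x).
Proof.
move=> sy; elim: k => [|k IH] kL; first by rewrite addn0.
have [sk Ek] := IH (ltnW kL).
have [||sk' Ek'] := sync2 sk; rewrite ?leq_addr ?ltn_add2l //.
rewrite addnS; split=> // a.
rewrite [LHS]Ek' /= add0n addKn.
exact: rstep_ext.
Qed.

Lemma piles_ext S S' (x : 'I_N -> cell V S) (y : 'I_N -> cell V S') :
  (forall a, cl (x a) = cl (y a)) -> piles x = piles y.
Proof.
move=> E; apply/setP => v; rewrite !inE; congr (1 < #|pred_of_set _|).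
by apply/setP => a; rewrite !inE E.
Qed.

Lemma phases x e i : #|V| <= 2 ^ e -> sync x e 0 -> i <= e.+1 ->
  sync (steps (i * phaseL e) x) e (i * phaseL e) /\
  2 ^ i * #|piles (proj sp1 (steps (i * phaseL e) x))| <= #|V|.
Proof.
move=> Ne sy; elim: i => [|i IH] ie.
  by rewrite mul0n mul1n; split=> //; apply: max_card.
have [sk le] := IH (ltnW ie); rewrite mulSnr stepsD.
have [sk' E] := run1 sk ie (leqnn _); split=> //.
apply: leq_trans le; rewrite expnSr -mulnA leq_mul2l; apply/orP; right.
rewrite (piles_ext (y := rrun (tr1 e) 0 (phaseL e) (proj sp1 (steps (i * phaseL e) x)))).
  exact: phase_halves.
by move=> a; rewrite -E.
Qed.

(** After [e + 1] halvings, [2 ^ e.+1] times the number of overcrowded nodes is at most [2 ^ e], so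
    there are none. *)
Lemma phases_inj x e : #|V| <= 2 ^ e -> sync x e 0 ->
  injective (fun a => loc (steps (len1 e) x a)).
Proof.
move=> Ne sy; have [_ le] := phases Ne sy (leqnn e.+1).
have p0 : #|piles (proj sp1 (steps (len1 e) x))| = 0.
  have : 2 ^ e < 2 ^ e.+1 by rewrite ltn_exp2l.
  by case: #|_| le => // p; rewrite mulnS; lia.
move=> a b E; apply/eqP; apply: contraT => ab.
move/eqP: p0; rewrite cards_eq0 => /eqP /setP /(_ (loc (steps (len1 e) x a))).
rewrite !inE => /negbT; rewrite -leqNgt => le1.
have : #|[set a; b]| <= 1.
  apply: leq_trans le1; apply: subset_leq_card; apply/subsetP => d.
  by rewrite !inE => /orP[] /eqP-> //=; rewrite E.
by rewrite cards2 ab.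
Qed.

Definition solved (x : conf) := (forall a, halted (x a)) /\ maximal_independent adj (occupied x).

Definition epochL e := len1 e + len2 c e + 1.

Lemma sync1_run x e k : sync x e 0 -> k <= len1 e -> sync (steps k x) e k.
Proof.
move=> sy; elim: k => //= k IH kL; have [s' _] := sync1 (IH (ltnW kL)) kL.
exact: s'.
Qed.

(** All agents halt or none does, so a failed epoch leaves them in step for the next one. The second
    conjunct is progress in a sufficiently large epoch. *)
Lemma epoch x e : sync x e 0 ->
  let y := steps (epochL e) x in
  (solved y \/ sync y e.+1 0) /\
  (#|V| <= 2 ^ e -> 0 < #|V| -> (forall a, id a < 2 ^ (c * e).+1) ->
   \sum_v deg v + #|V| + 2 * (c * e).+1 * #|V| < cycles c e -> solved y).
Proof.
move=> sy y; rewrite {}/y /epochL (stepsD _ 1) (stepsD (len1 e)).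
have s1 := sync1_run sy (leqnn _); set x1 := steps (len1 e) x in s1 *.
have [s2 E2] := run2 s1 (leqnn _); set x2 := steps (len2 c e) x1 in s2 E2 *.
have := phase2_fin adjS adjI portP conn id_inj id_pos c e (proj sp2 x1).
set b := elected _ _ _ _ _ _ => F.
have haltE a : halting (rrun (tr2 c e) 0 (len2 c e) (proj sp2 x1)) a =
    hm (sp2 (st (x2 a))) && odd (key (sp2 (st (x2 a)))).
  by rewrite /halting -E2.
have stpE a : stp x2 a = if halting (rrun (tr2 c e) 0 (len2 c e) (proj sp2 x1)) a then
    Defs.AC (loc (x2 a)) (st (x2 a) : state A) (entry (x2 a)) true
  else Defs.AC (loc (x2 a)) (Agent (uid (st (x2 a))) e.+1 0 (sp1 (st (x2 a))) (sp2 (st (x2 a))) : state A) (entry (x2 a)) false.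
  rewrite haltE /step_agent; have [_ ea ta ->] := s2 a; rewrite /= /agent_step ea ta ltnn.
  by rewrite (ltnNge _ (len1 e)) leq_addr /=; case: ifP.
have sol : b -> solved (steps 1 x2).
  move=> hb; rewrite hb in F; case: F => hl mi; split; first by move=> a /=; rewrite stpE hl.
  have -> : occupied (steps 1 x2) = [set v | [exists a, cl (rrun (tr2 c e) 0 (len2 c e) (proj sp2 x1) a) == v]].
    apply/setP => v; rewrite !inE; apply: eq_existsb => a /=.
    by rewrite stpE -E2; case: ifP.
  exact: mi.
split; last first.
  move=> Ne V0 idB bd; apply: sol; rewrite /b.
  by apply: (phase2_live adjS adjI portP id_inj id_pos) => //; apply: phases_inj.
case hb: b F => F; [left; exact: sol|right=> a].
by rewrite /= stpE (negbTE (F a)); have [-> _ _ _] := s2 a.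
Qed.
End Compose.

(** * A bound on all registers at a given time *)

Section Memory.
Variables (V : finType) (adj : rel V) (port : V -> nat -> V).
Hypothesis adjS : symmetric adj.
Hypothesis adjI : irreflexive adj.
Hypothesis portP : port_labeling adj port.
Notation deg := (deg adj).
Notation N := #|V|.
Variables (pos0 : 'I_N -> V) (id : 'I_N -> nat) (c : nat).
Notation run := (run adj port (election c) pos0 id).
Variable U : nat.
Hypothesis idU : forall a, id a <= U.

Let M := 2 * U + N + 1.

Let deg_M v : deg v < M.
Proof. by apply: leq_trans (deg_lt adjI v) _; rewrite /M addnAC leq_addl. Qed.

Lemma st_step (x : 'I_N -> agent_conf V (election c)) a : st (step_agent adj port x a) =
  if halted (x a) then st (x a) else
  (agent_step c (st (x a)) (deg (loc (x a))) (entry (x a)) (others x a)).1.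
Proof.
rewrite /step_agent /=; case: ifP => // _.
by case: (agent_step _ _ _ _ _) => s' [|i|] //=; case: ifP.
Qed.

Lemma entry_lt t a : odflt 0 (entry (run t a)) < M.
Proof.
elim: t a => [|t IH] a; first by rewrite /M addn1.
rewrite [run t.+1 a]/(step_agent adj port (run t) a) /step_agent /=; case: ifP => // _.
case: (agent_step _ _ _ _ _) => s' [|i|] //=; case: ifP => [id_|_] /=; last exact: IH.
have [lt _] := rport_back adjS portP id_.
exact: ltn_trans lt (deg_M _).
Qed.

Lemma uid_run t a : uid (st (run t a)) = id a.
Proof.
elim: t a => [|t IH] a //.
rewrite [run t.+1 a]/(step_agent adj port (run t) a) st_step; case: ifP => // _.
by rewrite /agent_step; do 3 (case: ifP => _ //=).
Qed.

Lemma run_bnd t a : bnd (M + t) (fields (st (run t a))).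
Proof.
elim: t a => [|t IH] a.
  have := idU a; rewrite /= /bnd /M => le /=; rewrite !andbT; lia.
set F := M + t in IH; have F0 : 0 < F by rewrite /F /M addn1.
have FM : M <= F by apply: leq_addr.
have FS : F.+1 = M + t.+1 by rewrite addnS.
have split3 b : bnd F (fields1 (sp1 (st (run t b)))) /\ bnd F (fields2 (sp2 (st (run t b)))).
  by have := IH b; rewrite /fields /bnd !all_cat => /and3P[].
have idF b : 2 * id b < F by have := idU b; move: FM; rewrite /M; lia.
rewrite -FS [run t.+1 a]/(step_agent adj port (run t) a) st_step.
have same : bnd F.+1 (fields (st (run t a))) by apply: bnd_next (IH a) _.
case: ifP => _ //.
have dF : deg (loc (run t a)) <= F.
  exact: ltnW (leq_trans (deg_M _) FM).
have all1 : all (ok1 F) [seq (uid o, sp1 o) | o <- others (run t) a].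
  rewrite !all_map; apply/allP => b _ /=; rewrite /ok1 uid_run idF andbT.
  by case: (split3 b).
have all2 : all (ok2 F) [seq (uid o, sp2 o) | o <- others (run t) a].
  rewrite !all_map; apply/allP => b _ /=; rewrite /ok2 uid_run idF andbT.
  by case: (split3 b).
have eF : odflt 0 (entry (run t a)) < F by apply: leq_trans (entry_lt t a) FM.
have [b1 b2] := split3 a; have uF := idF a.
have b1' : bnd F.+1 (fields1 (sp1 (st (run t a)))) by apply: bnd_next b1 _.
have b2' : bnd F.+1 (fields2 (sp2 (st (run t a)))) by apply: bnd_next b2 _.
have intro u e k s1 s2 : u <= F.+1 -> e <= F.+1 -> k <= F.+1 -> bnd F.+1 (fields1 s1) ->
    bnd F.+1 (fields2 s2) -> bnd F.+1 (fields (Agent u e k s1 s2)).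
  by move=> h1 h2 h3 h4 h5; rewrite /fields /bnd !all_cat [all _ (fields1 _)]h4 [all _ (fields2 _)]h5 /= h1 h2 h3.
have [uF1 [eF1 kF1]] : uid (st (run t a)) <= F /\ epo (st (run t a)) <= F /\ clk (st (run t a)) <= F.
  by have := IH a; rewrite /fields /bnd all_cat => /andP[/and4P[]].
rewrite /agent_step uid_run; rewrite uid_run in uF1; case: ifP => _.
  by apply: intro => //; [exact: leqW|exact: leqW|exact: bnd_tr1].
case: ifP => _; first by apply: intro => //; [exact: leqW|exact: leqW|exact: bnd_tr2].
by case: ifP => _ //; apply: intro => //; exact: leqW.
Qed.
End Memory.

(** * Lengths of the epochs and the final accounting *)

Definition quota e := 2 ^ e * e.+1 ^ 2.

Lemma quota_gt0 e : 0 < quota e.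
Proof. by rewrite muln_gt0 !expn_gt0. Qed.

(** The constant is [18 * (2 * c + 7)] for the two traversals, 15 for the dispersion, and 4 for
    isolated rounds. *)
Lemma epochL_le c e : epochL c e <= (36 * c + 145) * quota e.
Proof.
have q0 := quota_gt0 e.
have -> : epochL c e = e.+1 * (2 * 2 ^ e * (3 * e + 4) + 3 * (2 * 2 ^ e)).+1 + 18 * (2 * c + 7) * quota e + 4.
  by rewrite /epochL /len1 /len2 /phaseL /walkL /macroL /cycles /quota; lia.
have : e.+1 * (2 * 2 ^ e * (3 * e + 4) + 3 * (2 * 2 ^ e)).+1 <= 15 * quota e.
  have : 0 < 2 ^ e by rewrite expn_gt0.
  rewrite /quota -mulnn; move: (2 ^ e) => p p0; nia.
nia.
Qed.

(** Geometric growth: for [k = e.+1] the bound is [2 * quota e], so all epochs together cost about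
    twice the last. *)
Lemma sum_quota k : \sum_(e < k) quota e <= 2 ^ k * k ^ 2.
Proof.
elim: k => [|k IH]; first by rewrite big_ord0.
rewrite big_ord_recr /= expnS; apply: (@leq_trans (2 ^ k * k ^ 2 + quota k)); first by rewrite leq_add2r.
rewrite /quota -!mulnn; move: (2 ^ k) => p; nia.
Qed.

(** The preceding epoch was too small for [n] or for [m]. One epoch later, [2 ^ e] has doubled and
    the squared factor has grown at most fourfold, whence 8. *)
Lemma minimal_quota n m e : 0 < n -> (forall e', (n <= 2 ^ e') && (m <= quota e') -> e <= e') ->
  quota e <= 8 * maxn (n * lg n ^ 2) m.
Proof.
move=> n0 mn; have l0 : 0 < lg n by [].
case: e mn => [|e] mn.
  have -> : quota 0 = 1 by [].
  by rewrite muln_gt0 leq_max muln_gt0 n0 expn_gt0 l0.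
have : ~~ ((n <= 2 ^ e) && (m <= quota e)) by apply/negP => /mn; rewrite ltnn.
rewrite negb_and -!ltnNge => /orP[lt|lt].
  have el : e < lg n by rewrite /lg ltnS; apply: trunc_log_max => //; apply: ltnW.
  apply: (@leq_trans (8 * (n * lg n ^ 2))); last by rewrite leq_mul2l leq_maxl orbT.
  have h1 : e.+2 ^ 2 <= (2 * lg n) ^ 2 by rewrite leq_exp2r //; move: el; clear; lia.
  have := leq_mul (ltnW lt) h1; rewrite /quota [2 ^ e.+1]expnS expnMn -[2 ^ 2]/4.
  by move: (e.+2 ^ 2) (lg n ^ 2) (2 ^ e) => x y p; clear; nia.
apply: (@leq_trans (8 * m)); last by rewrite leq_mul2l leq_maxr orbT.
by move: lt; rewrite /quota [2 ^ e.+1]expnS -!mulnn; move: (2 ^ e) => p; clear; nia.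
Qed.

(** [num_edges] is a rounded half of the number of ordered adjacent pairs; the successor absorbs the
    rounding. *)
Lemma sum_deg (V : finType) (adj : rel V) : \sum_v deg adj v <= (2 * num_edges adj).+1.
Proof.
have -> : \sum_v deg adj v = #|[pred e : V * V | adj e.1 e.2]|.
  rewrite -sum1_card (eq_bigr (fun v => \sum_(w | adj v w) 1)); last by move=> v _; rewrite /deg -sum1_card.
  by rewrite (pair_big_dep predT (fun v w => adj v w) (fun _ _ => 1)) /=; apply: eq_bigl => -[].
by rewrite /num_edges; move: #|_| => k; lia.
Qed.

Lemma num_edges_le (V : finType) (adj : rel V) : num_edges adj <= #|V| ^ 2.
Proof.
apply: leq_trans (leq_div _ _) _; rewrite -mulnn -card_prod; exact: max_card.
Qed.

Lemma lg_le n : 0 < n -> lg n <= n.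
Proof. by move=> n0; apply: leq_trans (ltn_expl _ _) (trunc_logP _ _). Qed.

Theorem theorem1 :
  forall c : nat,
  exists (A : algorithm) (C : nat),
  forall (V : finType) (adj : rel V) (port : V -> nat -> V)
         (pos0 : 'I_#|V| -> V) (id : 'I_#|V| -> nat),
    simple_graph adj ->
    connected_graph adj ->
    port_labeling adj port ->
    injective id ->
    (forall a, 1 <= id a <= #|V| ^ c) ->
    exists T : nat,
      T <= C * maxn (#|V| * lg #|V| ^ 2) (num_edges adj) /\
      solves_D2D_at adj port A pos0 id T /\
      (forall (t : nat) (a : 'I_#|V|),
         size (encode (st (run adj port A pos0 id t a))) <= C * lg #|V|).
Proof.
(* In [C1], the factor 16 is 2 for summing the epochs times 8 from [minimal_quota]. In [K0], the 4
   covers [2 * n ^ c + n + 1] and [C1] covers the time, both in units of [n ^ (c + 3)]. *)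
move=> c; pose C1 := 16 * (36 * c + 145); pose K0 := 4 + C1.
(* An agent has 27 registers; a number below [2 ^ j] is written with at most [2 * j + 1] bits, and
   [j] will be at most [(K0 + (c + 3)) * lg n]. *)
pose C2 := 27 * (2 * (K0 + (c + 3))).+1.
exists (election c), (C1 + C2) => V adj port pos0 id [adjS adjI] conn portP id_inj id_rng.
set n := #|V|; set m := num_edges adj.
case: (posnP n) => [n0|n0].
  have noA (a : 'I_n) : False by case: (a) => i; rewrite n0.
  have noV (v : V) : False by have := n0; rewrite /n (cardD1 v) inE.
  by exists 0; split; last (split; [split=> [a|]; [case: (noA a)|split=> u; case: (noV u)]|move=> t a; case: (noA a)]).
have id_pos a : 0 < id a by case/andP: (id_rng a).
have id_le a : id a <= n ^ c by case/andP: (id_rng a).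
pose good e := (n <= 2 ^ e) && (m <= quota e).
have good_ex : exists e, good e.
  exists (n + m); rewrite /good expnD; apply/andP; split.
    by apply: leq_trans (ltnW (ltn_expl n (ltnSn 1))) _; rewrite leq_pmulr // expn_gt0.
  rewrite /quota expnD; apply: leq_trans (ltnW (ltn_expl m (ltnSn 1))) _.
  by rewrite mulnAC leq_pmull // muln_gt0 !expn_gt0.
case: (ex_minnP good_ex) => e /andP[ne me] emin.
pose S k := \sum_(i < k) epochL c i.
pose r t := run adj port (election c) pos0 id t.
have epochs k : sync id (r (S k)) k 0 \/ exists2 t, t <= S k & solved adj (r t).
  elim: k => [|k [sy|[t tS sol]]].
  - by left; rewrite /S big_ord0.
  - have SE : S k.+1 = S k + epochL c k by rewrite /S big_ord_recr.
    have [h _] := epoch adjS adjI portP conn id_inj id_pos sy.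
    rewrite SE /r run_steps; case: h => h; last by left.
    by right; exists (S k + epochL c k); rewrite // run_steps.
  by right; exists t => //; apply: leq_trans tS _; rewrite /S big_ord_recr leq_addr.
have [T TS [Thalt Tmis]] : exists2 t, t <= S e.+1 & solved adj (r t).
  have SE : S e.+1 = S e + epochL c e by rewrite /S big_ord_recr.
  case: (epochs e) => [sy|[t tS sol]]; last by exists t; rewrite // SE; apply: leq_trans tS (leq_addr _ _).
  have [_ h] := epoch adjS adjI portP conn id_inj id_pos sy.
  exists (S e.+1) => //; rewrite SE /r run_steps; apply: h => //.
    move=> a; apply: leq_ltn_trans (id_le a) _; rewrite expnS mulnC.
    apply: (@leq_ltn_trans (2 ^ (c * e))); last by rewrite -{1}[2 ^ _]muln1 ltn_pmul2l // expn_gt0.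
    by rewrite mulnC expnM; case: (c) => // c'; rewrite leq_exp2r.
  have h1 : n <= quota e by apply: leq_trans ne _; rewrite leq_pmulr // expn_gt0.
  have h2 : (c * e).+1 * n <= (c + 1) * quota e.
    rewrite /quota [2 ^ e * _]mulnC mulnA; apply: leq_mul ne.
    by rewrite -mulnn; clear; nia.
  have := sum_deg adj; rewrite -/m -/n /cycles -[_ * 2 ^ e * _]mulnA -/(quota e) -mulnA.
  by move: (\sum_v _) (_ * n) (quota_gt0 e) me h1 h2; move: (quota e) => p D w; clear; nia.
have TC : T <= C1 * maxn (n * lg n ^ 2) m.
  apply: leq_trans TS _; apply: (@leq_trans ((36 * c + 145) * (2 * quota e))).
    apply: (@leq_trans (\sum_(i < e.+1) (36 * c + 145) * quota i)).
      by apply: leq_sum => i _; apply: epochL_le.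
    rewrite -big_distrr leq_mul2l; apply/orP; right.
    by apply: leq_trans (sum_quota e.+1) _; rewrite [2 ^ e.+1]expnS -mulnA.
  have := minimal_quota n0 emin; rewrite /C1.
  move: (maxn _ _) (quota e) => x y; clear; nia.
exists T; split; first by apply: leq_trans TC _; rewrite leq_mul2r leq_addr orbT.
split; first by split.
move=> t a.
(* The register bound grows with time, but halted agents keep their state, so rounds after [T]
   reduce to [T]. *)
have [t' t'T ->] : exists2 t', t' <= T & st (r t a) = st (r t' a).
  case: (leqP t T) => [le|lt]; first by exists t.
  exists T => //; rewrite -(subnKC (ltnW lt)); elim: (t - T) => [|k IH]; rewrite ?addn0 //.
  have hk j : halted (r (T + j) a).
    elim: j => [|j hj]; rewrite ?addn0 // addnS /r /= /step_agent.
    by rewrite -/(r (T + j)) hj.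
  by rewrite addnS /r /= /step_agent -/(r (T + k)) hk.
have bd := run_bnd adjS adjI portP pos0 c id_le t' a.
pose j := K0 + lg n * (c + 3).
have Mj : 2 * n ^ c + n + 1 + t' < 2 ^ j.
  have nL : n < 2 ^ lg n by apply: trunc_log_ltn.
  have pw i : i <= c + 3 -> n ^ i <= n ^ (c + 3) by move=> le; apply: leq_pexp2l.
  have le1 : maxn (n * lg n ^ 2) m <= n ^ (c + 3).
    rewrite geq_max; apply/andP; split.
      apply: leq_trans (pw 3 _); last by rewrite leq_addl.
      by rewrite [n ^ 3]expnS leq_mul2l leq_exp2r ?lg_le ?orbT.
    apply: leq_trans (num_edges_le adj) (pw 2 _); by rewrite addnC.
  apply: (@leq_ltn_trans (K0 * n ^ (c + 3))).
    have := pw c (leq_addr _ _); have := pw 1 _; have := pw 0 (leq0n _).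
    rewrite expn0 expn1 addn3 => h0 /(_ isT) h1 hc.
    have := leq_trans t'T TC; have := leq_mul (leqnn C1) le1; rewrite /K0 addn3.
    move: (maxn _ _) h0 h1 hc => x; move: (n ^ c) (n ^ c.+3) => y z; clear; nia.
  rewrite /j (expnD 2 K0) (expnM 2 (lg n)); apply: (@leq_trans (2 ^ K0 * n ^ (c + 3))).
    by rewrite ltn_pmul2r ?expn_gt0 ?n0 // ltn_expl.
  by rewrite leq_mul2l leq_exp2r ?(ltnW nL) ?orbT // addn3.
have -> : encode (st (r t' a)) = encode_nats (fields (st (r t' a))) by [].
apply: leq_trans (size_encode_nats (j := j) _) _.
  by apply: sub_all bd => x /leq_ltn_trans; apply.
rewrite size_fields /j.
have l0 : 0 < lg n by [].
rewrite /C2; move: (lg n) l0 => l; clear; nia.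
Qed.
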